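(* Let $G$ be a connected, simply-connected solvable (real) Lie group. Then the algebraic hull $\mathrm{Ad}(G)_{alg}$, acting on $G$ by automorphisms, fixes the center $Z(G)$ pointwise.
   Context: Let $\mathfrak{g}=\mathrm{Lie}(G)$ and let $\mathrm{Ad}:G\to GL(\mathfrak{g})$ be the adjoint representation. The algebraic hull $\mathrm{Ad}(G)_{alg}\subset GL(\mathfrak{g})$ is the smallest real algebraic subgroup of $GL(\mathfrak{g})$ (i.e. subgroup definable by polynomial equations) containing $\mathrm{Ad}(G)$. It consists of Lie algebra automorphisms of $\mathfrak{g}$. Since $G$ is connected and simply-connected, each Lie algebra automorphism of $\mathfrak{g}$ integrates uniquely to a Lie group automorphism of $G$, and $\mathrm{Ad}(G)_{alg}$ acts on $G$ in this manner. *)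

(* Defs.v *)
From HB Require Import structures.
From mathcomp Require Import all_boot all_order all_algebra.
From mathcomp Require Import all_classical all_reals all_analysis.
From mathcomp Require mpoly.

Set Implicit Arguments.
Unset Strict Implicit.
Unset Printing Implicit Defensive.

Import Order.TTheory GRing.Theory Num.Theory.
Import numFieldNormedType.Exports.

Local Open Scope classical_set_scope.
Local Open Scope ring_scope.

Section Smoothness.
Context {R : realType} {V W : normedModType R}.

(* Meant for open [U] and finite-dimensional [V], where continuity of
   [x |-> 'd f x] amounts to continuity of [x |-> 'd f x v] for each [v] *)
Fixpoint Ck_on (k : nat) (U : set V) (f : V -> W) : Prop :=
  if k is k'.+1 then
    (forall x, U x -> differentiable f x) /\
    (forall v, Ck_on k' U (fun x => 'd f x v))
  else forall x, U x -> {for x, continuous f}.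

Definition smooth_on (U : set V) (f : V -> W) : Prop :=
  forall k, Ck_on k U f.

End Smoothness.

(* The values of [chart_map] off [chart_dom], and of [chart_inv] off the image
   of [chart_dom], are irrelevant *)
Record chart {R : realType} (E : normedModType R) (T : Type) := Chart {
  chart_dom : set T;
  chart_map : T -> E;
  chart_inv : E -> T
}.

Definition chart_img {R : realType} {E : normedModType R} {T : Type}
  (c : chart E T) : set E := chart_map c @` chart_dom c.

Definition is_chart {R : realType} {E : normedModType R} {T : topologicalType}
    (c : chart E T) : Prop :=
  [/\ open (chart_dom c),
      open (chart_img c),
      forall x, chart_dom c x -> chart_inv c (chart_map c x) = x,
      forall x, chart_dom c x -> {for x, continuous (chart_map c)} &
      forall u, chart_img c u -> {for u, continuous (chart_inv c)}].

Definition prod_chart {R : realType} {E F : normedModType R} {S T : Type}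
    (c : chart E S) (d : chart F T) : chart (E * F)%type (S * T)%type :=
  Chart (chart_dom c `*` chart_dom d)
        (fun p => (chart_map c p.1, chart_map d p.2))
        (fun u => (chart_inv c u.1, chart_inv d u.2)).

Definition prod_atlas {R : realType} {E F : normedModType R} {S T : Type}
    (A : set (chart E S)) (B : set (chart F T)) :
    set (chart (E * F)%type (S * T)%type) :=
  [set prod_chart p.1 p.2 | p in A `*` B].

HB.mixin Record isManifold (R : realType) (n : nat) T of Topological T := {
  manifold_hausdorff : hausdorff_space T;
  manifold_second_countable : @second_countable T;
  atlas : set (chart 'rV[R]_n T);
  atlas_is_chart : forall c, atlas c -> is_chart c;
  atlas_cover : forall x, exists2 c, atlas c & chart_dom c x;
  atlas_compatible : forall c d, atlas c -> atlas d ->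
    smooth_on (chart_map c @` (chart_dom c `&` chart_dom d))
              (chart_map d \o chart_inv c)
}.

#[short(type="manifoldType")]
HB.structure Definition Manifold (R : realType) (n : nat) :=
  {T of isManifold R n T & Topological T}.

Arguments atlas {R n} s.

Definition smooth_map {R : realType} {E F : normedModType R}
    {S T : topologicalType} (A : set (chart E S)) (B : set (chart F T))
    (f : S -> T) : Prop :=
  continuous f /\
  forall c d, A c -> B d ->
    smooth_on (chart_map c @` (chart_dom c `&` f @^-1` chart_dom d))
              (chart_map d \o f \o chart_inv c).

HB.mixin Record isLieGroup (R : realType) (n : nat) G
    of Manifold R n G & Group G := {
  lie_mul_smooth :
    smooth_map (prod_atlas (atlas G) (atlas G)) (atlas G)
               (fun p : G * G => (p.1 * p.2)%g);
  lie_inv_smooth : smooth_map (atlas G) (atlas G) (fun x : G => (x^-1)%g)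
}.

#[short(type="lieGroupType")]
HB.structure Definition LieGroup (R : realType) (n : nat) :=
  {G of isLieGroup R n G & Manifold R n G & Group G}.

Section SimplyConnected.
Variable R : realType.
Local Notation I := (`[0, 1]%classic : set R).

Definition path_connected (T : topologicalType) : Prop :=
  forall x y : T, exists g : R -> T,
    [/\ {within I, continuous g}, g 0 = x & g 1 = y].

Definition null_homotopic (T : topologicalType) (g : R -> T) : Prop :=
  exists h : R * R -> T,
    [/\ {within I `*` I, continuous h},
        forall t, I t -> h (0, t) = g t,
        forall t, I t -> h (1, t) = g 0 &
        forall s, I s -> h (s, 0) = g 0 /\ h (s, 1) = g 0].

Definition simply_connected (T : topologicalType) : Prop :=
  path_connected T /\
  forall g : R -> T, {within I, continuous g} -> g 0 = g 1 -> null_homotopic g.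

End SimplyConnected.

Section AbstractGroup.
Variable G : groupType.
Local Open Scope group_scope.

Definition is_subgroup (H : set G) : Prop :=
  [/\ H 1, forall x y, H x -> H y -> H (x * y) & forall x, H x -> H x^-1].

Fixpoint derived_series (k : nat) : set G :=
  if k is k'.+1 then
    smallest is_subgroup
      [set commg p.1 p.2 | p in derived_series k' `*` derived_series k']
  else setT.

Definition solvable_group : Prop := exists k, derived_series k = [set 1].

Definition group_center : set G := [set z | forall x, z * x = x * z].

End AbstractGroup.

Arguments derived_series : clear implicits.
Arguments solvable_group : clear implicits.
Arguments group_center : clear implicits.

Section AlgebraicHull.
Context {R : realType} {n : nat}.

Definition algebraic_subgroup (H : set 'M[R]_n) : Prop :=
  [/\ H 1%:M,
      forall A B, H A -> H B -> H (A *m B),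
      forall A, H A -> H (invmx A) &
      exists S : set (mpoly.mpoly (n * n) R),
        H = [set A | A \in unitmx /\
               forall p, S p -> mpoly.meval (fun k => mxvec A 0 k) p = 0]].

Definition algebraic_hull (X : set 'M[R]_n) : set 'M[R]_n :=
  smallest algebraic_subgroup X.

End AlgebraicHull.

Section AdjointRepresentation.
Context {R : realType} {n : nat} {G : lieGroupType R n}.

(* A chart [c] around 1 identifies Lie(G) = T_1 G with R^n.  For [f] fixing 1,
   [lie_diff c f] is the matrix of d_1 f : T_1 G -> T_1 G; like [jacobian], it
   acts on row vectors from the right, so [f \o g] goes to
   [lie_diff c g *m lie_diff c f].  Reversing products changes neither which
   sets of matrices are subgroups nor which are algebraic *)
Definition lie_diff (c : chart 'rV[R]_n G) (f : G -> G) : 'M[R]_n :=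
  jacobian (chart_map c \o f \o chart_inv c) (chart_map c 1%g).

Definition Ad (c : chart 'rV[R]_n G) (g : G) : 'M[R]_n :=
  lie_diff c (fun x => g * x * g^-1)%g.

Definition Ad_alg (c : chart 'rV[R]_n G) : set 'M[R]_n :=
  algebraic_hull (range (Ad c)).

Definition lie_automorphism (f : G -> G) : Prop :=
  [/\ {morph f : x y / (x * y)%g},
      smooth_map (atlas G) (atlas G) f &
      exists f', [/\ cancel f f', cancel f' f &
                     smooth_map (atlas G) (atlas G) f']].

(* [f] is the automorphism by which [a], viewed in GL(Lie(G)), acts on [G] *)
Definition integrates (c : chart 'rV[R]_n G) (a : 'M[R]_n) (f : G -> G) :
    Prop :=
  lie_automorphism f /\ lie_diff c f = a.

End AdjointRepresentation.

(* Main.v *)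
(* By Lie-Kolchin, the endomorphisms Ad(g) - 1 take values in an ideal [nilrad]
   of Lie(G) acting on Lie(G) by strictly triangular matrices; hence so does
   [a - 1] for every [a] in the algebraic hull.  Join 1 to the central element z
   by a C^1 curve x.  If [a] is the differential of an automorphism alpha, the
   logarithmic derivative of alpha(x(s)) x(s)^-1 lies in [nilrad], so this curve
   is a product of one-parameter subgroups at times p_i(s, a) which are iterated
   integrals in s and rational functions of a.  When a = Ad(g) and x(s) = z the
   product is 1.  As (0, ..., 0) is isolated among the times with product 1, and
   G is connected, the p_i vanish there for all g, hence also on the Zariski
   closure of Ad(G), so that alpha(z) = z. *)

Require Import Defs.
From HB Require Import structures.
From mathcomp Require Import all_boot all_order all_algebra.
From mathcomp Require mpoly.

Set Implicit Arguments.
Unset Strict Implicit.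
Unset Printing Implicit Defensive.

Import Order.TTheory GRing.Theory Num.Theory.

Local Open Scope ring_scope.

(** An automorphism enters the logarithmic derivative of [alpha (x s) * (x s)^-1] only through its
    differential [a], because [Ad (alpha y)] is the conjugate of [Ad y] by [a]. This makes that
    derivative a regular function of [a] and lets one formula treat [alpha] and all conjugations of
    G. Factoring the curve still conjugates it by exponentials of the times already found. These are
    polynomial in the times only because [ad e] is nilpotent for [e] in the ideal, so rationality in
    [a] survives the peeling of each factor; integration in s is harmless because it acts on finite
    sums of separated terms u(s) q(a). A product of one-parameter subgroups may return to 1 at
    nonzero times, so knowing that it equals 1 for all Ad(g) does not by itself annihilate the
    times. They are followed by continuity twice: for g = 1 along s, starting at s = 0 where they
    vanish by construction, then at the end point of the curve along g in G. *)

Module PolyFun.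
Import mpoly.

(** * Polynomial and regular functions on GL_n, Zariski closure *)

Section PolyFun.
Context {R : fieldType} {n : nat}.
Implicit Types (A B : 'M[R]_n).

Definition polyfun (f : 'M[R]_n -> R) : Prop :=
  exists p : {mpoly R[n * n]}, forall A, f A = p.@[fun k => mxvec A 0 k].

Lemma polyfun_cst r : polyfun (fun=> r).
Proof. by exists r%:MP => A; rewrite mevalC. Qed.

Lemma polyfunD (f g : 'M[R]_n -> R) : polyfun f -> polyfun g -> polyfun (fun A => f A + g A).
Proof. by move=> [p fp] [q gq]; exists (p + q) => A; rewrite mevalD fp gq. Qed.

Lemma polyfunM (f g : 'M[R]_n -> R) : polyfun f -> polyfun g -> polyfun (fun A => f A * g A).
Proof. by move=> [p fp] [q gq]; exists (p * q) => A; rewrite mevalM fp gq. Qed.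

Lemma polyfun_coord i j : polyfun (fun A => A i j).
Proof. by exists 'X_(mxvec_index i j) => A; rewrite mevalXU mxvecE. Qed.

(** Substituting functions of [t] for the variables of [p] stays in any class [Q] that contains
    constants and these functions and is closed under sums and products. It serves with [Q]
    polynomial, regular, or continuous. *)
Lemma meval_ind (T : Type) (Q : (T -> R) -> Prop) (x : 'I_(n * n) -> T -> R)
    (p : {mpoly R[n * n]}) :
  (forall r, Q (fun=> r)) ->
  (forall f g, Q f -> Q g -> Q (fun t => f t + g t)) ->
  (forall f g, Q f -> Q g -> Q (fun t => f t * g t)) ->
  (forall k, Q (x k)) -> (forall f g, f =1 g -> Q f -> Q g) ->
  Q (fun t => p.@[fun k => x k t]).
Proof.
move=> Qc QD QM Qx Qe.
apply: (Qe (fun t => \sum_(m <- msupp p)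
    p@_m * \prod_(i < n * n) x i t ^+ m i)).
  by move=> t; rewrite mevalE.
have Qsum (r : seq 'X_{1..n * n}) (F : 'X_{1..n * n} -> T -> R) :
    (forall m, Q (F m)) -> Q (fun t => \sum_(m <- r) F m t).
  move=> QF; elim: r => [|m r IHr].
    by apply: (Qe _ _ _ (Qc 0)) => t; rewrite big_nil.
  by apply: (Qe _ _ _ (QD _ _ (QF m) IHr)) => t; rewrite big_cons.
apply: Qsum => m; apply: (QM (fun=> _)); first exact: Qc.
have Qprod (r : seq 'I_(n * n)) (F : 'I_(n * n) -> T -> R) :
    (forall m, Q (F m)) -> Q (fun t => \prod_(m <- r) F m t).
  move=> QF; elim: r => [|k r IHr].
    by apply: (Qe _ _ _ (Qc 1)) => t; rewrite big_nil.
  by apply: (Qe _ _ _ (QM _ _ (QF k) IHr)) => t; rewrite big_cons.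
apply: Qprod => i; elim: (m i) => [|k IHk].
  by apply: (Qe _ _ _ (Qc 1)) => t; rewrite expr0.
by apply: (Qe _ _ _ (QM _ _ (Qx i) IHk)) => t; rewrite exprS.
Qed.

Lemma eq_polyfun (f g : 'M[R]_n -> R) : f =1 g -> polyfun f -> polyfun g.
Proof. by move=> fg [p fp]; exists p => A; rewrite -fg. Qed.

Lemma polyfun_sum (I : Type) (r : seq I) (F : I -> 'M[R]_n -> R) :
  (forall i, polyfun (F i)) -> polyfun (fun A => \sum_(i <- r) F i A).
Proof.
move=> PF; elim: r => [|i r IHr].
  by apply: eq_polyfun (polyfun_cst 0) => A; rewrite big_nil.
by apply: eq_polyfun (polyfunD (PF i) IHr) => A; rewrite big_cons.
Qed.

Lemma polyfun_prod (I : Type) (r : seq I) (F : I -> 'M[R]_n -> R) :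
  (forall i, polyfun (F i)) -> polyfun (fun A => \prod_(i <- r) F i A).
Proof.
move=> PF; elim: r => [|i r IHr].
  by apply: eq_polyfun (polyfun_cst 1) => A; rewrite big_nil.
by apply: eq_polyfun (polyfunM (PF i) IHr) => A; rewrite big_cons.
Qed.

Lemma polyfun_det_of m (F : 'I_m -> 'I_m -> 'M[R]_n -> R) :
  (forall i j, polyfun (F i j)) ->
  polyfun (fun A => \det (\matrix_(i, j) F i j A)).
Proof.
move=> PF; rewrite /determinant; apply: polyfun_sum => s.
apply: polyfunM; first exact: polyfun_cst.
apply: polyfun_prod => i.
apply: eq_polyfun (PF i _) => A.
by rewrite mxE.
Qed.

Lemma polyfun_det : polyfun (fun A => \det A).
Proof.
apply: eq_polyfun (polyfun_det_of polyfun_coord) => A; congr (\det _).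
by apply/matrixP => i j; rewrite mxE.
Qed.

Lemma polyfun_adj i j : polyfun (fun A => (\adj A) i j).
Proof.
apply: (@eq_polyfun (fun A => (-1) ^+ (j + i) *
    \det (\matrix_(k, l) A (lift j k) (lift i l)))).
  by move=> A; rewrite mxE /cofactor; congr (_ * \det _);
     apply/matrixP => k l; rewrite !mxE.
apply: polyfunM; first exact: polyfun_cst.
by apply: polyfun_det_of => k l; exact: polyfun_coord.
Qed.

Lemma polyfunX (f : 'M[R]_n -> R) d : polyfun f -> polyfun (fun A => f A ^+ d).
Proof.
move=> Pf; elim: d => [|d IHd].
  by apply: eq_polyfun (polyfun_cst 1) => A; rewrite expr0.
by apply: eq_polyfun (polyfunM Pf IHd) => A; rewrite exprS.
Qed.

Lemma polyfun_mull B (f : 'M[R]_n -> R) :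
  polyfun f -> polyfun (fun A => f (B *m A)).
Proof.
move=> [p fp]; apply: (@eq_polyfun (fun A => p.@[fun k => mxvec (B *m A) 0 k])).
  by move=> A; rewrite fp.
apply: meval_ind; [exact: polyfun_cst|exact: polyfunD|exact: polyfunM| |].
  move=> k; case/mxvec_indexP: k => i j.
  apply: (@eq_polyfun (fun A => \sum_k B i k * A k j)).
    by move=> A; rewrite mxvecE mxE.
  apply: polyfun_sum => k; apply: polyfunM; first exact: polyfun_cst.
  exact: polyfun_coord.
exact: eq_polyfun.
Qed.

Lemma polyfun_mulr B (f : 'M[R]_n -> R) :
  polyfun f -> polyfun (fun A => f (A *m B)).
Proof.
move=> [p fp]; apply: (@eq_polyfun (fun A => p.@[fun k => mxvec (A *m B) 0 k])).
  by move=> A; rewrite fp.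
apply: meval_ind; [exact: polyfun_cst|exact: polyfunD|exact: polyfunM| |].
  move=> k; case/mxvec_indexP: k => i j.
  apply: (@eq_polyfun (fun A => \sum_k A i k * B k j)).
    by move=> A; rewrite mxvecE mxE.
  apply: polyfun_sum => k; apply: polyfunM; last exact: polyfun_cst.
  exact: polyfun_coord.
exact: eq_polyfun.
Qed.

(** Regular functions on GL_n: the only denominators are powers of the determinant, and values at
    singular matrices are left free. *)
Definition ratfun (f : 'M[R]_n -> R) : Prop :=
  exists d p, polyfun p /\
    forall A, A \in unitmx -> f A * \det A ^+ d = p A.

Lemma eq_ratfun (f g : 'M[R]_n -> R) :
  {in unitmx, f =1 g} -> ratfun f -> ratfun g.
Proof.
move=> fg [d [p [Pp fp]]]; exists d, p; split=> // A uA.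
by rewrite -fg ?fp.
Qed.

Lemma polyfun_ratfun (f : 'M[R]_n -> R) : polyfun f -> ratfun f.
Proof. by move=> Pf; exists 0%N, f; split=> // A _; rewrite expr0 mulr1. Qed.

Lemma ratfunD (f g : 'M[R]_n -> R) :
  ratfun f -> ratfun g -> ratfun (fun A => f A + g A).
Proof.
move=> [d [p [Pp fp]]] [e [q [Pq gq]]].
exists (d + e)%N, (fun A => p A * \det A ^+ e + q A * \det A ^+ d); split.
  by apply: polyfunD; apply: polyfunM => //; apply/polyfunX/polyfun_det.
move=> A uA; rewrite mulrDl exprD -fp // -gq //.
by rewrite mulrA [_ ^+ d * _]mulrC mulrA.
Qed.

Lemma ratfunM (f g : 'M[R]_n -> R) :
  ratfun f -> ratfun g -> ratfun (fun A => f A * g A).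
Proof.
move=> [d [p [Pp fp]]] [e [q [Pq gq]]].
exists (d + e)%N, (fun A => p A * q A); split; first exact: polyfunM.
by move=> A uA; rewrite exprD -fp // -gq // mulrACA.
Qed.

Lemma ratfun_inv i j : ratfun (fun A => invmx A i j).
Proof.
exists 1%N, (fun A => (\adj A) i j); split; first exact: polyfun_adj.
move=> A uA; rewrite /invmx uA mxE expr1 mulrAC mulVf ?mul1r //.
by rewrite -unitfE.
Qed.

(** The Zariski closure taken inside GL_n, in the vectorised coordinates of [algebraic_subgroup]. *)
Definition zclosure (X : 'M[R]_n -> Prop) (A : 'M[R]_n) : Prop :=
  A \in unitmx /\
  forall p : {mpoly R[n * n]},
    (forall B, X B -> p.@[fun k => mxvec B 0 k] = 0) ->
    p.@[fun k => mxvec A 0 k] = 0.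

Section ZariskiClosure.
Variable X : 'M[R]_n -> Prop.
Hypothesis X_unit : forall A, X A -> A \in unitmx.
Hypothesis X_mul : forall A B, X A -> X B -> X (A *m B).
Hypothesis X_inv : forall A, X A -> X (invmx A).

Lemma sub_zclosure A : X A -> zclosure X A.
Proof. by move=> XA; split; [exact: X_unit | move=> p; apply]. Qed.

Lemma zclosure_polyfun (f : 'M[R]_n -> R) A :
  polyfun f -> (forall B, X B -> f B = 0) -> zclosure X A -> f A = 0.
Proof.
move=> [p fp] f0 [_ /(_ p) pA]; rewrite fp pA // => B XB.
by rewrite -fp f0.
Qed.

(** The numerator vanishes on [X], hence on its closure, where the determinant is invertible and can
    be cancelled. *)
Lemma zclosure_ratfun (f : 'M[R]_n -> R) A :
  ratfun f -> (forall B, X B -> f B = 0) -> zclosure X A -> f A = 0.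
Proof.
move=> [d [p [Pp fp]]] f0 ZA; have uA := ZA.1.
have pA : p A = 0.
  by apply: zclosure_polyfun ZA => // B XB; rewrite -fp ?X_unit // f0 ?mul0r.
have /eqP := fp _ uA; rewrite pA mulf_eq0 expf_eq0 => /orP[/eqP //|].
by move: uA; rewrite unitmxE unitfE => /negPf ->; rewrite andbF.
Qed.

Lemma zclosure_mul A B : zclosure X A -> zclosure X B -> zclosure X (A *m B).
Proof.
move=> ZA ZB; have [uA uB] := (ZA.1, ZB.1); split.
  by rewrite unitmx_mul uA.
move=> p p0; set f := fun C => p.@[fun k => mxvec C 0 k].
have Pf : polyfun f by exists p.
(* One factor at a time: with [B] fixed it suffices to treat left factors [C] in [X]; with such a
   [C] fixed, right factors in [X]. *)
apply: (zclosure_polyfun (polyfun_mulr B Pf) _ ZA) => C XC.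
by apply: (zclosure_polyfun (polyfun_mull C Pf) _ ZB) => D XD; exact/p0/X_mul.
Qed.

Lemma ratfun_invmx (f : 'M[R]_n -> R) :
  polyfun f -> ratfun (fun A => f (invmx A)).
Proof.
move=> [p fp].
apply: (@eq_ratfun (fun A => p.@[fun k => mxvec (invmx A) 0 k])).
  by move=> A _; rewrite fp.
apply: meval_ind.
- by move=> r; exact/polyfun_ratfun/polyfun_cst.
- exact: ratfunD.
- exact: ratfunM.
- move=> k; case/mxvec_indexP: k => i j.
  by apply: eq_ratfun (ratfun_inv i j) => A _; rewrite mxvecE.
- by move=> f' g' fg; apply: eq_ratfun => A _; rewrite fg.
Qed.

Lemma zclosure_inv A : zclosure X A -> zclosure X (invmx A).
Proof.
move=> ZA; split; first by rewrite unitmx_inv; exact: ZA.1.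
move=> p p0; set f := fun C => p.@[fun k => mxvec C 0 k].
have Pf : polyfun f by exists p.
apply: (zclosure_ratfun (ratfun_invmx Pf) _ ZA) => B XB.
exact/p0/X_inv.
Qed.

End ZariskiClosure.
End PolyFun.
End PolyFun.

From mathcomp Require Import all_classical all_reals all_analysis.
From mathcomp.real_closed Require complex.
From mathcomp Require Import ring lra zify.

Import numFieldNormedType.Exports.
Import PolyFun.

Local Open Scope classical_set_scope.
Local Open Scope ring_scope.

Lemma mulmxEij {R : nzRingType} m n p (A : 'M[R]_(m, n)) (B : 'M[R]_(n, p)) i j :
  (A *m B) i j = \sum_k A i k * B k j.
Proof. exact: mxE. Qed.

(** * Norm estimates, differentials and a mean value inequality *)

Section MatrixNorm.
Context {R : realType}.

Lemma mx_norm_le m n (A : 'M[R]_(m, n)) (e : R) :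
  0 <= e -> (forall i j, `|A i j| <= e) -> `|A| <= e.
Proof.
move=> e0 Ae; rewrite [`|A|]mx_normrE.
by apply/bigmax_leP; split => // -[i j] _ /=.
Qed.

Lemma mx_entry_le m n (A : 'M[R]_(m, n)) i j : `|A i j| <= `|A|.
Proof.
rewrite [`|A|]mx_normrE.
exact: (le_bigmax _ (fun ij : 'I_m * 'I_n => `|A ij.1 ij.2|) (i, j)).
Qed.

(** The norm is the largest absolute value of an entry, which is not submultiplicative; hence the
    factor [n]. *)
Lemma norm_mulmx m n p (A : 'M[R]_(m, n)) (B : 'M[R]_(n, p)) :
  `|A *m B| <= n%:R * `|A| * `|B|.
Proof.
apply: mx_norm_le; first by rewrite !mulr_ge0.
move=> i j; rewrite mxE; apply: le_trans (ler_norm_sum _ _ _) _.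
apply: (@le_trans _ _ (\sum_(k < n) `|A| * `|B|)).
  by apply: ler_sum => k _; rewrite normrM ler_pM // mx_entry_le.
by rewrite sumr_const card_ord -mulrA mulr_natl.
Qed.

End MatrixNorm.

Section EpsDifferentiable.
Context {R : realType} {V W : normedModType R}.
Implicit Types (f g : V -> W) (x : V).

Lemma differentiable_eps f x : differentiable f x ->
  forall e, 0 < e ->
  \forall y \near x, `|f y - f x - 'd f x (y - x)| <= e * `|y - x|.
Proof.
move=> /diff_locallyP[_ /eqaddoP fE] e e0.
have := fE e e0; rewrite [\forall y \near _, _ <= _](near_shift x) sub0r.
apply: filterS => y /=.
by rewrite /= opprD addrA !fctE /= subrK.
Qed.

Lemma differentiable_near_dist f x e : differentiable f x -> 0 < e ->
  \forall y \near x, `|f y - f x| <= e.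
Proof. by move=> /differentiable_continuous/cvgr_distC_le; apply. Qed.

Lemma eps_differentiable f x (L : {linear V -> W}) : continuous L ->
  (forall e, 0 < e ->
    \forall y \near x, `|f y - f x - L (y - x)| <= e * `|y - x|) ->
  differentiable f x /\ 'd f x = L :> (V -> W).
Proof.
move=> Lc H.
have E : f \o shift x = cst (f x) + L +o_ (0 : V) id.
  apply/eqaddoP => e e0; rewrite [\forall y \near _, _ <= _](near_shift x) sub0r.
  have := H e e0; apply: filterS => y /=.
  by rewrite opprD addrA !fctE /= subrK.
have dL := diff_unique Lc E.
by split => //; apply/diff_locallyP; rewrite dL.
Qed.

Lemma near_differentiable f g x :
  (\forall y \near x, f y = g y) -> differentiable f x ->
  differentiable g x /\ 'd g x = 'd f x :> (V -> W).
Proof.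
move=> fg df; apply: eps_differentiable; first exact: diff_continuous.
move=> e e0; have fgx := nbhs_singleton fg.
by apply: filterS2 fg (differentiable_eps df e0) => y <-; rewrite fgx.
Qed.

End EpsDifferentiable.

Section MeanValue.
Context {R : realType} {V : normedModType R} {m n : nat}.

(** The scalar mean value theorem is applied to each entry along the segment. The intermediate point
    depends on the entry, which costs nothing for the max norm. *)
Lemma norm_mvt (f : V -> 'M[R]_(m, n)) (x h : V) (w : 'M[R]_(m, n)) (K : R) :
  (forall t : R, t \in `[0, 1]%R -> differentiable f (x + t *: h) /\
     `|'d f (x + t *: h) h - w| <= K) ->
  `|f (x + h) - f x - w| <= K.
Proof.
move=> H; have K0 : 0 <= K.
  have [|_] := H 0; first by rewrite in_itv /= lexx ler01.
  exact: le_trans.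
apply: mx_norm_le => // i j.
pose g (t : R) : R := f (x + t *: h) i j.
have gd (t : R) : t \in `[0, 1]%R -> is_derive t 1 g ('d f (x + t *: h) h i j).
  move=> /H[df _].
  pose l : R -> V := cst x + *:%R^~ h.
  have dl : is_diff t l (0 + *:%R^~ h) by apply: is_diffD.
  have dfl : is_diff t (f \o l) ('d f (x + t *: h) \o (0 + *:%R^~ h)).
    by apply: is_diff_comp.
  have dv : derivable (f \o l) t 1.
    exact: diff_derivable.
  have /derivable_mxP dij := dv.
  apply: DeriveDef; first exact: dij.
  have := derive_mx dv => /matrixP/(_ i j); rewrite mxE => <-.
  by rewrite deriveE // diff_val /= fctE /= scale1r add0r.
pose dg (t : R) : R := 'd f (x + t *: h) h i j.
have gc (t : R) : t \in `[0, 1]%R -> {for t, continuous g}.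
  move=> /gd gdt; apply: differentiable_continuous.
  by apply/derivable1_diffP; exact: ex_derive.
have gcc : {within `[0, 1], continuous g}.
  by apply: continuous_in_subspaceT => t; rewrite inE /= => t01; exact: gc.
have gdd (t : R) : t \in `]0, 1[%R -> is_derive t 1 g (dg t).
  by move=> t01; apply: gd; exact: subset_itv_oo_cc.
have [c c01 E] := MVT ltr01 gdd gcc.
move: E; rewrite /g scale1r scale0r addr0 subr0 mulr1 => E.
have [_ ] := H c (subset_itv_oo_cc c01).
apply: le_trans; have := mx_entry_le ('d f (x + c *: h) h - w) i j.
by rewrite !mxE E.
Qed.

End MeanValue.

Section Smooth.
Context {R : realType} {V W : normedModType R}.
Variables (U : set V) (f : V -> W).
Hypothesis f_smooth : smooth_on U f.

Lemma smooth_on_diff p : U p -> differentiable f p.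
Proof. by have [+ _] := f_smooth 1; exact. Qed.

Lemma smooth_on_diff2 p v : U p -> differentiable (fun q => 'd f q v) p.
Proof. by have [_ /(_ v) [+ _]] := f_smooth 2; exact. Qed.

End Smooth.

(** * Charts and the group operations read in charts *)

Section Charts.
Context {R : realType} {E : normedModType R} {T : topologicalType}.
Variable c : chart E T.
Hypothesis c_chart : is_chart c.

Lemma chart_mapK u : chart_img c u -> chart_map c (chart_inv c u) = u.
Proof. by have [_ _ cK _ _] := c_chart => -[x Dx <-]; rewrite cK. Qed.

Lemma chart_inv_dom u : chart_img c u -> chart_dom c (chart_inv c u).
Proof. by have [_ _ cK _ _] := c_chart => -[x Dx <-]; rewrite cK. Qed.

Lemma open_chart_image (A : set T) : open A ->
  open (chart_map c @` (chart_dom c `&` A)).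
Proof.
have [_ oimg cK _ ci] := c_chart => oA.
have -> : chart_map c @` (chart_dom c `&` A) =
    chart_img c `&` chart_inv c @^-1` A.
  apply/seteqP; split=> [_ [x [Dx Ax] <-]|u [[x Dx <-]]] /=.
    by rewrite cK //; split=> //; exists x.
  by rewrite cK // => Ax; exists x.
rewrite openE => u [iu Au].
apply: filterI; first exact: open_nbhs_nbhs.
by apply: (ci u iu); exact: open_nbhs_nbhs.
Qed.

Lemma near_chart_img x : chart_dom c x ->
  \forall u \near chart_map c x, chart_img c u.
Proof.
move=> Dx; apply: open_nbhs_nbhs; split; last by exists x.
by have [] := c_chart.
Qed.

Lemma near_chart_dom x : chart_dom c x -> \forall y \near x, chart_dom c y.
Proof. by move=> Dx; apply: open_nbhs_nbhs; split=> //; have [] := c_chart. Qed.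

Lemma chart_map_cvg x : chart_dom c x -> {for x, continuous (chart_map c)}.
Proof. by have [_ _ _ + _] := c_chart; apply. Qed.

Lemma chart_inv_cvg u : chart_img c u -> {for u, continuous (chart_inv c)}.
Proof. by have [_ _ _ _] := c_chart; apply. Qed.

Lemma chart_invK x : chart_dom c x -> chart_inv c (chart_map c x) = x.
Proof. by have [_ _ + _ _] := c_chart; apply. Qed.

Lemma chart_inv_cvgx x : chart_dom c x ->
  chart_inv c u @[u --> chart_map c x] --> x.
Proof.
move=> Dx; rewrite -[X in _ --> X](chart_invK Dx).
by apply: chart_inv_cvg; exists x.
Qed.

End Charts.

Lemma open_setX {S T : topologicalType} (A : set S) (B : set T) :
  open A -> open B -> open (A `*` B).
Proof.
rewrite !openE => oA oB [x y] [/= /oA Ax /oB By].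
by exists (A, B).
Qed.

Lemma is_chart_prod {R : realType} {E F : normedModType R}
    {S T : topologicalType} (c : chart E S) (d : chart F T) :
  is_chart c -> is_chart d -> is_chart (prod_chart c d).
Proof.
move=> cc dd.
have imgE : chart_img (prod_chart c d) = chart_img c `*` chart_img d.
  apply/seteqP; split=> [_ [[x y] [/= Dx Dy] <-]|[u v] /= [[x Dx <-] [y Dy <-]]].
    by split; [exists x|exists y].
  by exists (x, y).
split.
- by apply: open_setX; [have [] := cc|have [] := dd].
- by rewrite imgE; apply: open_setX; [have [] := cc|have [] := dd].
- by move=> [x y] [/= Dx Dy]; rewrite !chart_invK.
- move=> [x y] [/= Dx Dy]; apply: cvg_pair => /=.
    by apply: cvg_comp; [exact: cvg_fst|exact: chart_map_cvg].
  by apply: cvg_comp; [exact: cvg_snd|exact: chart_map_cvg].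
- move=> [u v]; rewrite imgE => -[/= iu iv]; apply: cvg_pair => /=.
    by apply: cvg_comp; [exact: cvg_fst|exact: chart_inv_cvg].
  by apply: cvg_comp; [exact: cvg_snd|exact: chart_inv_cvg].
Qed.

Section GroupCharts.
Context {R : realType} {n : nat} {G : lieGroupType R n}.
Implicit Types c d e : chart 'rV[R]_n G.

Definition mul_chart c d e (p : 'rV[R]_n * 'rV[R]_n) : 'rV[R]_n :=
  chart_map e (chart_inv c p.1 * chart_inv d p.2)%g.

Lemma mul_continuous : continuous (fun p : G * G => (p.1 * p.2)%g).
Proof. by have [] := @lie_mul_smooth R n G. Qed.

Lemma inv_continuous : continuous (fun x : G => x^-1%g).
Proof. by have [] := @lie_inv_smooth R n G. Qed.

Lemma cvg_mulg (T : Type) (F : set_system T) (x y : T -> G) a b : Filter F ->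
  x @ F --> a -> y @ F --> b -> (fun t => x t * y t)%g @ F --> (a * b)%g.
Proof.
move=> FF xa yb.
apply: (@cvg_comp _ _ _ (fun t => (x t, y t)) (fun p : G * G => (p.1 * p.2)%g)
  F (nbhs (a, b))); first exact: cvg_pair.
exact: (@mul_continuous (a, b)).
Qed.

Lemma cvg_invg (T : Type) (F : set_system T) (x : T -> G) a : Filter F ->
  x @ F --> a -> (fun t => (x t)^-1%g) @ F --> (a^-1)%g.
Proof. by move=> FF xa; apply: cvg_comp xa _; exact: (@inv_continuous a). Qed.

Section MulChart.
Variables c d e : chart 'rV[R]_n G.
Hypotheses (cA : atlas G c) (dA : atlas G d) (eA : atlas G e).

(** Written exactly as the domain that [smooth_map] produces for product charts, so that
    [lie_mul_smooth] applies as it is. *)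
Definition mul_chart_dom : set ('rV[R]_n * 'rV[R]_n) :=
  chart_map (prod_chart c d) @` (chart_dom (prod_chart c d) `&`
    [set p | chart_dom e (p.1 * p.2)%g]).

Lemma mul_chart_smooth : smooth_on mul_chart_dom (mul_chart c d e).
Proof.
have [_ H] := @lie_mul_smooth R n G.
by apply: (H (prod_chart c d) e) => //; exists (c, d).
Qed.

Lemma open_mul_chart_dom : open mul_chart_dom.
Proof.
apply: open_chart_image.
  by apply: is_chart_prod; exact: atlas_is_chart.
apply: (@open_comp _ _ (fun p : G * G => (p.1 * p.2)%g)).
  by move=> p _; exact: (@mul_continuous p).
by have [] := atlas_is_chart _ eA.
Qed.

Lemma mul_chart_domP x y : chart_dom c x -> chart_dom d y ->
  chart_dom e (x * y)%g -> mul_chart_dom (chart_map c x, chart_map d y).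
Proof. by move=> Dx Dy Dxy; exists (x, y). Qed.

Lemma mul_chart_diff p : mul_chart_dom p -> differentiable (mul_chart c d e) p.
Proof. exact: (smooth_on_diff mul_chart_smooth). Qed.

Lemma mul_chart_diff2 p v : mul_chart_dom p ->
  differentiable (fun q => 'd (mul_chart c d e) q v) p.
Proof. exact: (smooth_on_diff2 mul_chart_smooth). Qed.

End MulChart.

End GroupCharts.

(** * First-order expansion of the multiplication near 1 *)

Section Tangents.
Context {R : realType} {n : nat} {G : lieGroupType R n}.
Variable c : chart 'rV[R]_n G.
Hypotheses (c_atlas : atlas G c) (c_at1 : chart_dom c 1%g).

Local Notation E := 'rV[R]_n.
Local Notation phi := (chart_map c).
Local Notation u0 := (phi 1%g).
Local Notation m := (mul_chart c c c).
Local Notation U := (mul_chart_dom c c c).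

Let cc : is_chart c := atlas_is_chart _ c_atlas.

Lemma mul_dom1 : U (u0, u0).
Proof. by apply: mul_chart_domP => //; rewrite mulg1. Qed.

Lemma near_mul_dom : \forall p \near (u0, u0), U p.
Proof.
by apply: open_nbhs_nbhs; split; [exact: open_mul_chart_dom|exact: mul_dom1].
Qed.

Lemma mul_chart1 : \forall u \near u0, m (u, u0) = u /\ m (u0, u) = u.
Proof.
near=> u; have iu : chart_img c u by near: u; exact: (near_chart_img cc c_at1).
by rewrite /mul_chart /= chart_invK // mulg1 mul1g chart_mapK.
Unshelve. all: by end_near. Qed.

Lemma diff_pairl (a b : E) : is_diff a (fun u : E => (u, b)) (fun k => (k, 0)).
Proof. exact: is_diff_pair. Qed.

Lemma diff_pairr (a b : E) : is_diff b (fun u : E => (a, u)) (fun k => (0, k)).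
Proof. exact: is_diff_pair. Qed.

Lemma diff_mul1l (k : E) : 'd m (u0, u0) (k, 0) = k.
Proof.
have dm : is_diff (u0, u0) m ('d m (u0, u0)).
  by split=> //; apply: mul_chart_diff mul_dom1.
have d1 := is_diff_comp (diff_pairl u0 u0) dm.
have nE : \forall u \near u0, (m \o (fun u : E => (u, u0))) u = id u.
  by apply: filterS mul_chart1 => u [].
have [_] := near_differentiable nE (@ex_diff _ _ _ _ _ _ _ d1).
rewrite [X in _ = X](@diff_val _ _ _ _ _ _ _ d1).
by rewrite [X in X = _](@diff_val _ _ _ _ _ _ _ (is_diff_id u0)) => /(congr1 (fun f => f k)).
Qed.

(** Smoothness gives continuity in [q] of the differential along each fixed direction; expanding on
    the basis turns this into an estimate uniform in [k]. *)
Lemma diff_mul_pairl (q : E * E) (k : E) :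
  'd m q (k, 0) = \sum_(j < n) k 0 j *: 'd m q (delta_mx 0 j, 0).
Proof.
have -> : (k, 0 : E) = \sum_(j < n) k 0 j *: (delta_mx 0 j, 0 : E).
  rewrite [k in LHS]row_sum_delta.
  elim: (index_enum _) => [|j r IHr]; first by rewrite !big_nil.
  by rewrite !big_cons -IHr; congr (_, _); rewrite /= ?scaler0 ?addr0.
by rewrite linear_sum; apply: eq_bigr => j _; rewrite linearZ.
Qed.

Lemma near_diff_mull e : 0 < e -> \forall q \near (u0, u0),
  U q /\ forall k, `|'d m q (k, 0) - k| <= e * `|k|.
Proof.
move=> e0; have n1 : 0 < n.+1%:R :> R by [].
(* The tolerance is shared among the basis vectors; [n.+1] rather than [n] because [n] may be 0. *)
have H : \forall q \near (u0, u0), forall j : 'I_n,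
    `|'d m q (delta_mx 0 j, 0) - delta_mx 0 j| <= e / n.+1%:R.
  have H := @filter_forall _ _ (fun (j : 'I_n) (q : E * E) =>
    `|'d m q (delta_mx 0 j, 0) - delta_mx 0 j| <= e / n.+1%:R) _
    (nbhs_filter (u0, u0)).
  apply: H => j.
  have := differentiable_near_dist
    (mul_chart_diff2 c_atlas c_atlas c_atlas (delta_mx 0 j, 0) mul_dom1)
    (divr_gt0 e0 n1).
  apply: filterS => q; have E1 := diff_mul1l (delta_mx 0 j).
  by rewrite [X in _ - X]E1.
near=> q; split; first by near: q; exact: near_mul_dom.
move=> k; have Hq : forall j : 'I_n,
    `|'d m q (delta_mx 0 j, 0) - delta_mx 0 j| <= e / n.+1%:R by near: q.
rewrite diff_mul_pairl [X in _ - X]row_sum_delta -sumrB.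
apply: le_trans (ler_norm_sum _ _ _) _.
apply: (@le_trans _ _ (\sum_(j < n) `|k| * (e / n.+1%:R))).
  apply: ler_sum => j _; rewrite -scalerBr normrZ.
  by apply: ler_pM => //; exact: mx_entry_le.
rewrite sumr_const card_ord -[_ *+ n]mulr_natl.
rewrite [leLHS](_ : _ = n%:R / n.+1%:R * (e * `|k|)); last by field.
apply: ler_piMl; first by rewrite mulr_ge0 // ltW.
by rewrite ler_pdivrMr // mul1r ler_nat.
Unshelve. all: by end_near. Qed.

(** The error is relative to the displacement of the left factor alone, uniformly in the right
    factor. It comes from moving from (u0, v), where the product is v, to (u, v), along which the
    partial differential is close to the identity. The estimates below on products rest on it. *)
Lemma mul_chart_left e : 0 < e ->
  \forall p \near (u0, u0),
    U p /\ `|m p - p.2 - (p.1 - u0)| <= e * `|p.1 - u0|.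
Proof.
move=> e0; have /nbhs_ballP[r /= r0 br] := near_diff_mull e0.
have /nbhs_ballP[r1 /= r10 br1] := mul_chart1.
apply/nbhs_ballP; exists (Num.min r r1) => /=; first by rewrite lt_min r0.
move=> [u v] [] /=; rewrite -!ball_normE /= !lt_min => /andP[ur _] /andP[vr vr1].
split.
  by have [] := br (u, v); first by split; rewrite /= -ball_normE.
have vE : m (u0, v) = v by have [] := br1 v; rewrite // -ball_normE.
have -> : (u, v) = (u0, v) + (u - u0, 0) :> E * E.
  by congr (_, _); rewrite /= ?addr0 // addrC subrK.
rewrite -[X in `|_ - X - _|]vE; apply: norm_mvt => t; rewrite in_itv /= => /andP[t0 t1].
have [Uq Hq] : U ((u0, v) + t *: (u - u0, 0)) /\
    forall k, `|'d m ((u0, v) + t *: (u - u0, 0)) (k, 0) - k| <= e * `|k|.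
  apply: br; split; rewrite /= -ball_normE /=; last by rewrite scaler0 addr0.
  rewrite opprD addrA subrr sub0r normrN normrZ ger0_norm //.
  apply: le_lt_trans ur; rewrite distrC ler_piMl //.
by split; [exact: mul_chart_diff | exact: Hq].
Qed.

End Tangents.

(** * Calculus of curves tangent to a vector at 1 *)

Section Tang.
Context {R : realType} {n : nat} {G : lieGroupType R n}.
Variable c : chart 'rV[R]_n G.
Hypotheses (c_atlas : atlas G c) (c_at1 : chart_dom c 1%g).

Local Notation E := 'rV[R]_n.
Local Notation phi := (chart_map c).
Local Notation psi := (chart_inv c).
Local Notation u0 := (phi 1%g).
Local Notation m := (mul_chart c c c).

Let cc : is_chart c := atlas_is_chart _ c_atlas.

(* [y] tends to 1 and is [1 + w + o(r)] in the chart, where [w = O(r)] *)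
Definition tang (T : Type) (F : set_system T) (y : T -> G) (w : T -> E)
    (r : T -> R) : Prop :=
  [/\ y @ F --> (1%g : G),
      exists C, \forall t \near F, `|w t| <= C * r t &
      forall e, 0 < e -> \forall t \near F, `|phi (y t) - u0 - w t| <= e * r t].

Section Rules.
Context {T : Type} {F : set_system T} {FF : Filter F}.
Implicit Types (y : T -> G) (w : T -> E) (r : T -> R).

Lemma tang_ge0 y w r : tang F y w r -> \forall t \near F, 0 <= r t.
Proof.
move=> [_ _ /(_ 1 ltr01)]; apply: filterS => t; rewrite mul1r.
exact: le_trans.
Qed.

Lemma tang_phi y w r : tang F y w r -> (fun t => phi (y t)) @ F --> u0.
Proof.
move=> [y1 _ _]; apply: (@cvg_comp _ _ _ y phi _ _ _ y1).
exact: (chart_map_cvg cc c_at1).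
Qed.

Lemma tang_dom y w r : tang F y w r -> \forall t \near F, chart_dom c (y t).
Proof. by move=> [y1 _ _]; apply: y1; exact: (near_chart_dom cc c_at1). Qed.

Lemma tang_bound y w r : tang F y w r ->
  exists2 C, 0 < C & \forall t \near F, `|w t| <= C * r t /\ `|phi (y t) - u0| <= C * r t.
Proof.
move=> yw; have r0 := tang_ge0 yw; have [_ [C wC] /(_ 1 ltr01) yE] := yw.
exists (`|C| + 1); first by rewrite ltr_pwDr.
apply: filterS3 r0 wC yE => t r0 wC yE.
have wC' : `|w t| <= `|C| * r t.
  by apply: le_trans wC _; rewrite ler_wpM2r // ler_norm.
split; first by apply: le_trans wC' _; rewrite ler_wpM2r // lerDl.
rewrite mulrDl -[phi _ - _](subrK (w t)) addrC.
by apply: le_trans (ler_normD _ _) _; exact: lerD.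
Qed.

Lemma eq_tang y y' w w' r : (\forall t \near F, y t = y' t) ->
  (\forall t \near F, w t = w' t) -> tang F y w r -> tang F y' w' r.
Proof.
move=> yy ww [y1 [C wC] yE]; split.
- by apply: cvg_trans y1; apply: near_eq_cvg; apply: filterS yy => t ->.
- by exists C; apply: filterS2 ww wC => t ->.
- by move=> e /yE; apply: filterS3 yy ww => t -> ->.
Qed.

(** Used to choose the tolerance [d] of the ingredients once the total error is known to be [D * d];
    [D] may have any sign. *)
Lemma tang_err (D e : R) : 0 < e -> exists2 d, 0 < d & D * d <= e.
Proof.
move=> e0; exists (e / (`|D| + 1)); first by rewrite divr_gt0 // ltr_pwDr.
rewrite mulrCA ler_piMr ?(ltW e0) // ler_pdivrMr ?ltr_pwDr // mul1r.
by apply: le_trans (ler_norm _) _; rewrite lerDl.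
Qed.

Lemma tang_mul y1 y2 w1 w2 r : tang F y1 w1 r -> tang F y2 w2 r ->
  tang F (fun t => y1 t * y2 t)%g (fun t => w1 t + w2 t) r.
Proof.
move=> t1 t2; have [C1 C10 b1] := tang_bound t1; have [C2 C20 b2] := tang_bound t2.
split.
- by case: t1 t2 => [y1c _ _] [y2c _ _]; rewrite -[1%g]mulg1; exact: cvg_mulg.
- exists (C1 + C2); apply: filterS2 b1 b2 => t [b1 _] [b2 _].
  by rewrite mulrDl (le_trans (ler_normD _ _)) // lerD.
(* [C1] pays for the error of the multiplication, and 2 for the errors of [y1] and [y2]. *)
move=> e e0; have [d d0 dle] := tang_err (C1 + 2) e0.
have p0 : (fun t => (phi (y1 t), phi (y2 t))) @ F --> (u0, u0).
  exact: (cvg_pair (tang_phi t1) (tang_phi t2)).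
have H := p0 _ (mul_chart_left c_atlas c_at1 d0).
have D1 := tang_dom t1; have D2 := tang_dom t2.
have r0 := tang_ge0 t1.
case: t1 t2 => [_ _ /(_ d d0) e1] [_ _ /(_ d d0) e2].
near=> t.
have [_] : mul_chart_dom c c c (phi (y1 t), phi (y2 t)) /\
  `|m (phi (y1 t), phi (y2 t)) - phi (y2 t) - (phi (y1 t) - u0)|
    <= d * `|phi (y1 t) - u0| by near: t.
rewrite /mul_chart /= !chart_invK //; [|by near: t..] => M.
have [_ B1] : `|w1 t| <= C1 * r t /\ `|phi (y1 t) - u0| <= C1 * r t by near: t.
have e1t : `|phi (y1 t) - u0 - w1 t| <= d * r t by near: t.
have e2t : `|phi (y2 t) - u0 - w2 t| <= d * r t by near: t.
have r0t : 0 <= r t by near: t.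
rewrite [X in `|X|](_ : _ = (phi (y1 t * y2 t)%g - phi (y2 t) - (phi (y1 t) - u0))
  + ((phi (y1 t) - u0 - w1 t) + (phi (y2 t) - u0 - w2 t))); last first.
  by apply/matrixP => i j; rewrite !mxE; ring.
apply: le_trans (ler_normD _ _) _.
apply: (@le_trans _ _ (d * (C1 * r t) + (d * r t + d * r t))).
  apply: lerD; first by apply: le_trans M _; rewrite ler_wpM2l // ltW.
  by apply: le_trans (ler_normD _ _) _; exact: lerD.
rewrite [leLHS](_ : _ = (C1 + 2) * d * r t); last by ring.
by rewrite ler_wpM2r.
Unshelve. all: by end_near. Qed.

(** The expansion of the product at [y] and its inverse, whose product is 1, already determines the
    inverse to first order; its differential is not computed. *)
Lemma tang_inv y w r : tang F y w r ->
  tang F (fun t => (y t)^-1)%g (fun t => - w t) r.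
Proof.
move=> t1; have [C1 C10 b1] := tang_bound t1.
have yc : (fun t => (y t)^-1)%g @ F --> (1%g : G).
  by case: t1 => [y1c _ _]; rewrite -[1%g]invg1; exact: cvg_invg.
split => //.
  exists C1; apply: filterS b1 => t [b1 _].
  by rewrite normrN.
move=> e e0; have [d d0 dle] := tang_err (C1 + 1) e0.
have pc : (fun t => phi (y t)^-1%g) @ F --> u0.
  apply: (@cvg_comp _ _ _ (fun t => (y t)^-1)%g phi _ _ _ yc).
  exact: (chart_map_cvg cc c_at1).
have p0 : (fun t => (phi (y t), phi (y t)^-1%g)) @ F --> (u0, u0).
  exact: (cvg_pair (tang_phi t1) pc).
have H := p0 _ (mul_chart_left c_atlas c_at1 d0).
have D1 := tang_dom t1.
have D2 : \forall t \near F, chart_dom c (y t)^-1%g.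
  by apply: yc; exact: (near_chart_dom cc c_at1).
have r0 := tang_ge0 t1.
case: t1 => [_ _ /(_ d d0) e1].
near=> t.
have [_] : mul_chart_dom c c c (phi (y t), phi (y t)^-1%g) /\
  `|m (phi (y t), phi (y t)^-1%g) - phi (y t)^-1%g - (phi (y t) - u0)|
    <= d * `|phi (y t) - u0| by near: t.
rewrite /mul_chart /= !chart_invK //; [|by near: t..] => M.
have [_ B1] : `|w t| <= C1 * r t /\ `|phi (y t) - u0| <= C1 * r t by near: t.
have e1t : `|phi (y t) - u0 - w t| <= d * r t by near: t.
have r0t : 0 <= r t by near: t.
rewrite mulgV in M.
rewrite -normrN [X in `|X|](_ : _ = (u0 - phi (y t)^-1%g - (phi (y t) - u0))
  + (phi (y t) - u0 - w t)); last first.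
  by apply/matrixP => i j; rewrite !mxE; ring.
apply: le_trans (ler_normD _ _) _.
apply: (@le_trans _ _ (d * (C1 * r t) + d * r t)).
  by apply: lerD => //; apply: le_trans M _; rewrite ler_wpM2l // ltW.
rewrite [leLHS](_ : _ = (C1 + 1) * d * r t); last by ring.
by rewrite ler_wpM2r.
Unshelve. all: by end_near. Qed.

Lemma tang_map (f : G -> G) y w r : f 1%g = 1%g ->
  {for 1%g, continuous f} -> differentiable (phi \o f \o psi) u0 ->
  tang F y w r -> tang F (fun t => f (y t)) (fun t => w t *m lie_diff c f) r.
Proof.
move=> f1 fc fd t1; have [C1 C10 b1] := tang_bound t1.
set J := lie_diff c f.
split.
- have fc1 : f @ (1%g : G) --> (1%g : G) by rewrite -[in X in _ --> X]f1; exact: fc.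
  by case: t1 => [y1c _ _]; exact: cvg_comp y1c fc1.
- exists (n%:R * C1 * `|J|); apply: filterS b1 => t [b1 _].
  apply: le_trans (norm_mulmx _ _) _.
  rewrite [leRHS](_ : _ = n%:R * (C1 * r t) * `|J|); last by ring.
  by rewrite ler_wpM2r // ler_wpM2l.
move=> e e0; have [d d0 dle] := tang_err (C1 + n%:R * `|J|) e0.
have H := tang_phi t1 (differentiable_eps fd d0).
have D1 := tang_dom t1.
have r0 := tang_ge0 t1.
case: t1 => [_ _ /(_ d d0) e1].
near=> t.
have : `|(phi \o f \o psi) (phi (y t)) - (phi \o f \o psi) u0 -
   'd (phi \o f \o psi) u0 (phi (y t) - u0)| <= d * `|phi (y t) - u0| by near: t.
rewrite /= !chart_invK //; last by near: t.
rewrite f1 -[X in _ - X](mul_rV_lin1 ('d (phi \o f \o psi) u0)).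
rewrite -[lin1_mx _]/J => M.
have [_ B1] : `|w t| <= C1 * r t /\ `|phi (y t) - u0| <= C1 * r t by near: t.
have e1t : `|phi (y t) - u0 - w t| <= d * r t by near: t.
have r0t : 0 <= r t by near: t.
rewrite [X in `|X|](_ : _ = (phi (f (y t)) - u0 - (phi (y t) - u0) *m J)
  + (phi (y t) - u0 - w t) *m J); last first.
  by rewrite (mulmxBl (phi (y t) - u0)) addrA subrK.
apply: le_trans (ler_normD _ _) _.
apply: (@le_trans _ _ (d * (C1 * r t) + n%:R * (d * r t) * `|J|)).
  apply: lerD => //; first by apply: le_trans M _; rewrite ler_wpM2l // ltW.
  apply: le_trans (norm_mulmx _ _) _.
  by rewrite ler_wpM2r // ler_wpM2l.
rewrite [leLHS](_ : _ = (C1 + n%:R * `|J|) * d * r t); last by ring.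
by rewrite ler_wpM2r.
Unshelve. all: by end_near. Qed.

Lemma tang_unique y w w' r : tang F y w r -> tang F y w' r ->
  forall e, 0 < e -> \forall t \near F, `|w t - w' t| <= e * r t.
Proof.
move=> [_ _ H] [_ _ H'] e e0; have e20 : 0 < e / 2 by rewrite divr_gt0.
apply: filterS2 (H _ e20) (H' _ e20) => t.
rewrite -normrN => h h'; rewrite [e]splitr mulrDl.
rewrite [X in `|X|](_ : _ = - (phi (y t) - u0 - w t) + (phi (y t) - u0 - w' t)).
  by apply: le_trans (ler_normD _ _) _; exact: lerD.
by apply/matrixP => i j; rewrite !mxE; ring.
Qed.

Lemma tang_eqo y w w' r : tang F y w r ->
  (forall e, 0 < e -> \forall t \near F, `|w t - w' t| <= e * r t) ->
  tang F y w' r.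
Proof.
move=> t1 ww; have [C C0 b1] := tang_bound t1; have [y1 _ H] := t1.
split=> //.
  exists (C + 1); apply: filterS2 b1 (ww _ ltr01) => t [b1 _] ww1.
  rewrite -[w' t](subKr (w t)) mulrDl.
  by apply: le_trans (ler_normB _ _) _; exact: lerD.
move=> e e0; have e20 : 0 < e / 2 by rewrite divr_gt0.
apply: filterS2 (H _ e20) (ww _ e20) => t h h'; rewrite [e]splitr mulrDl.
rewrite [X in `|X|](_ : _ = (phi (y t) - u0 - w t) + (w t - w' t)).
  by apply: le_trans (ler_normD _ _) _; exact: lerD.
by rewrite addrA subrK.
Qed.

(** Coarsens the scale of the error, so that factors tending to 1 at different rates can be
    multiplied. *)
Lemma tang_le y w r r' K : (\forall t \near F, r t <= K * r' t) ->
  (\forall t \near F, 0 <= r' t) ->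
  tang F y w r -> tang F y w r'.
Proof.
move=> rr r'0 t1; have [C C0 b1] := tang_bound t1; have [y1 _ H] := t1.
split=> //.
  exists (C * K); apply: filterS2 b1 rr => t [b1 _] rr.
  by apply: le_trans b1 _; rewrite -mulrA ler_wpM2l // ltW.
move=> e e0; have [d d0 dle] := tang_err K e0.
apply: filterS3 (H _ d0) rr r'0 => t h rr r'0; apply: le_trans h _.
apply: (@le_trans _ _ (d * (K * r' t))); first by rewrite ler_wpM2l // ltW.
by rewrite mulrA ler_wpM2r // mulrC.
Qed.

End Rules.

Lemma tang_comp (T T' : Type) (F : set_system T) (F' : set_system T')
    (g : T' -> T) y w r : g @ F' --> F ->
  tang F y w r -> tang F' (y \o g) (w \o g) (r \o g).
Proof.
move=> gF [y1 [C wC] H]; split; first exact: cvg_comp gF y1.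
  by exists C; exact: gF wC.
by move=> e e0; exact: gF (H e e0).
Qed.

(** The universal example: pushing it through a map of G exhibits the differential of the map as a
    tangent part, and uniqueness then yields identities between differentials. *)
Lemma tang_chart : tang (nbhs (0 : E)) (fun w => psi (u0 + w)) id (fun w => `|w|).
Proof.
have a0 : (fun w : E => u0 + w) @ (0 : E) --> u0.
  move=> A /nbhs_ballP[e /= e0 eA]; apply/nbhs_ballP; exists e => // w.
  rewrite -!ball_normE /= sub0r normrN => we; apply: eA.
  by rewrite -ball_normE /= opprD addrA subrr sub0r normrN.
split.
- apply: (@cvg_comp _ _ _ (fun w => u0 + w) psi _ _ _ a0); exact: (chart_inv_cvgx cc c_at1).
- by exists 1; near=> w; rewrite mul1r.
move=> e e0; near=> w.
have iw : chart_img c (u0 + w).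
  by near: w; exact: (a0 _ (near_chart_img cc c_at1)).
by rewrite chart_mapK // [u0 + w]addrC addrK subrr normr0 mulr_ge0 // ltW.
Unshelve. all: by end_near. Qed.

End Tang.

(** * The adjoint representation and automorphisms *)

Section Ad.
Context {R : realType} {n : nat} {G : lieGroupType R n}.
Variable c : chart 'rV[R]_n G.
Hypotheses (c_atlas : atlas G c) (c_at1 : chart_dom c 1%g).

Local Notation E := 'rV[R]_n.
Local Notation phi := (chart_map c).
Local Notation psi := (chart_inv c).
Local Notation u0 := (phi 1%g).
Local Notation tang := (tang c).

Let cc : is_chart c := atlas_is_chart _ c_atlas.

Definition conj (g x : G) : G := (g * x * g^-1)%g.

Lemma conj1 g : conj g 1%g = 1%g.
Proof. by rewrite /conj mulg1 mulgV. Qed.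

Lemma conj_cvg g (T : Type) (F : set_system T) (x : T -> G) a : Filter F ->
  x @ F --> a -> (fun t => conj g (x t)) @ F --> conj g a.
Proof.
move=> FF xa; apply: cvg_mulg; last exact: cvg_cst.
by apply: cvg_mulg => //; exact: cvg_cst.
Qed.

(** As [g] may lie outside the domain of [c], left translation goes from [c] to a chart [d] around
    [g], and right translation comes back using a chart [d'] around its inverse. *)
Lemma conj_diff g : differentiable (phi \o conj g \o psi) u0.
Proof.
have [d dA dg] := atlas_cover g; have [d' dA' dg'] := atlas_cover g^-1%g.
pose F1 := mul_chart d c d \o (fun u : E => (chart_map d g, u)).
pose F2 := mul_chart d d' c \o (fun u : E => (u, chart_map d' g^-1%g)).
have F1u0 : F1 u0 = chart_map d g.
  rewrite /F1 /mul_chart /= chart_invK ?chart_invK ?mulg1 //.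
  exact: atlas_is_chart.
have dF1 : differentiable F1 u0.
  apply: differentiable_comp; first exact: (ex_diff (is_diff_def := diff_pairr _ _)).
  apply: mul_chart_diff => //; apply: mul_chart_domP => //.
  by rewrite mulg1.
have dF2 : differentiable F2 (F1 u0).
  rewrite F1u0.
  apply: differentiable_comp; first exact: (ex_diff (is_diff_def := diff_pairl _ _)).
  apply: mul_chart_diff => //; apply: mul_chart_domP => //.
  by rewrite mulgV.
have dF := differentiable_comp dF1 dF2.
apply: (near_differentiable _ dF).1.
have gpsi : (fun u => g * psi u)%g @ u0 --> g.
  have H : (fun u => g * psi u)%g @ u0 --> (g * 1)%g.
    exact: (@cvg_mulg R n G E (nbhs u0) (fun=> g) psi g 1%g (nbhs_filter u0)
      (cvg_cst g) (chart_inv_cvgx cc c_at1)).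
  by rewrite mulg1 in H.
near=> u.
have du : chart_dom d (g * psi u)%g.
  by near: u; exact: (gpsi _ (near_chart_dom (atlas_is_chart _ dA) dg)).
by rewrite /F2 /F1 /mul_chart /= !chart_invK //; exact: atlas_is_chart.
Unshelve. all: by end_near. Qed.

Lemma tang_conj (T : Type) (F : set_system T) y w r g : Filter F ->
  tang F y w r -> tang F (fun t => conj g (y t)) (fun t => w t *m Ad c g) r.
Proof.
move=> FF; apply: tang_map => //; [exact: conj1|exact: conj_cvg|exact: conj_diff].
Qed.

(** Identities between differentials follow by expanding the same map in two ways, in place of a
    chain rule in charts. *)
Lemma tang_lin_unique y (A B : 'M[R]_n) :
  tang (nbhs (0 : E)) y (fun w => w *m A) (fun w => `|w|) ->
  tang (nbhs (0 : E)) y (fun w => w *m B) (fun w => `|w|) -> A = B.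
Proof.
move=> tA tB; have H := tang_unique tA tB.
suff D (w : E) : w *m (A - B) = 0.
  apply/eqP; rewrite -subr_eq0; apply/eqP/row_matrixP => i.
  by rewrite rowE D row0.
apply/eqP; rewrite -normr_eq0 eq_le normr_ge0 andbT.
have [->|w0] := eqVneq w 0; first by rewrite mul0mx normr0.
have nw : 0 < `|w| by rewrite normr_gt0.
apply/ler_addgt0Pr => e e0; rewrite add0r.
have /nbhs_ballP[d /= d0 dH] := H (nbhs_filter _) _ (divr_gt0 e0 nw).
(* By homogeneity [w] may be rescaled into the ball where the estimate holds. *)
have [s s0 sw] : exists2 s : R, 0 < s & s * `|w| = d / 2.
  by exists (d / 2 / `|w|); rewrite ?divfK ?divr_gt0 // gt_eqF.
have := dH (s *: w).
rewrite -mulmxBr -scalemxAl -ball_normE /= sub0r normrN.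
rewrite (normrZ s w) (normrZ s (w *m _)) gtr0_norm // sw => dw.
have {dw} : s * `|w *m (A - B)| <= e / `|w| * (d / 2) by apply: dw; lra.
rewrite -sw mulrCA divfK ?gt_eqF // ler_pM2l //.
Qed.

Lemma Ad_mul g h : Ad c (g * h)%g = Ad c h *m Ad c g.
Proof.
have t := tang_chart c_atlas c_at1; have F0 := nbhs_filter (0 : E).
apply: (@tang_lin_unique (fun w => conj (g * h)%g (psi (u0 + w)))).
  exact: tang_conj t.
have := tang_conj g F0 (tang_conj h F0 t).
apply: (eq_tang (FF := F0)); apply: nearW => w; last by rewrite mulmxA.
by rewrite /conj invgM !mulgA.
Qed.

Lemma Ad1 : Ad c (1%g : G) = 1%:M.
Proof.
have t := tang_chart c_atlas c_at1; have F0 := nbhs_filter (0 : E).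
apply: (@tang_lin_unique (fun w => conj 1%g (psi (u0 + w)))).
  exact: tang_conj t.
apply: (eq_tang (FF := F0)) t; apply: nearW => w; last by rewrite mulmx1.
by rewrite /conj mul1g invg1 mulg1.
Qed.

Lemma Ad_mulV g : Ad c g *m Ad c g^-1%g = 1%:M.
Proof. by rewrite -Ad_mul mulVg Ad1. Qed.

Lemma Ad_unit g : Ad c g \in unitmx.
Proof. exact: (mulmx1_unit (Ad_mulV g)).1. Qed.

Lemma Ad_inv g : Ad c g^-1%g = invmx (Ad c g).
Proof.
by rewrite -[LHS](mulKmx (Ad_unit g)) Ad_mulV mulmx1.
Qed.

Section Automorphism.
Variable f : G -> G.
Hypothesis f_aut : lie_automorphism f.

Lemma aut1 : f 1%g = 1%g.
Proof.
have [fM _ _] := f_aut; apply: (@mulgI _ (f 1%g)).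
by rewrite -fM !mulg1.
Qed.

Lemma autV x : f x^-1%g = (f x)^-1%g.
Proof.
have [fM _ _] := f_aut; apply: (@mulgI _ (f x)).
by rewrite -fM !mulgV aut1.
Qed.

Lemma aut_continuous : continuous f.
Proof. by have [_ [fc _] _] := f_aut. Qed.

Lemma aut_diff : differentiable (phi \o f \o psi) u0.
Proof.
have [_ [_ fs] _] := f_aut; apply: (smooth_on_diff (fs c c c_atlas c_atlas)).
by exists 1%g => //; split=> //; rewrite /= aut1.
Qed.

Lemma tang_aut (T : Type) (F : set_system T) y w r : Filter F ->
  tang F y w r -> tang F (fun t => f (y t)) (fun t => w t *m lie_diff c f) r.
Proof.
move=> FF; apply: tang_map => //; [exact: aut1|exact: aut_continuous|].
exact: aut_diff.
Qed.

Lemma Ad_aut g : Ad c g *m lie_diff c f = lie_diff c f *m Ad c (f g).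
Proof.
have [fM _ _] := f_aut.
have t := tang_chart c_atlas c_at1; have F0 := nbhs_filter (0 : E).
apply: (@tang_lin_unique (fun w => f (conj g (psi (u0 + w))))).
  have := tang_aut F0 (tang_conj g F0 t).
  by apply: (eq_tang (FF := F0)); apply: nearW => w //; rewrite mulmxA.
have := tang_conj (f g) F0 (tang_aut F0 t).
apply: (eq_tang (FF := F0)); apply: nearW => w; last by rewrite mulmxA.
by rewrite /conj !fM autV.
Qed.

End Automorphism.

End Ad.

(** * Differentiability of Ad and its differential *)

Section LittleAd.
Context {R : realType} {n : nat} {G : lieGroupType R n}.
Variable c : chart 'rV[R]_n G.
Hypotheses (c_atlas : atlas G c) (c_at1 : chart_dom c 1%g).

Local Notation E := 'rV[R]_n.
Local Notation phi := (chart_map c).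
Local Notation psi := (chart_inv c).
Local Notation u0 := (phi 1%g).
Local Notation tang := (tang c).
Local Notation m := (mul_chart c c c).

Let cc : is_chart c := atlas_is_chart _ c_atlas.

Let iota (u : E) : E := phi (psi u)^-1%g.

Lemma iota_diff : differentiable iota u0.
Proof.
have [_ H] := @lie_inv_smooth R n G.
apply: (smooth_on_diff (H c c c_atlas c_atlas)).
by exists 1%g => //; split=> //; rewrite /= invg1.
Qed.

Lemma AdE x i j :
  Ad c x i j = 'd (phi \o conj x \o psi) u0 (delta_mx 0 i) 0 j.
Proof. by rewrite /Ad /lie_diff /jacobian mxE. Qed.

(** Conjugation is left translation by [psi u], of differential ['d m (u, u0) (0, _)], followed by
    right translation by its inverse. This writes Ad through first derivatives of the
    multiplication, which are themselves differentiable. *)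
Lemma Ad_chartE : \forall u \near u0, forall i j, Ad c (psi u) i j =
  \sum_(k < n) 'd m (u, u0) (0, delta_mx 0 i) 0 k *
               'd m (u, iota u) (delta_mx 0 k, 0) 0 j.
Proof.
have H : (fun u : E => (psi u)^-1)%g @ u0 --> (1^-1 : G)%g.
  exact: (@cvg_invg R n G E (nbhs u0) psi 1%g (nbhs_filter u0)
    (chart_inv_cvgx cc c_at1)).
rewrite invg1 in H.
near=> u; have iu : chart_img c u by near: u; exact: (near_chart_img cc c_at1).
have Dx : chart_dom c (psi u) by exact: chart_inv_dom.
have Dx' : chart_dom c (psi u)^-1%g.
  by near: u; exact: (H _ (near_chart_dom cc c_at1)).
set x := psi u in Dx Dx' *; have uE : u = phi x by rewrite chart_mapK.
have U1 : mul_chart_dom c c c (u, u0).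
  by rewrite uE; apply: mul_chart_domP => //; rewrite mulg1.
have U2 : mul_chart_dom c c c (u, iota u).
  by rewrite /iota -/x [u in (u, _)]uE; apply: mul_chart_domP => //; rewrite mulgV.
have mu : m (u, u0) = u by rewrite /mul_chart /= chart_invK // mulg1 -uE.
have dm1 : is_diff (u, u0) m ('d m (u, u0)).
  by split=> //; exact: mul_chart_diff U1.
have dm2 : is_diff (u, iota u) m ('d m (u, iota u)).
  by split=> //; exact: mul_chart_diff U2.
have d1 := is_diff_comp (diff_pairr u u0) dm1.
have d2' := is_diff_comp (diff_pairl u (iota u)) dm2.
have d2 : is_diff ((m \o (fun v : E => (u, v))) u0)
    (m \o (fun v : E => (v, iota u)))
    ('d m (u, iota u) \o (fun k : E => (k, 0))).
  by rewrite /= mu.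
have d3 := is_diff_comp d1 d2.
have near_eq : \forall v \near u0,
   ((m \o (fun v : E => (v, iota u))) \o (m \o (fun v : E => (u, v)))) v =
   (phi \o conj x \o psi) v.
  have Hx : (fun v => x * psi v)%g @ u0 --> (x * 1)%g.
    exact: (@cvg_mulg R n G E (nbhs u0) (fun=> x) psi x 1%g (nbhs_filter u0)
      (cvg_cst x) (chart_inv_cvgx cc c_at1)).
  rewrite mulg1 in Hx.
  near=> v; have Dv : chart_dom c (x * psi v)%g.
    by near: v; exact: (Hx _ (near_chart_dom cc Dx)).
  by rewrite /mul_chart /= /iota -/x !chart_invK.
have [_ dE] := near_differentiable near_eq (ex_diff (is_diff_def := d3)).
move=> i j; rewrite AdE dE.
rewrite (@diff_val _ _ _ _ _ _ _ d3).
have K (v : E) : 'd m (u, iota u) (v, 0) 0 j =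
    \sum_(k < n) v 0 k * 'd m (u, iota u) (delta_mx 0 k, 0) 0 j.
  by rewrite diff_mul_pairl summxE; apply: eq_bigr => k _; rewrite mxE.
exact: K.
Unshelve. all: by end_near. Qed.

Lemma Ad_chart_diff i j : differentiable (fun u => Ad c (psi u) i j) u0.
Proof.
have U0 := mul_dom1 c_at1.
have i0 : iota u0 = u0 by rewrite /iota chart_invK // invg1.
have dp1 : differentiable (fun u : E => (u, u0)) u0.
  exact: (ex_diff (is_diff_def := diff_pairl _ _)).
have dp2 : differentiable (fun u : E => (u, iota u)) u0.
  by apply: differentiable_pair => //; exact: iota_diff.
pose a k := (fun A : E => A 0 k) \o (fun q => 'd m q (0, delta_mx 0 i)) \o
  (fun u : E => (u, u0)).
pose b k := (fun A : E => A 0 j) \o (fun q => 'd m q (delta_mx 0 k, 0)) \o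
  (fun u : E => (u, iota u)).
have da k : differentiable (a k) u0.
  apply: differentiable_comp => //; apply: differentiable_comp.
    exact: (mul_chart_diff2 c_atlas c_atlas c_atlas _ U0).
  exact: differentiable_coord.
have db k : differentiable (b k) u0.
  apply: differentiable_comp => //; apply: differentiable_comp.
    by rewrite i0; exact: (mul_chart_diff2 c_atlas c_atlas c_atlas _ U0).
  exact: differentiable_coord.
have dab : differentiable (\sum_(k < n) (a k * b k)) u0.
  by apply: differentiable_sum => k; exact: differentiableM.
apply: (near_differentiable _ dab).1.
apply: filterS Ad_chartE => u ->.
by rewrite fct_sumE.
Qed.

(** The differential of Ad at 1: [w *m ad v] is the Lie bracket [v, w]. *)
Definition ad (v : E) : 'M[R]_n :=
  \matrix_(i, j) 'd (fun u => Ad c (psi u) i j) u0 v.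

Lemma adD v w : ad (v + w) = ad v + ad w.
Proof. by apply/matrixP => i j; rewrite !mxE linearD. Qed.

Lemma adZ a v : ad (a *: v) = a *: ad v.
Proof. by apply/matrixP => i j; rewrite !mxE linearZ. Qed.

Lemma Ad_tang (T : Type) (F : set_system T) (FF : Filter F) y w r e :
  tang F y w r -> 0 < e ->
  \forall t \near F, `|Ad c (y t) - 1%:M - ad (w t)| <= e * r t.
Proof.
move=> t1 e0; have r0 := tang_ge0 (FF := FF) t1.
suff H i j : \forall t \near F,
    `|(Ad c (y t) - 1%:M - ad (w t)) i j| <= e * r t.
  pose P i j t := `|(Ad c (y t) - 1%:M - ad (w t)) i j| <= e * r t.
  have := @filter_forall _ _ (fun i t => forall j, P i j t) F FF
    (fun i => @filter_forall _ _ (P i) F FF (H i)).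
  apply: filterS2 r0 => t r0 H1; apply: mx_norm_le => //.
  by rewrite mulr_ge0 // ltW.
pose f u := Ad c (psi u) i j.
have df : differentiable f u0 by exact: Ad_chart_diff.
have [k k0 kL] := linear_lipschitz (diff_continuous df).
have [C1 C10 b1] := tang_bound (FF := FF) t1.
have [d d0 dle] := tang_err (C1 + k) e0.
have H := tang_phi c_atlas c_at1 t1 (differentiable_eps df d0).
have D1 := tang_dom c_atlas c_at1 t1.
case: t1 => [_ _ /(_ d d0) e1].
near=> t.
have M : `|f (phi (y t)) - f u0 - 'd f u0 (phi (y t) - u0)| <=
  d * `|phi (y t) - u0| by near: t.
move: M; rewrite /f !chart_invK //; last by near: t.
rewrite -/f (Ad1 c_atlas c_at1) => M.
have [_ B1] : `|w t| <= C1 * r t /\ `|phi (y t) - u0| <= C1 * r t by near: t.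
have e1t : `|phi (y t) - u0 - w t| <= d * r t by near: t.
have r0t : 0 <= r t by near: t.
rewrite [X in `|X|](_ : _ = (Ad c (y t) i j - (1%:M : 'M[R]_n) i j -
    'd f u0 (phi (y t) - u0)) + 'd f u0 (phi (y t) - u0 - w t)); last first.
  by rewrite (linearB _ _ (w t)) addrA subrK !mxE.
apply: le_trans (ler_normD _ _) _.
apply: (@le_trans _ _ (d * (C1 * r t) + k * (d * r t))).
  apply: lerD; first by apply: le_trans M _; rewrite ler_wpM2l // ltW.
  by apply: le_trans (kL _) _; rewrite ler_wpM2l // ltW.
rewrite [leLHS](_ : _ = (C1 + k) * d * r t); last by ring.
by rewrite ler_wpM2r.
Unshelve. all: by end_near. Qed.

Lemma Ad_cvg1 (T : Type) (F : set_system T) (FF : Filter F) (x : T -> G) i j :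
  x @ F --> (1%g : G) -> (fun t => Ad c (x t) i j) @ F --> Ad c (1%g : G) i j.
Proof.
move=> x1; have phix : (fun t => phi (x t)) @ F --> u0.
  by apply: (@cvg_comp _ _ _ x phi _ _ _ x1); exact: (chart_map_cvg cc c_at1).
have D1 : \forall t \near F, chart_dom c (x t).
  by apply: x1; exact: (near_chart_dom cc c_at1).
apply/cvgrPdist_le => e e0.
have H := phix _ (differentiable_near_dist (Ad_chart_diff i j) e0).
near=> t; rewrite distrC.
have : `|Ad c (psi (phi (x t))) i j - Ad c (psi u0) i j| <= e by near: t.
by rewrite !chart_invK //; near: t.
Unshelve. all: by end_near. Qed.

(** Continuity at 1 is carried to [a] by multiplicativity of Ad. *)
Lemma Ad_cvg (T : Type) (F : set_system T) (FF : Filter F) (x : T -> G) a i j :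
  x @ F --> a -> (fun t => Ad c (x t) i j) @ F --> Ad c a i j.
Proof.
move=> xa.
have x1 : (fun t => x t * a^-1)%g @ F --> (1%g : G).
  by rewrite -(mulgV a); apply: cvg_mulg => //; exact: cvg_cst.
have -> : (fun t => Ad c (x t) i j) =
    (fun t => \sum_k Ad c a i k * Ad c (x t * a^-1)%g k j).
  apply/funext => t; rewrite -[x t in LHS](mulgVK a).
  by rewrite [Ad c _ in LHS](Ad_mul c_atlas c_at1 (x t * a^-1)%g a) mulmxEij.
have E1 : \sum_k Ad c a i k * Ad c (1%g : G) k j = Ad c a i j.
  by rewrite -mulmxEij -(Ad_mul c_atlas c_at1) mul1g.
rewrite -[X in _ --> X]E1.
elim: (index_enum _) => [|k r IHr].
  by under eq_fun do rewrite big_nil; rewrite big_nil; exact: cvg_cst.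
under eq_fun do rewrite big_cons; rewrite big_cons.
apply: cvgD => //; apply: cvgM; first exact: cvg_cst.
exact: Ad_cvg1.
Qed.

End LittleAd.

#[local] Opaque Ad.

(** * Right logarithmic derivatives of curves *)

Section EpsDerive.
Context {R : realType}.
Implicit Types (f : R -> R) (s : R).

Lemma near_shift0 (P : R -> Prop) s :
  (\forall h \near (0 : R), P (s + h)) <-> (\forall t \near s, P t).
Proof.
split=> /nbhs_ballP[e /= e0 eP]; apply/nbhs_ballP; exists e => // t.
  rewrite -ball_normE /= => st; rewrite -[t](subrK s) addrC.
  by apply: eP; rewrite -ball_normE /= sub0r opprB.
rewrite -ball_normE /= sub0r normrN => t0; apply: eP.
by rewrite -ball_normE /= opprD addrA subrr sub0r normrN.
Qed.

Lemma eps_is_derive f s d :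
  (forall e, 0 < e ->
    \forall h \near (0 : R), `|f (s + h) - f s - h * d| <= e * `|h|) ->
  is_derive s 1 f d.
Proof.
move=> H.
have lin_d : linear ( *:%R^~ d : R -> R).
  by move=> u y z; rewrite scalerDl scalerA.
pose dM := GRing.isLinear.Build _ _ _ _ _ lin_d.
pose L : {linear R -> R} := HB.pack ( *:%R^~ d : R -> R) dM.
have [df dE] : differentiable f s /\ 'd f s = L :> (R -> R).
  apply: eps_differentiable; first exact: scalel_continuous.
  move=> e e0; apply/near_shift0; apply: filterS (H e e0) => h.
  by rewrite [s + h - s]addrAC subrr add0r.
have dv : derivable f s 1 by exact: diff_derivable.
by split=> //; rewrite deriveE // dE /= scale1r.
Qed.

Lemma is_derive_eps f s d : is_derive s 1 f d -> forall e, 0 < e ->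
  \forall h \near (0 : R), `|f (s + h) - f s - h * d| <= e * `|h|.
Proof.
move=> fd e e0; have df : differentiable f s.
  by apply/derivable1_diffP; exact: ex_derive.
have dE h : 'd f s h = h * d.
  rewrite -[h in LHS]mulr1 -[h * 1]/(h *: 1) linearZ /= -deriveE //.
  by rewrite derive_val.
have := differentiable_eps df e0; move/near_shift0; apply: filterS => h.
by rewrite [s + h - s]addrAC subrr add0r dE.
Qed.

End EpsDerive.

Lemma mulmx_expansion {R : comNzRingType} n (A B D : 'M[R]_n) h i j :
  (A *m B) i j - A i j - h * (A *m D) i j =
  (A *m (B - 1%:M - h *: D)) i j.
Proof. by rewrite !mulmxBr mulmx1 -scalemxAr !mxE. Qed.

Section Curves.
Context {R : realType} {n : nat} {G : lieGroupType R n}.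
Variable c : chart 'rV[R]_n G.
Hypotheses (c_atlas : atlas G c) (c_at1 : chart_dom c 1%g).

Local Notation E := 'rV[R]_n.
Local Notation phi := (chart_map c).
Local Notation u0 := (phi 1%g).
Local Notation tang := (tang c).
Local Notation m := (mul_chart c c c).

Let cc : is_chart c := atlas_is_chart _ c_atlas.
Let F0 : Filter (nbhs (0 : R)) := nbhs_filter (0 : R).

(* [v] = x'(s) x(s)^-1 *)
Definition rlog (x : R -> G) (s : R) (v : E) : Prop :=
  tang (nbhs (0 : R)) (fun h => x (s + h) * (x s)^-1)%g
    (fun h => h *: v) (fun h => `|h|).

Lemma eq_rlog x y s v w : x =1 y -> v = w -> rlog x s v -> rlog y s w.
Proof.
move=> xy <-; apply: (eq_tang (FF := F0)); apply: nearW => // h.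
by rewrite !xy.
Qed.

Lemma rlog_continuous x s v : rlog x s v -> x @ s --> x s.
Proof.
move=> [x1 _ _] A /= As.
have H : (fun h => x (s + h) * (x s)^-1 * x s)%g @ (0 : R) --> (1 * x s)%g.
  exact: (cvg_mulg F0 x1 (cvg_cst (x s))).
rewrite mul1g in H; apply: (near_shift0 (fun t => A (x t)) s).1.
have HA : \forall h \near (0 : R), A (x (s + h) * (x s)^-1 * x s)%g := H A As.
by apply: filterS HA => h; rewrite mulgVK.
Qed.

Lemma rlog_mul x y s v w : rlog x s v -> rlog y s w ->
  rlog (fun t => x t * y t)%g s (v + w *m Ad c (x s)).
Proof.
move=> rx ry.
have := tang_mul (FF := F0) c_atlas c_at1 rx
  (tang_conj c_atlas c_at1 (x s) F0 ry).
apply: (eq_tang (FF := F0)); apply: nearW => h; last first.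
  by rewrite -scalemxAl scalerDr.
by rewrite /conj invgM !mulgA mulgVK.
Qed.

Lemma rlog_inv x s v : rlog x s v ->
  rlog (fun t => (x t)^-1)%g s (- (v *m Ad c (x s)^-1%g)).
Proof.
move=> rx.
have := tang_conj c_atlas c_at1 (x s)^-1%g F0
  (tang_inv (FF := F0) c_atlas c_at1 rx).
apply: (eq_tang (FF := F0)); apply: nearW => h; last first.
  by rewrite mulNmx -scalemxAl scalerN.
by rewrite /conj invgM !invgK !mulgA mulVg mul1g.
Qed.

Lemma rlog_Ad x s v i j : rlog x s v ->
  is_derive s 1 (fun t => Ad c (x t) i j) ((Ad c (x s) *m ad c v) i j).
Proof.
move=> rx; apply: eps_is_derive => e e0.
set A := Ad c (x s).
have [d d0 dle] := tang_err (n%:R * `|A|) e0.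
have := Ad_tang c_atlas c_at1 F0 rx d0.
apply: filterS => h H.
have -> : Ad c (x (s + h)) = A *m Ad c (x (s + h) * (x s)^-1)%g.
  by rewrite -(Ad_mul c_atlas c_at1) mulgVK.
set B := Ad c _ in H *.
have -> : (A *m B) i j - A i j - h * (A *m ad c v) i j =
    (A *m (B - 1%:M - ad c (h *: v))) i j.
  by rewrite adZ mulmx_expansion.
apply: le_trans (mx_entry_le _ _ _) _; apply: le_trans (norm_mulmx _ _) _.
apply: (@le_trans _ _ (n%:R * `|A| * (d * `|h|))).
  by rewrite ler_wpM2l // mulr_ge0.
by rewrite mulrA ler_wpM2r.
Qed.

Lemma rlog_comp x (p : R -> R) s d v :
  rlog x (p s) v -> is_derive s 1 p d -> rlog (x \o p) s (d *: v).
Proof.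
move=> rx dp.
have pc : {for s, continuous p}.
  apply: differentiable_continuous.
  by apply/derivable1_diffP; exact: ex_derive.
have p0 : (fun h => p (s + h) - p s) @ (0 : R) --> (0 : R).
  move=> A A0; have : \forall t \near s, A (p t - p s).
    have B : nbhs (p s) [set u | A (u - p s)].
      apply: (near_shift0 (fun u => A (u - p s)) (p s)).1.
      by apply: filterS A0 => h; rewrite [p s + h]addrC addrK.
    exact: pc _ B.
  by move/near_shift0.
have t1 := tang_comp p0 rx.
have dpe := is_derive_eps dp.
have t2 : tang (nbhs (0 : R)) (fun h => x (p (s + h)) * (x (p s))^-1)%g
    (fun h => (p (s + h) - p s) *: v) (fun h => `|h|).
  (* The expansion of [p] with tolerance 1 bounds its increments by (|d| + 1) |h|. *)
  apply: (@tang_le _ _ _ _ _ _ F0 _ _ _ _ (`|d| + 1)) (_ : tang _ _ _ (fun h => `|p (s + h) - p s|)).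
  - apply: filterS (dpe _ ltr01) => h; rewrite mul1r => H.
    rewrite -[p (s + h) - p s](subrK (h * d)).
    apply: le_trans (ler_normD _ _) _; rewrite mulrDl mul1r addrC normrM mulrC.
    exact: lerD.
  - exact: nearW.
  - apply: (eq_tang (FF := F0)) t1; apply: nearW => h //=.
    by rewrite addrC subrK.
apply: (tang_eqo (FF := F0) t2) => e e0.
have [a a0 ale] := tang_err `|v| e0.
apply: filterS (dpe _ a0) => h H.
rewrite scalerA -scalerBl normrZ.
apply: (@le_trans _ _ (a * `|h| * `|v|)); first by rewrite ler_wpM2r.
rewrite [leLHS](_ : _ = `|v| * a * `|h|); last by ring.
by rewrite ler_wpM2r.
Qed.

Lemma rlog_aut f x s v : lie_automorphism f -> rlog x s v ->
  rlog (f \o x) s (v *m lie_diff c f).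
Proof.
move=> fA rx; have [fM _ _] := fA.
have := tang_aut c_atlas c_at1 fA F0 rx.
apply: (eq_tang (FF := F0)); apply: nearW => h; last by rewrite -scalemxAl.
by rewrite fM (autV fA).
Qed.

(** Translated to start at 1, the curve stays for a while in the chart; there its coordinates have
    zero derivative, and the mean value inequality makes them constant. *)
Lemma rlog0_near x s0 : (forall s, rlog x s 0) ->
  \forall s \near s0, x s = x s0.
Proof.
move=> rx; pose y s := (x s * (x s0)^-1)%g.
have yc s : y @ s --> y s.
  apply: (cvg_mulg (nbhs_filter s)); last exact: (@cvg_cst _ _ _ _ (nbhs_filter s)).
  exact: rlog_continuous (rx s).
have y0 : y s0 = 1%g by rewrite /y mulgV.
have phiy : (fun s => phi (y s)) @ s0 --> u0.
  rewrite -y0; apply: (@cvg_comp _ _ _ y phi _ _ _ (yc s0)).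
  by rewrite y0; exact: (chart_map_cvg cc c_at1).
have ydom : \forall s \near s0, chart_dom c (y s).
  by have := yc s0; rewrite y0; apply; exact: (near_chart_dom cc c_at1).
(* Tolerance 1 suffices: the increment of the left factor is already o(h). *)
have /nbhs_ballP[r /= r0 br] := mul_chart_left c_atlas c_at1 (@ltr01 R).
have H1 := phiy _ (nbhsx_ballx u0 r r0).
have /nbhs_ballP[r1 /= r10 br1] : \forall s \near s0,
    ball u0 r (phi (y s)) /\ chart_dom c (y s) by apply: filterI.
have dphi s : ball s0 r1 s -> differentiable (fun s => phi (y s)) s /\
    'd (fun s => phi (y s)) s = (\0%R : {linear R -> E}) :> (R -> E).
  move=> /br1 [bs Ds].
  apply: eps_differentiable; first by move=> z; exact: cvg_cst.
  move=> e e0; apply/near_shift0.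
  have e20 : 0 < e / 2 by rewrite divr_gt0.
  have [w1 _ /(_ _ e20) wH] := rx s.
  have Dw : \forall h \near (0 : R), chart_dom c (x (s + h) * (x s)^-1)%g.
    by apply: w1; exact: (near_chart_dom cc c_at1).
  have phiw : (fun h => phi (x (s + h) * (x s)^-1)%g) @ (0 : R) --> u0.
    apply: (@cvg_comp _ _ _ (fun h => x (s + h) * (x s)^-1)%g phi _ _ _ w1).
    exact: (chart_map_cvg cc c_at1).
  have H2 := phiw _ (nbhsx_ballx u0 r r0).
  near=> h.
  have [_] : mul_chart_dom c c c (phi (x (s + h) * (x s)^-1)%g, phi (y s)) /\
    `|m (phi (x (s + h) * (x s)^-1)%g, phi (y s)) - phi (y s) -
      (phi (x (s + h) * (x s)^-1)%g - u0)| <=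
    1 * `|phi (x (s + h) * (x s)^-1)%g - u0|.
    apply: (br (_, _)); split => //=.
    by near: h.
  rewrite /mul_chart /= !chart_invK //; last by near: h.
  rewrite {1}/y !mulgA mulgVK -/(y (s + h)) mul1r => M.
  have W : `|phi (x (s + h) * (x s)^-1)%g - u0 - h *: 0| <= e / 2 * `|h|.
    by near: h.
  rewrite scaler0 subr0 in W; rewrite subr0.
  rewrite -[phi (y (s + h)) - _](subrK (phi (x (s + h) * (x s)^-1)%g - u0)).
  rewrite [s + h - s]addrAC subrr add0r [e]splitr mulrDl.
  apply: le_trans (ler_normD _ _) _; apply: lerD => //.
  exact: le_trans M W.
near=> s.
have bs : ball s0 r1 s by near: s; exact: nbhsx_ballx.
have [bys Dys] := br1 s bs.
have : `|phi (y (s0 + (s - s0))) - phi (y s0) - 0| <= 0.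
  apply: (norm_mvt (f := fun s => phi (y s))) => t.
  rewrite in_itv /= => /andP[t0 t1].
  have [] := dphi (s0 + t *: (s - s0)).
    move: bs; rewrite -!ball_normE /= opprD addrA subrr sub0r normrN normrM.
    rewrite (ger0_norm t0) distrC; apply: le_lt_trans.
    by rewrite ler_piMl.
  by move=> D ->; split=> //=; rewrite subrr normr0.
rewrite [s0 + _]addrC subrK subr0 normr_le0 subr_eq0 y0 => /eqP E1.
have : y s = 1%g by rewrite -[y s](chart_invK cc) // E1 (chart_invK cc).
by rewrite /y => /(congr1 (fun g => g * x s0)%g); rewrite mulgVK mul1g.
Unshelve. all: by end_near. Qed.

Lemma rlog0_cst x s t : (forall s, rlog x s 0) -> x s = x t.
Proof.
(* The indicator of the fibre through [t] is locally constant, so its derivative is 0 and it is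
   constant on the whole line. *)
move=> rx; pose chi a : R := (`[<x a = x t>])%:R.
have dchi (a : R) : is_derive a 1 chi 0.
  apply: eps_is_derive => e e0.
  have H := (near_shift0 (fun b => x b = x a) a).2 (rlog0_near a rx).
  apply: filterS H => h; rewrite /chi => ->.
  by rewrite mulr0 !subrr normr0 mulr_ge0 // ltW.
have := is_derive_0_is_cst s t dchi.
rewrite /chi (asboolT (erefl (x t))); case: asboolP => // _ /eqP.
by rewrite eq_sym oner_eq0.
Qed.

End Curves.

(** * Existence of one-parameter subgroups *)

Lemma ultra_fmap (T U : Type) (f : T -> U) (F : set_system T) :
  UltraFilter F -> UltraFilter (f @ F).
Proof.
move=> FU; have PF : ProperFilter (f @ F) by exact: fmap_proper_filter.
split=> // H PH FH; apply/seteqP; split=> [A HA|A FA]; last exact: FH.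
have [//|FnA] := in_ultra_setVsetC (f @^-1` A) FU.
have HnA : H (~` A) by apply: FH.
have H0 : H set0 by rewrite -(setICr A); exact: filterI.
by case: (@filter_not_empty _ H PH).
Qed.

Section Exp.
Context {R : realType} {n : nat} {G : lieGroupType R n}.
Variable c : chart 'rV[R]_n G.
Hypotheses (c_atlas : atlas G c) (c_at1 : chart_dom c 1%g).

Local Notation E := 'rV[R]_n.
Local Notation phi := (chart_map c).
Local Notation psi := (chart_inv c).
Local Notation u0 := (phi 1%g).
Local Notation tang := (tang c).
Local Notation m := (mul_chart c c c).

Let cc : is_chart c := atlas_is_chart _ c_atlas.
Let F0 : Filter (nbhs (0 : R)) := nbhs_filter (0 : R).

(** Each new factor on the left costs at most a |w|, so the error grows linearly in [j]; the bound
    on (1 + a) j |w| keeps the powers in the ball where the multiplication estimate holds. *)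
Lemma pow_estimate a : 0 < a -> exists2 r, 0 < r & forall (w : E) j,
  `|w| < r -> (1 + a) * (j%:R * `|w|) < r ->
  [/\ chart_img c (phi (psi (u0 + w) ^+ j)%g), chart_dom c (psi (u0 + w) ^+ j)%g &
  `|phi (psi (u0 + w) ^+ j)%g - u0 - j%:R *: w| <= a * (j%:R * `|w|)].
Proof.
move=> a0; have /nbhs_ballP[r /= r0 br] := mul_chart_left c_atlas c_at1 a0.
exists r => // w j wr; set x := psi (u0 + w).
suff H : (1 + a) * (j%:R * `|w|) < r -> chart_dom c (x ^+ j)%g /\
    `|phi (x ^+ j)%g - u0 - j%:R *: w| <= a * (j%:R * `|w|).
  by move=> /H[Dx ?]; split=> //; exists (x ^+ j)%g.
elim: j => [|j IHj] jr.
  by rewrite expg0 subrr scale0r subr0 normr0 mul0r mulr0.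
have jw : j%:R * `|w| <= j.+1%:R * `|w| by rewrite ler_wpM2r // ler_nat.
have [|Dj Hj] := IHj.
  by apply: le_lt_trans jr; rewrite ler_wpM2l // addr_ge0 // ltW.
have pj : `|phi (x ^+ j)%g - u0| < r.
  apply: le_lt_trans jr.
  apply: le_trans (_ : (1 + a) * (j%:R * `|w|) <= _); last first.
    by rewrite ler_wpM2l // addr_ge0 // ltW.
  rewrite -[phi _ - _](subrK (j%:R *: w)) mulrDl mul1r addrC.
  apply: le_trans (ler_normD _ _) _; apply: lerD => //.
  by rewrite normrZ ger0_norm.
have [[] /= [y z] [/= [Dy Dz] Dyz] [Ey Ez]] : mul_chart_dom c c c (u0 + w, phi (x ^+ j)%g) /\
   `|m (u0 + w, phi (x ^+ j)%g) - phi (x ^+ j)%g - (u0 + w - u0)| <= a * `|u0 + w - u0|.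
  apply: (br (_, _)); split; rewrite /= -ball_normE /=.
    by rewrite opprD addrA subrr sub0r normrN.
  by rewrite distrC.
have xE : x = y by rewrite /x -Ey chart_invK.
have zE : (x ^+ j)%g = z by rewrite -[(x ^+ j)%g](chart_invK cc) // -Ez chart_invK.
rewrite expgS /mul_chart /= -/x (chart_invK cc) // [u0 + w]addrC addrK => M.
split; first by rewrite xE -xE zE xE.
rewrite [X in `|X|](_ : _ = (phi (x * x ^+ j)%g - phi (x ^+ j)%g - w) +
   (phi (x ^+ j)%g - u0 - j%:R *: w)); last first.
  by rewrite -natr1 scalerDl scale1r; apply/matrixP => ? ?; rewrite !mxE; ring.
apply: le_trans (ler_normD _ _) _.
rewrite -natr1 mulrDl mul1r mulrDr addrC; exact: lerD.
Qed.

Variable e : E.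
(* The one-parameter subgroup tangent to [e] is a limit of the discrete ones
   generated by [x_ k] = 1 + e/k; an ultrafilter spares the convergence proof *)
Let x_ (k : nat) : G := psi (u0 + k.+1%:R^-1 *: e).
Let f_ (t : R) (k : nat) : G := (x_ k ^+ Num.truncn (t * k.+1%:R))%g.

Variable F : set_system nat.
Hypotheses (FU : UltraFilter F) (Foo : \oo `<=` F).

Let PF : ProperFilter F := @ultra_proper _ _ FU.
Let FF : Filter F := @filter_filter _ _ PF.

Let near_inv (d : R) : 0 < d -> \forall k \near F, k.+1%:R^-1 * `|e| < d.
Proof.
move=> d0; apply: Foo; exists (Num.truncn (`|e| / d)) => // k /= kd.
rewrite mulrC ltr_pdivrMr // mulrC -ltr_pdivrMr //.
apply: lt_le_trans (truncnS_gt _) _.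
by rewrite ler_nat.
Qed.

Let lim_f (t : R) (l : G) : Prop := f_ t @ F --> l.

Let lim_f_small a : 0 < a -> exists2 tau, 0 < tau &
  forall t, 0 <= t -> t <= tau -> exists l,
  [/\ lim_f t l, chart_dom c l & `|phi l - u0 - t *: e| <= a * (t * `|e|)].
Proof.
move=> a0; have [r r0 H] := pow_estimate a0.
have /nbhs_ballP[r1 /= r10 br1] := near_chart_img cc c_at1.
pose d := Num.min r r1; have d0 : 0 < d by rewrite lt_min r0.
(* For t up to [tau], (1 + a) t |e| is at most d / 2, so all [f_ t k] with [k] large lie in a
   compact ball inside the chart, where the ultrafilter has a limit. The summand 1 covers [e] =
   0. *)
pose tau := d / 2 / ((1 + a) * (`|e| + 1)).
have den0 : 0 < (1 + a) * (`|e| + 1).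
  by rewrite mulr_gt0 // ltr_wpDr // ltW.
exists tau; first by rewrite /tau !divr_gt0.
move=> t t0 ttau.
have te : (1 + a) * (t * `|e|) <= d / 2.
  move: ttau; rewrite /tau ler_pdivlMr // => ttau; apply: le_trans ttau.
  rewrite mulrCA ler_wpM2l // ler_wpM2l ?addr_ge0 ?(ltW a0) //.
  by rewrite lerDl.
pose j k := Num.truncn (t * k.+1%:R).
have jle k : (j k)%:R * (k.+1%:R^-1 * `|e|) <= t * `|e|.
  rewrite mulrA ler_wpM2r // ler_pdivrMr //.
  by have /andP[] := truncn_itv (mulr_ge0 t0 (ler0n R k.+1)).
have wE k : `|k.+1%:R^-1 *: e| = k.+1%:R^-1 * `|e|.
  by rewrite normrZ ger0_norm // invr_ge0.
have P k : k.+1%:R^-1 * `|e| < r -> chart_dom c (f_ t k) /\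
   `|phi (f_ t k) - u0 - ((j k)%:R / k.+1%:R) *: e| <= a * (t * `|e|).
  rewrite -wE => kr; have [|_ D1 D2] := H _ (j k) kr.
    rewrite wE; apply: (@le_lt_trans _ _ (d / 2)).
      by apply: le_trans te; rewrite ler_wpM2l // addr_ge0 // ltW.
    have : d <= r by rewrite /d ge_min lexx.
    by lra.
  split=> //; rewrite -scalerA; apply: le_trans D2 _.
  by rewrite wE ler_wpM2l // ltW.
pose A : set E := [set u | `|u0 - u| <= d / 2].
have Acl : closed A by exact: closed_closed_ball_.
have Abd : bounded_set A.
  exists (`|u0| + d / 2); split; first exact: num_real.
  move=> M /ltW dM u /= uA; apply: le_trans dM.
  rewrite -[u](subKr u0); apply: le_trans (ler_normB _ _) _.
  by rewrite lerD2l.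
have Aco := bounded_closed_compact Abd Acl.
have Aimg u : A u -> chart_img c u.
  move=> /= uA; apply: br1; rewrite -ball_normE /=.
  apply: le_lt_trans uA _; have : d <= r1 by rewrite /d ge_min lexx orbT.
  by lra.
have nearP := near_inv r0.
have Pn k : k.+1%:R^-1 * `|e| < r -> `|u0 - phi (f_ t k)| <= d / 2.
  move=> /P[_ Hk]; apply: le_trans te.
  rewrite distrC -[phi _ - _](subrK (((j k)%:R / k.+1%:R) *: e)).
  apply: le_trans (ler_normD _ _) _; rewrite mulrDl mul1r addrC; apply: lerD => //.
  by rewrite normrZ ger0_norm ?divr_ge0 // -mulrA; exact: jle.
have UG : UltraFilter ((fun k => phi (f_ t k)) @ F) by exact: ultra_fmap.
have GA : ((fun k => phi (f_ t k)) @ F) A.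
  by apply: filterS nearP => k kr /=; exact: Pn.
move: Aco; rewrite compact_ultra => /(_ _ UG GA) [u [/= uA cu]].
have iu := Aimg u uA.
exists (psi u); split; last first.
(* The estimate for a single late [k] passes to the limit, the truncated time differing from [t] by
   at most 1 / (k + 1). *)
- rewrite (chart_mapK cc) //; apply/ler_addgt0Pr => b b0.
  have b20 : 0 < b / 2 by rewrite divr_gt0.
  have C : \forall k \near F, `|u - phi (f_ t k)| <= b / 2.
    by move/cvgrPdist_le : (cu); apply.
  have [k [kr [k1 k2]]] := filter_ex (filterI nearP (filterI C (near_inv b20))).
  have [_ Hk] := P k kr.
  rewrite [X in `|X|](_ : _ = (phi (f_ t k) - u0 - ((j k)%:R / k.+1%:R) *: e) +
      ((u - phi (f_ t k)) + (((j k)%:R / k.+1%:R - t) *: e))); last first.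
    by rewrite scalerBl; apply/matrixP => ? ?; rewrite !mxE; ring.
  apply: le_trans (ler_normD _ _) _; apply: lerD => //.
  apply: le_trans (ler_normD _ _) _; rewrite [b]splitr; apply: lerD => //.
  apply: le_trans (ltW k2); rewrite normrZ ler_wpM2r // distrC.
  have /andP[j1 j2] := truncn_itv (mulr_ge0 t0 (ler0n R k.+1)).
  rewrite ger0_norm; last by rewrite subr_ge0 ler_pdivrMr.
  rewrite lerBlDr -[X in X + _]mul1r -mulrDl ler_pdivlMr //.
  by rewrite nat1r ltW.
- exact: chart_inv_dom.
have H1 := @cvg_comp _ _ _ (fun k => phi (f_ t k)) psi F (nbhs u) _ cu
  (chart_inv_cvg cc iu).
apply: cvg_trans H1; apply: near_eq_cvg; apply: filterS nearP => k /P[Dk _].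
by rewrite /= (chart_invK cc).
Qed.

Let x_cvg1 : x_ @ F --> (1%g : G).
Proof.
apply: (@cvg_comp _ _ _ (fun k => u0 + k.+1%:R^-1 *: e) psi F (nbhs u0)); last first.
  exact: (chart_inv_cvgx cc c_at1).
apply/cvgrPdist_le => d d0; apply: filterS (near_inv d0) => k /ltW kd.
by rewrite opprD addrA subrr sub0r normrN normrZ ger0_norm // invr_ge0.
Qed.

(** Truncation is additive up to 0 or 1, and one extra factor [x_ k] disappears in the limit. *)
Let lim_fD s t a b : 0 <= s -> 0 <= t ->
  lim_f s a -> lim_f t b -> lim_f (s + t) (a * b)%g.
Proof.
move=> s0 t0 sa tb.
pose d k := (Num.truncn ((s + t) * k.+1%:R) -
  (Num.truncn (s * k.+1%:R) + Num.truncn (t * k.+1%:R)))%N.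
have dP k : (d k <= 1)%N /\ Num.truncn ((s + t) * k.+1%:R) =
   (Num.truncn (s * k.+1%:R) + Num.truncn (t * k.+1%:R) + d k)%N.
  have N0 : 0 <= k.+1%:R :> R by [].
  have /andP[s1 s2] := truncn_itv (mulr_ge0 s0 N0).
  have /andP[t1 t2] := truncn_itv (mulr_ge0 t0 N0).
  have st0 : 0 <= (s + t) * k.+1%:R by rewrite mulr_ge0 // addr_ge0.
  have L : (Num.truncn (s * k.+1%:R) + Num.truncn (t * k.+1%:R) <=
      Num.truncn ((s + t) * k.+1%:R))%N.
    by rewrite truncn_ge_nat // natrD mulrDl lerD.
  have U : (Num.truncn ((s + t) * k.+1%:R) <=
      (Num.truncn (s * k.+1%:R) + Num.truncn (t * k.+1%:R)) + 1)%N.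
    rewrite truncn_le_nat mulrDl; have st := ltrD s2 t2.
    apply: lt_le_trans st _.
    by rewrite -!natrD ler_nat addSn addnS addn1.
  by rewrite /d; lia.
have H : (fun k => f_ s k * f_ t k * x_ k ^+ d k)%g @ F --> (a * b * 1)%g.
  apply: (cvg_mulg FF (cvg_mulg FF sa tb)).
  move=> A A1; apply: (@filterS _ _ FF _ _ _ (x_cvg1 A1)) => k /= Ax.
  have [+ _] := dP k; case: (d k) => [|[|//]] _ /=.
    by rewrite expg0; exact: nbhs_singleton.
  by rewrite expg1.
rewrite mulg1 in H; apply: cvg_trans H; apply: near_eq_cvg; apply: nearW => k.
by rewrite /f_ -!expgnDr -(dP k).2.
Qed.

Let lim_f0 : lim_f 0 1%g.
Proof.
rewrite /lim_f (_ : f_ 0 = fun=> 1%g); first exact: cvg_cst.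
by apply/funext => k; rewrite /f_ mul0r truncn0.
Qed.

Let lim_f_ex t : 0 <= t -> exists l, lim_f t l.
Proof.
move=> t0; have [tau tau0 H] := lim_f_small (@ltr01 R).
(* Large times are [N] steps of length at most [tau]. *)
pose N := (Num.truncn (t / tau)).+1.
have N0 : 0 < N%:R :> R by [].
have tN0 : 0 <= t / N%:R by rewrite divr_ge0.
have tN : t / N%:R <= tau.
  rewrite ler_pdivrMr // mulrC -ler_pdivrMr // ltW //.
  exact: truncnS_gt.
have [l [L _ _]] := H _ tN0 tN.
have K j : lim_f (j%:R * (t / N%:R)) (l ^+ j)%g.
  elim: j => [|j IHj]; first by rewrite mul0r expg0; exact: lim_f0.
  rewrite -natr1 mulrDl mul1r expgSr; apply: lim_fD => //.
  by rewrite mulr_ge0.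
by exists (l ^+ N)%g; have := K N; rewrite mulrC divfK ?gt_eqF.
Qed.

Let lim_f_uniq t a b : lim_f t a -> lim_f t b -> a = b.
Proof.
have := @cvg_unique G manifold_hausdorff (f_ t @ F) _; exact.
Qed.

Let X0 t : G := xget 1%g [set l | lim_f t l].

Let X0P t : 0 <= t -> lim_f t (X0 t).
Proof. by move=> /lim_f_ex; exact: xgetPex. Qed.

Let X0D s t : 0 <= s -> 0 <= t -> X0 (s + t) = (X0 s * X0 t)%g.
Proof.
move=> s0 t0; apply: lim_f_uniq (X0P (addr_ge0 s0 t0)) _.
exact: lim_fD (X0P s0) (X0P t0).
Qed.

Let X0C s t : 0 <= s -> 0 <= t -> (X0 s * X0 t = X0 t * X0 s)%g.
Proof. by move=> s0 t0; rewrite -!X0D // addrC. Qed.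

Let X t : G := if 0 <= t then X0 t else (X0 (- t))^-1%g.

Let X0B s t : 0 <= s -> 0 <= t -> X (s - t) = (X0 s * (X0 t)^-1)%g.
Proof.
move=> s0 t0; rewrite /X subr_ge0; case: ifPn => [ts|].
  have := X0D (_ : 0 <= s - t) t0; rewrite subr_ge0 subrK => /(_ ts) ->.
  by rewrite mulgK.
rewrite -ltNge => st.
have := X0D (_ : 0 <= t - s) s0; rewrite subr_ge0 subrK => /(_ (ltW st)) E1.
by rewrite opprB E1 invgM mulgA mulgV mul1g.
Qed.

Let XD s t : X (s + t) = (X s * X t)%g.
Proof.
(* Splitting each time into positive and negative parts reduces additivity to nonnegative times,
   whose values commute. *)
pose p (u : R) := Num.max u 0; pose q (u : R) := Num.max (- u) 0.
have pq u : [/\ 0 <= p u, 0 <= q u & u = p u - q u].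
  have [u0|] := boolP (0 <= u).
    by rewrite /p /q (max_l u0) max_r ?oppr_le0 // subr0.
  rewrite -ltNge => /ltW u0.
  by rewrite /p /q (max_r u0) max_l ?oppr_ge0 // sub0r opprK.
have [ps qs sE] := pq s; have [pt qt tE] := pq t.
rewrite [in LHS]sE [in LHS]tE addrACA -opprD X0B ?addr_ge0 // sE tE !X0B //.
rewrite -sE -tE [q s + q t]addrC !X0D // invgM.
rewrite -!mulgA; congr (_ * _)%g; rewrite !mulgA; congr (_ * _)%g.
apply: (@mulgI _ (X0 (q s))); rewrite !mulgA mulgV mul1g -X0C //.
by rewrite mulgK.
Qed.

Let X0_tang : tang (nbhs (0 : R)) (fun h => X0 `|h|) (fun h => `|h| *: e)
  (fun h => `|h|).
Proof.
have near_le d : 0 < d -> \forall h \near (0 : R), `|h| <= d.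
  move=> d0; apply/nbhs_ballP; exists d => // h.
  by rewrite -ball_normE /= sub0r normrN => /ltW.
have est a : 0 < a -> \forall h \near (0 : R), chart_dom c (X0 `|h|) /\
    `|phi (X0 `|h|) - u0 - `|h| *: e| <= a * `|h|.
  move=> a0; have [d d0 dle] := tang_err `|e| a0.
  have [tau tau0 H] := lim_f_small d0.
  apply: filterS (near_le _ tau0) => h htau.
  have [l [L Dl Hl]] := H _ (normr_ge0 h) htau.
  rewrite (lim_f_uniq (X0P (normr_ge0 h)) L); split=> //.
  apply: le_trans Hl _; rewrite mulrCA mulrC -mulrA.
  by rewrite [leLHS](_ : _ = `|e| * d * `|h|) ?ler_wpM2r //; ring.
split; last by move=> a /est; apply: filterS => h [].
  have phiX : (fun h => phi (X0 `|h|)) @ (0 : R) --> u0.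
    apply/cvgrPdist_le => a a0.
    have [d d0 dle] := tang_err (1 + `|e|) a0.
    apply: filterS2 (est _ ltr01) (near_le _ d0) => h [_ H1] H2.
    rewrite distrC -[phi _ - _](subrK (`|h| *: e)).
    apply: le_trans (ler_normD _ _) _; apply: le_trans dle.
    rewrite mulrDl; apply: lerD; first by apply: le_trans H1 _; rewrite !mul1r.
    by rewrite normrZ normr_id mulrC ler_wpM2l.
  have H := @cvg_comp _ _ _ (fun h => phi (X0 `|h|)) psi (nbhs (0 : R)) (nbhs u0) _ phiX
    (chart_inv_cvgx cc c_at1).
  apply: cvg_trans H; apply: near_eq_cvg; apply: filterS (est _ ltr01) => h [Dh _].
  by rewrite /= (chart_invK cc).
by exists `|e|; apply: nearW => h; rewrite normrZ normr_id mulrC.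
Qed.

Let X_tang : tang (nbhs (0 : R)) X (fun h => h *: e) (fun h => `|h|).
Proof.
have t1 := X0_tang; have t2 := tang_inv (FF := F0) c_atlas c_at1 X0_tang.
have Xor h : X h = X0 `|h| /\ h *: e = `|h| *: e \/
    X h = (X0 `|h|)^-1%g /\ h *: e = - (`|h| *: e).
  rewrite /X; have [h0|] := boolP (0 <= h); first by left; rewrite ger0_norm.
  rewrite -ltNge => h0; right; rewrite ltr0_norm //; split=> //.
  by rewrite scaleNr opprK.
case: t1 t2 => [a1 [C1 b1] c1] [a2 [C2 b2] c2]; split.
- move=> A A1; suff : \forall h \near (0 : R), A (X h) by [].
  have B1 : \forall h \near (0 : R), A (X0 `|h|) := a1 A A1.
  have B2 : \forall h \near (0 : R), A (X0 `|h|)^-1%g := a2 A A1.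
  by apply: filterS2 B1 B2 => h A1h A2h; case: (Xor h) => -[-> _].
- exists C1; apply: filterS b1 => h.
  by case: (Xor h) => -[_ ->]; rewrite ?normrN.
- move=> a a0; apply: filterS2 (c1 a a0) (c2 a a0) => h.
  by case: (Xor h) => -[-> ->].
Qed.

Lemma ultra_exp_exists : exists Y : R -> G,
  {morph Y : s t / s + t >-> (s * t)%g} /\
  tang (nbhs (0 : R)) Y (fun h => h *: e) (fun h => `|h|).
Proof. by exists X. Qed.

End Exp.

Lemma exp_exists {R : realType} {n : nat} {G : lieGroupType R n}
    (c : chart 'rV[R]_n G) (c_atlas : atlas G c) (c_at1 : chart_dom c 1%g)
    (e : 'rV[R]_n) : exists Y : R -> G,
  {morph Y : s t / s + t >-> (s * t)%g} /\
  tang c (nbhs (0 : R)) Y (fun h => h *: e) (fun h => `|h|).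
Proof.
have [F [FU Foo]] := @ultraFilterLemma nat \oo _.
exact: (ultra_exp_exists c_atlas c_at1 e FU Foo).
Qed.

(** * Joining 1 to every point by a curve with continuous logarithmic derivative *)

Section Reach.
Context {R : realType} {n : nat} {G : lieGroupType R n}.
Variable c : chart 'rV[R]_n G.
Hypotheses (c_atlas : atlas G c) (c_at1 : chart_dom c 1%g).

Local Notation E := 'rV[R]_n.
Local Notation phi := (chart_map c).
Local Notation psi := (chart_inv c).
Local Notation u0 := (phi 1%g).
Local Notation m := (mul_chart c c c).

Let cc : is_chart c := atlas_is_chart _ c_atlas.

(** Curves are required on the whole real line. The end time is pi / 2 because the elementary curves
    are parametrised by the sine, which runs from 0 to 1 there and is bounded everywhere. *)
Definition reachable (g : G) : Prop := exists x xi,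
  [/\ x 0 = 1%g, x (pi / 2) = g, forall s, rlog c x s (xi s) &
      forall j, continuous (fun s => xi s 0 j)].

Lemma reachable_mul g h : reachable g -> reachable h -> reachable (g * h)%g.
Proof.
move=> [x [xi [x0 x1 xd xc]]] [y [zeta [y0 y1 yd yc]]].
exists (fun t => x t * y t)%g, (fun s => xi s + zeta s *m Ad c (x s)).
split; [by rewrite x0 y0 mulg1|by rewrite x1 y1| |].
  by move=> s; exact: rlog_mul.
move=> j s.
have -> : (fun s => (xi s + zeta s *m Ad c (x s)) 0 j) =
   (fun s => xi s 0 j + \sum_k zeta s 0 k * Ad c (x s) k j).
  by apply/funext => t; rewrite mxE mulmxEij.
apply: cvgD; first exact: xc.
elim: (index_enum _) => [|k r IHr].
  by under eq_fun do rewrite big_nil; rewrite big_nil; exact: cvg_cst.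
under eq_fun do rewrite big_cons; rewrite big_cons.
apply: cvgD => //; apply: cvgM; first exact: yc.
by apply: (Ad_cvg c_atlas c_at1 (nbhs_filter s)); exact: rlog_continuous (xd s).
Qed.

(** The curve u0 + sin(s) w never leaves a ball of the chart. Its logarithmic derivative is a
    partial differential of the multiplication times cos(s), hence continuous. *)
Lemma reachable_near1 : \forall g \near (1%g : G), reachable g.
Proof.
have i1 : (fun u => (psi u)^-1)%g @ u0 --> (1^-1 : G)%g.
  exact: (@cvg_invg R n G E (nbhs u0) psi 1%g (nbhs_filter u0)
    (chart_inv_cvgx cc c_at1)).
rewrite invg1 in i1.
have /nbhs_ballP[r /= r0 br] : \forall u \near u0,
    chart_img c u /\ chart_dom c (psi u)^-1%g.
  apply: filterI; first exact: (near_chart_img cc c_at1).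
  exact: (i1 _ (near_chart_dom cc c_at1)).
suff H (w : E) : `|w| < r -> reachable (psi (u0 + w)).
  have H1 : \forall g \near (1%g : G), chart_dom c g /\ ball u0 r (phi g).
    apply: filterI; first exact: (near_chart_dom cc c_at1).
    exact: (chart_map_cvg cc c_at1 (nbhsx_ballx u0 r r0)).
  apply: filterS H1 => g [Dg].
  rewrite -ball_normE /= distrC => /H.
  by rewrite addrC subrK chart_invK.
move=> wr.
pose u (s : R) : E := u0 + sin s *: w.
have du s : is_diff s u (fun h => h *: (cos s *: w)).
  pose l : R -> E := cst u0 + ( *:%R^~ w \o sin).
  have ds : is_diff s (sin : R -> R) (fun h => h *: cos s).
    have dsin : derivable (sin : R -> R) s 1 by exact: ex_derive.
    split; first by apply/derivable1_diffP.
    by rewrite deriv1E // derive1E derive_val.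
  have dl : is_diff s l (0 + ( *:%R^~ w \o (fun h => h *: cos s))).
    have d1 : is_diff (sin s) ( *:%R^~ w : R -> E) ( *:%R^~ w).
      exact: is_diff_scalel.
    have d2 := is_diff_comp ds d1.
    have d3 : is_diff s (cst u0 : R -> E) 0 by exact: is_diff_cst.
    exact: (is_diffD d3 d2).
  have E1 : 0 + ( *:%R^~ w \o (fun h => h *: cos s)) =
      (fun h => h *: (cos s *: w)) :> (R -> E).
    by apply/funext => h; rewrite fctE add0r scalerA.
  by rewrite -E1.
have us s : chart_img c (u s) /\ chart_dom c (psi (u s))^-1%g.
  apply: br; rewrite -ball_normE /= opprD addrA subrr sub0r normrN normrZ.
  apply: le_lt_trans wr; rewrite ler_piMl // ler_norml.
  by rewrite sin_geN1 sin_le1.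
pose x s := psi (u s).
have xD s : chart_dom c (x s) by apply: chart_inv_dom => //; exact: (us s).1.
have xphi s : phi (x s) = u s by rewrite /x chart_mapK //; exact: (us s).1.
have uc : continuous u by move=> s; apply: differentiable_continuous.
have xc s : x @ s --> x s.
  apply: (@cvg_comp _ _ _ u psi (nbhs s) (nbhs (u s))); first exact: uc.
  by apply: (chart_inv_cvg cc); exact: (us s).1.
pose v s := phi (x s)^-1%g.
have Uuv s : mul_chart_dom c c c (u s, v s).
  rewrite -xphi; apply: mul_chart_domP => //; last by rewrite mulgV.
  exact: (us s).2.
exists x, (fun s => cos s *: 'd m (u s, v s) (w, 0)); split.
- by rewrite /x /u sin0 scale0r addr0 chart_invK.
- by rewrite /x /u sin_pihalf scale1r.
- move=> s.
  have w1 : (fun h => x (s + h) * (x s)^-1)%g @ (0 : R) --> (1%g : G).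
    move=> A A1; suff : \forall h \near (0 : R), A (x (s + h) * (x s)^-1)%g by [].
    apply/(near_shift0 (fun t => A (x t * (x s)^-1)%g) s).
    have H : (fun t => x t * (x s)^-1)%g @ s --> (x s * (x s)^-1)%g.
      exact: (cvg_mulg (nbhs_filter s) (xc s) (@cvg_cst _ _ _ _ (nbhs_filter s))).
    by rewrite mulgV in H; exact: H A A1.
  pose k (t : R) : E := m (u t, v s).
  have dm : is_diff (u s, v s) m ('d m (u s, v s)).
    by split=> //; exact: (mul_chart_diff c_atlas c_atlas c_atlas (Uuv s)).
  have dk : is_diff s k ('d m (u s, v s) \o ((fun a : E => (a, 0)) \o
      (fun h : R => h *: (cos s *: w)))).
    have duv := is_diff_comp (du s) (diff_pairl (u s) (v s)).
    exact: (is_diff_comp duv dm).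
  have kE t : k t = phi (x t * (x s)^-1)%g.
    by rewrite /k /mul_chart /= /v chart_invK //; exact: (us s).2.
  split=> //.
    exists `|cos s *: 'd m (u s, v s) (w, 0)|; apply: nearW => h.
    by rewrite normrZ mulrC.
  move=> e e0; have := differentiable_eps (ex_diff (is_diff_def := dk)) e0.
  move/near_shift0; apply: filterS => h.
  rewrite (diff_val (is_diff_def := dk)) !kE mulgV [s + h - s]addrAC subrr add0r /=.
  congr (_ <= _); congr `|_ - _|.
  have -> : (h *: (cos s *: w), 0) = (h * cos s) *: (w, 0 : E) :> E * E.
    by rewrite scalerA; congr (_, _); rewrite /= scaler0.
  by rewrite linearZ /= scalerA.
- move=> j s.
  have vc : v @ s --> v s.
    apply: (@cvg_comp _ _ _ (fun t => (x t)^-1)%g phi (nbhs s) (nbhs (x s)^-1%g)).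
      exact: (cvg_invg (nbhs_filter s) (xc s)).
    by apply: (chart_map_cvg cc); exact: (us s).2.
  have uvc : (fun t => (u t, v t)) @ s --> (u s, v s).
    exact: (@cvg_pair _ _ _ (nbhs s) _ _ (nbhs_filter s) _ _ u v (uc s) vc).
  have D := mul_chart_diff2 c_atlas c_atlas c_atlas (w, 0) (Uuv s).
  have Dj := differentiable_comp D (differentiable_coord _ 0 j).
  have H := @cvg_comp _ _ _ (fun t => (u t, v t)) _ (nbhs s) (nbhs (u s, v s)) _
    uvc (differentiable_continuous Dj).
  have -> : (fun s => (cos s *: 'd m (u s, v s) (w, 0)) 0 j) =
     (fun s => cos s * 'd m (u s, v s) (w, 0) 0 j).
    by apply/funext => t; rewrite mxE.
  by apply: cvgM; [exact: continuous_cos | exact: H].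
Qed.

Lemma connected_reachable : connected [set: G] -> forall g, reachable g.
Proof.
move=> Gc; suff H : reachable = [set: G].
  by move=> g; have : [set: G] g by []; rewrite -H.
have dv (g : G) : (fun x => g^-1 * x)%g @ g --> (1%g : G).
  have -> : (1%g : G) = (g^-1 * g)%g by rewrite mulVg.
  by apply: (cvg_mulg (nbhs_filter g)); [exact: cvg_cst|exact: cvg_id].
have dv' (g : G) : (fun x => x^-1 * g)%g @ g --> (1%g : G).
  have -> : (1%g : G) = (g^-1 * g)%g by rewrite mulVg.
  apply: (cvg_mulg (nbhs_filter g)); last exact: cvg_cst.
  by apply: (cvg_invg (nbhs_filter g)); exact: cvg_id.
apply: Gc.
- by exists 1%g; exact: nbhs_singleton reachable_near1.
- exists reachable; last by rewrite setTI.
  rewrite openE => g rg; suff : \forall x \near g, reachable x by [].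
  have B : \forall x \near g, reachable (g^-1 * x)%g := dv g _ reachable_near1.
  apply: filterS B => x rx.
  by have := reachable_mul rg rx; rewrite mulVKg.
(* Closedness: near a limit point [g] some reachable [x] has [x^-1 * g] close enough to 1 to be
   reachable too. *)
- exists reachable; last by rewrite setTI.
  move=> g /(_ _ (dv' g _ reachable_near1)) [x [/= rx rxg]].
  by have := reachable_mul rx rxg; rewrite mulVKg.
Qed.

End Reach.

(** * Invariant subspaces and common eigenvectors *)

Section StableSubspaces.
Context {C : closedFieldType} {N : nat}.
Implicit Types (S : 'M[C]_N -> Prop) (K : 'M[C]_N).

Definition stable S K : Prop := forall A, S A -> (K *m A <= K)%MS.

Lemma min_stable S : (0 < N)%N -> exists K, [/\ K != 0, stable S K &
  forall K', K' != 0 -> (K' <= K)%MS -> stable S K' -> (K <= K')%MS].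
Proof.
move=> N0.
pose P k := `[< exists K, [/\ K != 0, stable S K & \rank K = k] >].
have exP : exists k, P k.
  exists N; apply/asboolP; exists 1%:M; split; last exact: mxrank1.
    by rewrite -mxrank_eq0 mxrank1 -lt0n.
  by move=> A _; exact: submx1.
case: (ex_minnP exP) => k /asboolP[K [K0 KS Kk]] kmin.
exists K; split=> // K' K'0 K'K K'S.
rewrite -(geq_leqif (mxrank_leqif_sup K'K)) Kk; apply: kmin.
by apply/asboolP; exists K'.
Qed.

Lemma stable_eigenvector K (A : 'M[C]_N) : K != 0 -> (K *m A <= K)%MS ->
  exists v a, [/\ v != 0 :> 'rV_N, (v <= K)%MS & v *m A = a *: v].
Proof.
move=> K0 KA; pose B := row_base K.
have BA : (B *m A <= B)%MS.
  by rewrite (eqmxMr _ (eq_row_base K)) (submx_trans KA) // eq_row_base.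
pose A' := B *m A *m pinvmx B.
have AE : A' *m B = B *m A by rewrite mulmxKpV.
have r0 : (0 < \rank K)%N by rewrite lt0n mxrank_eq0.
have [a] : exists a, root (char_poly A') a.
  apply: closed_rootP; rewrite size_char_poly.
  by case: (\rank K) r0.
rewrite -eigenvalue_root_char => /eigenvalueP[v vA v0].
exists (v *m B), a; split.
- apply: contra v0 => /eqP vB; apply/eqP.
  by apply: (row_free_inj (row_base_free K)); rewrite vB mul0mx.
- by rewrite (submx_trans (submxMl _ _)) // eq_row_base.
- by rewrite -mulmxA -AE mulmxA vA scalemxAl.
Qed.

(** By commutation an eigenspace of one matrix is stable under all, so a minimal stable subspace
    lies in an eigenspace of each; any nonzero row of it will do. *)
Lemma commuting_eigenvector S : (0 < N)%N ->
  (forall A B, S A -> S B -> A *m B = B *m A) ->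
  exists2 v : 'rV_N, v != 0 & forall A, S A -> exists a, v *m A = a *: v.
Proof.
move=> N0 comS; have [K [K0 KS Kmin]] := min_stable S N0.
have [i vi] : exists i, row i K != 0.
  apply/existsP; apply: contraR K0; rewrite negb_exists => /forallP K0.
  by apply/eqP/row_matrixP => i; rewrite row0; apply/eqP/negPn.
exists (row i K) => // A SA.
have [v [a [v0 vK vA]]] := stable_eigenvector K0 (KS A SA).
exists a; apply/eigenspaceP.
have KE : (K <= K :&: eigenspace A a)%MS.
  apply: Kmin; last first.
  - move=> B SB; rewrite sub_capmx (submx_trans (submxMr _ (capmxSl _ _))) ?KS //=.
    apply/eigenspaceP.
    have /eigenspaceP E := capmxSr K (eigenspace A a).
    by rewrite -mulmxA (comS B A) // mulmxA E scalemxAl.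
  - exact: capmxSl.
  apply: contra v0 => /eqP H0; rewrite -submx0 -H0 sub_capmx vK.
  exact/eigenspaceP.
by apply: submx_trans (row_sub i K) _; apply: submx_trans KE _; exact: capmxSr.
Qed.

(** [K] has maximal rank among the matrices whose row space lies in [Q]; a vector of [Q] outside
    would increase the rank. *)
Lemma subspace_mx (F : fieldType) n (Q : 'rV[F]_n -> Prop) : Q 0 ->
  (forall a u v, Q u -> Q v -> Q (a *: u + v)) ->
  exists K : 'M[F]_n, forall v, Q v <-> (v <= K)%MS.
Proof.
move=> Q0 Qlin.
pose P k := `[< exists K : 'M[F]_n, (forall v, (v <= K)%MS -> Q v) /\ \rank K = k >].
have P0 : exists k, P k.
  exists 0; apply/asboolP; exists 0; rewrite mxrank0; split=> // v.
  by rewrite submx0 => /eqP ->.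
have ub k : P k -> (k <= n)%N.
  by move=> /asboolP[K [_ <-]]; exact: rank_leq_row.
case: (ex_maxnP P0 ub) => k /asboolP[K [KQ Kk]] kmax.
exists K => v; split=> [Qv|]; last exact: KQ.
have /kmax : P (\rank (K + <<v>>)%MS).
  apply/asboolP; exists (K + <<v>>)%MS; split=> // w /sub_addsmxP[[a b]] /= ->.
  have /sub_rVP[x ->] : (b *m <<v>>%MS <= v)%MS.
    by rewrite (submx_trans (submxMl _ _)) // genmxE.
  by rewrite addrC; apply: Qlin => //; apply: KQ; exact: submxMl.
rewrite -Kk => rk.
have := geq_leqif (mxrank_leqif_sup (addsmxSl K <<v>>%MS)).
rewrite rk => /esym H; apply: submx_trans H.
by rewrite (submx_trans _ (addsmxSr _ _)) // genmxE.
Qed.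

End StableSubspaces.

(** * The derived series of an abstract group *)

Section Derived.
Variable G : groupType.
Implicit Types (k : nat) (g h x : G).

Lemma smallest_subgroup (X : set G) : is_subgroup (smallest (@is_subgroup G) X).
Proof.
split.
- by move=> H [[H1 _ _] _].
- by move=> x y Hx Hy H HX; have [[_ HM _] _] := HX; apply: HM; [apply: Hx|apply: Hy].
- by move=> x Hx H HX; have [[_ _ HV] _] := HX; apply: HV; apply: Hx.
Qed.

Lemma derived_subgroup k : is_subgroup (derived_series G k).
Proof. by case: k => [|k]; [split | exact: smallest_subgroup]. Qed.

Lemma derived_commg k g h : derived_series G k g -> derived_series G k h ->
  derived_series G k.+1 (commg g h).
Proof. by move=> Dg Dh H [_]; apply; exists (g, h). Qed.

Lemma derived_ind k (H : set G) : is_subgroup H ->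
  (forall g h, derived_series G k g -> derived_series G k h -> H (commg g h)) ->
  derived_series G k.+1 `<=` H.
Proof.
move=> Hsub Hc x; apply; split=> // _ [[g h] [/= Dg Dh] <-]; exact: Hc.
Qed.

Lemma derived_conj k g h : derived_series G k h -> derived_series G k (conjg h g).
Proof.
elim: k g h => [//|k IHk] g h Dh.
have [D1 DM DV] := derived_subgroup k.+1.
apply: (derived_ind (H := [set h | derived_series G k.+1 (conjg h g)]) _ _ Dh).
  split=> /=.
  - by rewrite conj1g.
  - by move=> x y Dx Dy; rewrite conjMg; exact: DM.
  - by move=> x Dx; rewrite conjVg; exact: DV.
move=> x y Dx Dy /=; rewrite conjRg.
by apply: derived_commg; exact: IHk.
Qed.

End Derived.

(** * Lie-Kolchin theorem for connected solvable groups *)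

Section Kolchin.
Import complex.
Context {R : realType} {n : nat} {G : lieGroupType R n}.
Local Notation C := (complex R).

Definition ccont (f : G -> C) : Prop :=
  continuous (fun g => Re (f g)) /\ continuous (fun g => Im (f g)).

Lemma eq_ccont f g : f =1 g -> ccont f -> ccont g.
Proof. by move=> /funext ->. Qed.

Lemma ccont_cst a : ccont (fun=> a).
Proof. by split=> g; exact: cvg_cst. Qed.

Lemma ccontD f g : ccont f -> ccont g -> ccont (fun x => f x + g x).
Proof.
move=> [f1 f2] [g1 g2]; split=> x.
  have -> : (fun x => Re (f x + g x)) = (fun x => Re (f x) + Re (g x)).
    by apply/funext => y; case: (f y) (g y) => ? ? [].
  by apply: cvgD; [exact: f1|exact: g1].
have -> : (fun x => Im (f x + g x)) = (fun x => Im (f x) + Im (g x)).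
  by apply/funext => y; case: (f y) (g y) => ? ? [].
by apply: cvgD; [exact: f2|exact: g2].
Qed.

Lemma ccontM f g : ccont f -> ccont g -> ccont (fun x => f x * g x).
Proof.
move=> [f1 f2] [g1 g2]; split=> x.
  have -> : (fun x => Re (f x * g x)) =
      (fun x => Re (f x) * Re (g x) - Im (f x) * Im (g x)).
    by apply/funext => y; case: (f y) (g y) => ? ? [].
  by apply: cvgB; apply: cvgM; [exact: f1|exact: g1|exact: f2|exact: g2].
have -> : (fun x => Im (f x * g x)) =
    (fun x => Re (f x) * Im (g x) + Im (f x) * Re (g x)).
  by apply/funext => y; case: (f y) (g y) => ? ? [].
by apply: cvgD; apply: cvgM; [exact: f1|exact: g2|exact: f2|exact: g1].
Qed.

Lemma ccont_sum (I : Type) (r : seq I) (f : I -> G -> C) :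
  (forall i, ccont (f i)) -> ccont (fun x => \sum_(i <- r) f i x).
Proof.
move=> fc; elim: r => [|i r IHr].
  by apply: eq_ccont (ccont_cst 0) => x; rewrite big_nil.
by apply: eq_ccont (ccontD (fc i) IHr) => x; rewrite big_cons.
Qed.

Lemma ccont_comp (f : G -> C) (k : G -> G) : ccont f -> continuous k ->
  ccont (fun x => f (k x)).
Proof.
move=> [f1 f2] kc; split=> x.
  by apply: (@cvg_comp _ _ _ k (fun g => Re (f g))); [exact: kc|exact: f1].
by apply: (@cvg_comp _ _ _ k (fun g => Im (f g))); [exact: kc|exact: f2].
Qed.

(* A substitute for connectedness that passes to derived subgroups *)
Definition conn (D : set G) : Prop := forall f : G -> C, ccont f ->
  (exists s : seq C, forall g, D g -> f g \in s) ->
  forall g h, D g -> D h -> f g = f h.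

(** A fibre of a continuous function with finitely many values is closed, and so is its complement,
    a finite union of fibres. *)
Lemma conn_setT : connected [set: G] -> conn setT.
Proof.
move=> Gc f [f1 f2] [s fs] g h _ _.
have cl a : closed [set x | f x = a].
  have -> : [set x | f x = a] =
      (fun x => Re (f x)) @^-1` [set Re a] `&` (fun x => Im (f x)) @^-1` [set Im a].
    apply/seteqP; split=> x /=; first by move=> ->.
    by case: (f x) (a) => ? ? [? ?] /= [-> ->].
  apply: closedI; apply: preimage_closed.
  - by move=> x _; exact: f1.
  - exact: accessible_closed_set1 (hausdorff_accessible (@Rhausdorff R)) _.
  - by move=> x _; exact: f2.
  - exact: accessible_closed_set1 (hausdorff_accessible (@Rhausdorff R)) _.
have clU (r : seq C) : closed [set x | f x \in r].
  elim: r => [|a r IHr].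
    have -> : [set x | f x \in [::]] = set0 by apply/seteqP; split.
    exact: closed0.
  have -> : [set x | f x \in a :: r] = [set x | f x = a] `|` [set x | f x \in r].
    apply/seteqP; split=> x /=; rewrite inE.
      by case/orP => [/eqP|]; [left|right].
    by case=> [->|->]; rewrite ?eqxx ?orbT.
  exact: closedU.
suff -> : f g = f h by [].
have : [set x | f x = f h] = setT.
  apply: Gc.
  - by exists h.
  - exists (~` [set x | f x \in [seq a <- s | a != f h]]).
      exact: closed_openC.
    rewrite setTI; apply/seteqP; split=> x /=; rewrite mem_filter /=.
      by move=> ->; rewrite eqxx.
    by rewrite fs // andbT => /negP; rewrite negbK => /eqP.
  - by exists [set x | f x = f h] => //; rewrite setTI.
by move=> E; have : [set x | f x = f h] g by rewrite E.
Qed.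

Lemma mulgl_continuous (g : G) : continuous (fun x => g * x)%g.
Proof.
by move=> x; apply: (cvg_mulg (nbhs_filter x)); [exact: cvg_cst|exact: cvg_id].
Qed.

Lemma conjg_continuous (h : G) : continuous (fun x : G => conjg h x).
Proof.
move=> x; apply: (cvg_mulg (nbhs_filter x)).
  by apply: (cvg_invg (nbhs_filter x)); exact: cvg_id.
by apply: (cvg_mulg (nbhs_filter x)); [exact: cvg_cst|exact: cvg_id].
Qed.

Lemma commg_continuous (q : G) : continuous (fun x : G => commg x q).
Proof.
move=> x; apply: (cvg_mulg (nbhs_filter x)).
  by apply: (cvg_invg (nbhs_filter x)); exact: cvg_id.
apply: (cvg_mulg (nbhs_filter x)); first exact: cvg_cst.
by apply: (cvg_mulg (nbhs_filter x)); [exact: cvg_id|exact: cvg_cst].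
Qed.

(** The elements of D_(k+1) whose right translation preserves every finite-valued continuous [f]
    form a subgroup. It contains each commutator [p, q]: as t varies in D_k, f(x [t, q]) takes
    finitely many values, hence equals its value at t = 1. *)
Lemma conn_derived k : connected [set: G] -> conn (derived_series G k).
Proof.
move=> Gc; elim: k => [|k IHk]; first exact: conn_setT.
pose D := derived_series G k.+1.
have [D1 DM DV] := @derived_subgroup G k.+1.
have [D01 _ _] := @derived_subgroup G k.
pose H := [set h | D h /\ forall f, ccont f ->
  (exists s : seq C, forall g, D g -> f g \in s) ->
  forall x, D x -> f (x * h)%g = f x].
have DH : D `<=` H.
  apply: derived_ind.
    split.
    - by split=> // f _ _ x _; rewrite mulg1.
    - move=> x y [Dx Hx] [Dy Hy]; split; first exact: DM.
      by move=> f fc fs z Dz; rewrite mulgA Hy ?Hx //; exact: DM.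
    - move=> x [Dx Hx]; split; first exact: DV.
      move=> f fc fs z Dz.
      have E1 : f (z * x^-1 * x)%g = f (z * x^-1)%g.
        by apply: Hx => //; apply: DM => //; exact: DV.
      by rewrite -E1 mulgVK.
  move=> p q Dp Dq; split; first exact: derived_commg.
  move=> f fc [s fs] x Dx.
  have fxc : ccont (fun t => f (x * commg t q)%g).
    apply: (ccont_comp (f := fun t => f (x * t)%g)); last exact: commg_continuous.
    by apply: ccont_comp => //; exact: mulgl_continuous.
  have := IHk _ fxc _ p 1%g Dp D01; rewrite comm1g mulg1; apply.
  by exists s => g Dg; apply: fs; apply: DM => //; exact: derived_commg.
move=> f fc fs g h Dg Dh.
have [_ /(_ f fc fs 1%g D1)] := DH g Dg.
have [_ /(_ f fc fs 1%g D1)] := DH h Dh.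
by rewrite !mul1g => -> ->.
Qed.

Definition rep N (rho : G -> 'M[C]_N) : Prop :=
  [/\ rho 1%g = 1%:M, forall g h, rho (g * h)%g = rho g *m rho h &
      forall i j, ccont (fun g => rho g i j)].

Definition acts_scalar N (rho : G -> 'M[C]_N) (D : set G) : Prop :=
  forall h, D h -> exists a, rho h = a%:M.

Section Irreducible.
Variables (N : nat) (rho : G -> 'M[C]_N).
Hypotheses (N0 : (0 < N)%N) (rho_rep : rep rho).
Hypothesis irr : forall K : 'M[C]_N, K != 0 ->
  (forall g, (K *m rho g <= K)%MS) -> row_full K.
Hypothesis Gc : connected [set: G].

Lemma rep_det g : \det (rho g^-1%g) * \det (rho g) = 1.
Proof.
have [r1 rM _] := rho_rep.
by rewrite -det_mulmx -rM mulVg r1 det1.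
Qed.

(* An eigenvector of D_k with weight chi; chi is fixed by G since G is
   connected, so the weight space is stable under G, hence everything *)
Lemma eigenvector_scalar k (v : 'rV[C]_N) : v != 0 ->
  (forall h, derived_series G k h -> exists a, v *m rho h = a *: v) ->
  acts_scalar rho (derived_series G k).
Proof.
move=> v0 vD; have [r1 rM rc] := rho_rep.
pose Q (w : 'rV[C]_N) := forall h a, derived_series G k h -> v *m rho h = a *: v ->
  w *m rho h = a *: w.
have [|a u w Qu Qw h b Dh vh|K KQ] := @subspace_mx C N Q.
- by move=> h a _ _; rewrite mul0mx scaler0.
- by rewrite mulmxDl -scalemxAl (Qu _ _ Dh vh) (Qw _ _ Dh vh) !scalerDr !scalerA mulrC.
have [j vj] : exists j, v 0 j != 0.
  apply/existsP; apply: contraR v0; rewrite negb_exists => /forallP H.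
  by apply/eqP/rowP => j; rewrite mxE; apply/eqP/negPn.
have Qv : Q v by move=> h a _.
have weight h a g : derived_series G k h -> v *m rho h = a *: v ->
    v *m rho (conjg h g) = a *: v.
  move=> Dh vh.
  pose f x := (v *m rho (conjg h x)) 0 j / v 0 j.
  have fc : ccont f.
    apply: (ccontM (g := fun=> _)); last exact: ccont_cst.
    apply: (eq_ccont (f := fun x => \sum_i v 0 i * rho (conjg h x) i j)).
      by move=> x; rewrite mxE.
    apply: ccont_sum => i; apply: (ccontM (f := fun=> _)); first exact: ccont_cst.
    by apply: (ccont_comp (f := fun g => rho g i j)); [exact: rc|exact: conjg_continuous].
  have fE x b : v *m rho (conjg h x) = b *: v -> f x = b.
    by move=> E; rewrite /f E mxE mulfK.
  have [s sP] := closed_field_poly_normal (char_poly (rho h)).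
  have fs : exists s : seq C, forall g, [set: G] g -> f g \in s.
    exists s => x _; have [b vb] := vD _ (derived_conj x Dh).
    rewrite (fE _ _ vb).
    (* Conjugates have the same eigenvalues, so the weight of [v] on all of them takes finitely many
       values. *)
    have : root (char_poly (rho h)) b.
      rewrite -eigenvalue_root_char; apply/eigenvalueP; exists (v *m rho x^-1%g).
        rewrite -mulmxA -rM -[(x^-1 * h)%g]mulg1 -(mulgV x) !mulgA.
        by rewrite -(mulgA _ h x) -/(conjg h x) rM mulmxA vb scalemxAl.
      apply: contra v0 => /eqP vx0.
      by rewrite -[v]mulmx1 -r1 -(mulVg x) rM mulmxA vx0 mul0mx.
    rewrite sP (monicP (char_poly_monic _)) scale1r root_prod_XsubC.
    exact.
  have := conn_setT Gc fc fs (g := g) (h := 1%g) I I.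
  have [b vb] := vD _ (derived_conj g Dh).
  by rewrite (fE _ _ vb) (fE 1%g a) ?conjg1 // vb => ->.
have Kst g : (K *m rho g <= K)%MS.
  apply/row_subP => i; rewrite row_mul; apply/KQ.
  have /KQ Qi := row_sub i K.
  move=> h a Dh vh.
  have vh' := weight h a g^-1%g Dh vh.
  have := Qi _ _ (derived_conj g^-1%g Dh) vh'.
  move=> /(congr1 (mulmx^~ (rho g))).
  rewrite -mulmxA -rM conjgE invgK -!mulgA mulVg mulg1 rM mulmxA => ->.
  by rewrite -scalemxAl.
have K0 : K != 0.
  apply: contra v0 => /eqP K0; rewrite -submx0 -K0; exact/KQ.
have Kfull := irr K0 Kst.
move=> h Dh; have [a vh] := vD h Dh; exists a.
apply/row_matrixP => i; rewrite rowE.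
have Qi : Q (delta_mx 0 i) by apply/KQ; exact: (submx_full _ Kfull).
by rewrite (Qi h a Dh vh) -scalemx1 rowE -scalemxAr mulmx1.
Qed.

(** Commutators act by scalars of determinant 1, that is by [N]-th roots of unity. There are
    finitely many, so connectedness of D_k forces the value 1: D_k acts by commuting matrices and
    has a common eigenvector. *)
Lemma scalar_step k : acts_scalar rho (derived_series G k.+1) ->
  acts_scalar rho (derived_series G k).
Proof.
move=> Hk; have [r1 rM rc] := rho_rep.
have i0 : 'I_N by exact: Ordinal N0.
have comm1 x y : derived_series G k x -> derived_series G k y ->
    rho (commg x y) = 1%:M.
  move=> Dx Dy.
  have D01 : derived_series G k 1%g by have [] := @derived_subgroup G k.
  pose f t := rho (commg t y) i0 i0.
  have fc : ccont f.
    by apply: (ccont_comp (f := fun g => rho g i0 i0)); [exact: rc|exact: commg_continuous].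
  have rE t : derived_series G k t -> rho (commg t y) = (f t)%:M /\ f t ^+ N = 1.
    move=> Dt; have [a aE] := Hk _ (derived_commg Dt Dy).
    have fa : f t = a by rewrite /f aE mxE eqxx.
    rewrite fa; split=> //; rewrite -det_scalar -aE.
    rewrite commgEl conjgE !rM !det_mulmx.
    rewrite -[RHS](mulr1 1) -{1}(rep_det t) -(rep_det y); ring.
  have [s sP] := closed_field_poly_normal ('X^N - 1 : {poly C}).
  have fs : exists s : seq C, forall t, derived_series G k t -> f t \in s.
    exists s => t /rE[_ ft].
    have : root ('X^N - 1 : {poly C}) (f t).
      by rewrite rootE !hornerE ft subrr.
    by rewrite sP (monicP (monicXnsubC 1 N0)) scale1r root_prod_XsubC.
  have := conn_derived Gc fc fs Dx D01.
  have [-> _] := rE _ Dx; have [E1 _] := rE _ D01 => ->.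
  by rewrite -E1 comm1g.
have [A B [g [Dg <-]] [h [Dh <-]]|v v0 vS] := @commuting_eigenvector C N
    (fun A => exists g, derived_series G k g /\ rho g = A) N0.
  by rewrite -!rM commgC [LHS]rM comm1 // mulmx1.
apply: (eigenvector_scalar v0) => h Dh; apply: vS; by exists h.
Qed.

Lemma irreducible_scalar : solvable_group G ->
  forall g, exists a, rho g = a%:M.
Proof.
move=> [k Dk] g.
suff H j : (j <= k)%N -> acts_scalar rho (derived_series G (k - j)).
  by have := H k (leqnn k) g; rewrite subnn; apply.
elim: j => [_|j IHj jk].
  rewrite subn0 Dk => h ->; exists 1; by have [] := rho_rep.
apply: scalar_step; rewrite subnSK //; apply: IHj; exact: ltnW.
Qed.

End Irreducible.

End Kolchin.

Lemma drsubmx_mul {F : nzRingType} m1 m2 (A B : 'M[F]_(m1 + m2)) :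
  ursubmx B = 0 -> drsubmx (A *m B) = drsubmx A *m drsubmx B.
Proof.
move=> B0; rewrite -[A in LHS]submxK -[B in LHS]submxK mulmx_block block_mxKdr.
by rewrite B0 mulmx0 add0r.
Qed.

Section Triangular.
Import complex.
Context {R : realType} {n : nat} {G : lieGroupType R n}.
Local Notation C := (complex R).
Hypotheses (Gc : connected [set: G]) (Gs : solvable_group G).

Lemma rep_sandwich N M (rho : G -> 'M[C]_N) (A : 'M[C]_(M, N)) (B : 'M[C]_(N, M)) :
  rep rho -> forall i j, ccont (fun g => (A *m rho g *m B) i j).
Proof.
move=> [_ _ rc] i j.
apply: (eq_ccont (f := fun g => \sum_k (\sum_l A i l * rho g l k) * B k j)).
  by move=> g; rewrite mulmxEij; apply: eq_bigr => k _; rewrite mulmxEij.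
apply: ccont_sum => k; apply: (ccontM (g := fun=> _)); last exact: ccont_cst.
apply: ccont_sum => l; apply: (ccontM (f := fun=> _)); first exact: ccont_cst.
exact: rc.
Qed.

(** On a minimal stable subspace the representation is irreducible, hence scalar, so every row of a
    basis of it is an eigenvector. *)
Lemma kolchin_eigenvector N (rho : G -> 'M[C]_N) : (0 < N)%N -> rep rho ->
  exists2 v : 'rV[C]_N, v != 0 & forall g, exists a, v *m rho g = a *: v.
Proof.
move=> N0 rho_rep; have [r1 rM rc] := rho_rep.
have [K [K0 KS Kmin]] := @min_stable C N (fun A => exists g, rho g = A) N0.
pose B := row_base K; have Bfree : row_free B := row_base_free K.
have BK : (B :=: K)%MS := eq_row_base K.
have [rho' [BrE rE]] : exists rho' : G -> 'M[C]_(\rank K),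
    (forall g, rho' g *m B = B *m rho g) /\
    forall g, rho' g = B *m rho g *m pinvmx B.
  exists (fun g => B *m rho g *m pinvmx B); split=> // g.
  rewrite mulmxKpV // (eqmxMr _ BK) (submx_trans (KS _ (ex_intro _ g erefl))) //.
  by rewrite BK.
have rep' : rep rho'.
  split.
  - by apply: (row_free_inj Bfree); rewrite BrE r1 mulmx1 mul1mx.
  - move=> g h; apply: (row_free_inj Bfree).
    by rewrite BrE rM mulmxA -BrE -mulmxA -BrE mulmxA.
  - move=> i j; apply: eq_ccont (rep_sandwich B (pinvmx B) rho_rep i j) => g.
    by rewrite rE.
have r0 : (0 < \rank K)%N by rewrite lt0n mxrank_eq0.
have irr' (L : 'M[C]_(\rank K)) : L != 0 ->
    (forall g, (L *m rho' g <= L)%MS) -> row_full L.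
  move=> L0 LS.
  have LB0 : <<L *m B>>%MS != 0.
    rewrite -mxrank_eq0 mxrank_gen mxrank_eq0; apply: contra L0 => /eqP LB; apply/eqP.
    by apply: (row_free_inj Bfree); rewrite LB mul0mx.
  have LBK : (<<L *m B>> <= K)%MS.
    by rewrite genmxE (submx_trans (submxMl _ _)) // BK.
  have := Kmin _ LB0 LBK; rewrite genmxE => /(_ _)/wrap[].
    move=> _ [g <-]; rewrite (eqmxMr _ (genmxE _)) genmxE -mulmxA -BrE mulmxA.
    exact: submxMr.
  rewrite -BK => /submxP[D] DE.
  apply/row_fullP; exists D; apply: (row_free_inj Bfree).
  by rewrite mul1mx -mulmxA -DE.
have i0 : 'I_(\rank K) by exact: Ordinal r0.
exists (row i0 B) => [|g].
  apply: contraTneq Bfree => Bi.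
  have : delta_mx 0 i0 *m B = 0 :> 'rV_N by rewrite -rowE.
  rewrite -[X in _ = X -> _](mul0mx 1 B) => H; apply/negP => Bfree.
  have /rowP/(_ i0) := row_free_inj Bfree H; rewrite !mxE !eqxx => /eqP.
  by rewrite oner_eq0.
have [a aE] := irreducible_scalar r0 rep' irr' Gc Gs g.
exists a; rewrite -row_mul -BrE aE mul_scalar_mx.
by apply/rowP => j; rewrite !mxE.
Qed.

(** Induction on [N]: a common eigenvector becomes the first basis vector, and the induction
    hypothesis triangularises the lower right block, which is the action on the quotient. With row
    vectors this gives lower triangular matrices. *)
Lemma kolchin N (rho : G -> 'M[C]_N) : rep rho ->
  exists2 P : 'M[C]_N, P \in unitmx & forall g (i j : 'I_N), (i < j)%N ->
    (P *m rho g *m invmx P) i j = 0.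
Proof.
elim: N rho => [|N IHN] rho rho_rep.
  by exists 1%:M; [exact: unitmx1|move=> g []].
have [r1 rM rc] := rho_rep.
have [v v0 vE] := kolchin_eigenvector (ltn0Sn N) rho_rep.
(* Completes [v] to a basis: the first row of [P1] is proportional to [v]. *)
pose P1 : 'M[C]_(1 + N) := row_ebase v.
have uP1 : P1 \in unitmx := row_ebase_unit v.
have rv : \rank v = 1%N.
  by apply/eqP; rewrite eqn_leq rank_leq_row lt0n mxrank_eq0.
pose e : 'rV[C]_(1 + N) := row_mx 1%:M 0.
have eE : exists2 b, b != 0 & v = b *: (e *m P1).
  have vEb := mulmx_ebase v; exists (col_ebase v 0 0).
    have := col_ebase_unit v; rewrite unitmxE unitfE det_mx11.
    exact.
  rewrite -{1}vEb rv {1}[col_ebase v]mx11_scalar -mulmxA mul_scalar_mx.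
  congr (_ *: (_ *m _)).
  apply/rowP => j; rewrite !mxE; case: splitP => k jk.
    by rewrite (ord1 k) !mxE /= jk (ord1 k).
  by rewrite mxE jk.
have {eE} eE g : exists a, e *m (P1 *m rho g *m invmx P1) = a *: e.
  have [b b0 vb] := eE; have [a] := vE g; rewrite vb => va; exists a.
  move: va; rewrite -scalemxAl scalerA mulrC -scalerA => /(scalerI b0) va.
  by rewrite !mulmxA va -scalemxAl mulmxK.
have [rho1 rho1E] : exists rho1 : G -> 'M[C]_(1 + N),
    forall g, rho1 g = P1 *m rho g *m invmx P1.
  by exists (fun g => P1 *m rho g *m invmx P1).
have rho1M g h : rho1 (g * h)%g = rho1 g *m rho1 h.
  by rewrite !rho1E rM !mulmxA mulmxKV.
have rho11 : rho1 1%g = 1%:M by rewrite rho1E r1 mulmx1 mulmxV.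
have ur0 g : ursubmx (rho1 g) = 0.
  have [a] := eE g; rewrite -rho1E -[rho1 g in X in X -> _]submxK mul_row_block.
  rewrite !mul1mx !mul0mx !addr0 scale_row_mx scaler0.
  by move=> /eq_row_mx[_].
pose rho2 g := drsubmx (rho1 g).
have rep2 : rep rho2.
  split.
  - by rewrite /rho2 rho11; apply/matrixP => i j; rewrite !mxE eq_rshift.
  - by move=> g h; rewrite /rho2 rho1M drsubmx_mul.
  - move=> i j; have := rep_sandwich P1 (invmx P1) rho_rep (rshift 1 i) (rshift 1 j).
    by apply: eq_ccont => g; rewrite -rho1E /rho2 [RHS]mxE [RHS]mxE.
have [P2 uP2 P2T] := IHN _ rep2.
pose Q : 'M[C]_(1 + N) := block_mx 1%:M 0 0 P2.
have QV : Q *m block_mx 1%:M 0 0 (invmx P2) = 1%:M.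
  rewrite mulmx_block !mulmx0 !mul0mx !mulmx1 !addr0 !add0r mulmxV //.
  by rewrite -scalar_mx_block.
have [uQ _] := mulmx1_unit QV.
have QVE : invmx Q = block_mx 1%:M 0 0 (invmx P2).
  by rewrite -[RHS](mulKmx uQ) QV mulmx1.
exists (Q *m P1); first by rewrite unitmx_mul uQ.
move=> g i j ij.
have -> : Q *m P1 *m rho g *m invmx (Q *m P1) = Q *m rho1 g *m invmx Q.
  have -> : invmx (Q *m P1) = invmx P1 *m invmx Q.
    have uQP : Q *m P1 \in unitmx by rewrite unitmx_mul uQ.
    have E1 : Q *m P1 *m (invmx P1 *m invmx Q) = 1%:M.
      by rewrite mulmxA mulmxK // mulmxV.
    by rewrite -[RHS](mulKmx uQP) E1 mulmx1.
  by rewrite rho1E !mulmxA.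
rewrite QVE -[rho1 g]submxK ur0 !mulmx_block.
rewrite !mulmx0 !mul0mx !mulmx1 !mul1mx !addr0 !add0r.
rewrite -/(rho2 g).
move: ij; case: (@split_ordP 1 N i) => i' ->; case: (@split_ordP 1 N j) => j' ->.
- by rewrite (ord1 i') (ord1 j').
- by move=> _; apply: etrans (block_mxEur _ _ _ _ _ _) _; rewrite mul0mx mxE.
- by rewrite (ord1 j').
- rewrite /= !add1n ltnS => ij'.
  by apply: etrans (block_mxEdr _ _ _ _ _ _) _; exact: P2T.
Qed.

End Triangular.

(** * Differentiating identities satisfied by Ad *)

Lemma small_lin0 {R : realType} m n (M : 'M[R]_(m, n)) :
  (forall e, 0 < e -> \forall h \near (0 : R), `|h *: M| <= e * `|h|) -> M = 0.
Proof.
move=> H; apply/eqP; rewrite -normr_eq0 eq_le normr_ge0 andbT.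
apply/ler_addgt0Pr => e e0; rewrite add0r.
have /nbhs_ballP[d /= d0 /(_ (d / 2))] := H e e0.
rewrite -ball_normE /= sub0r normrN gtr0_norm ?divr_gt0 // => /(_ _)/wrap[].
  by lra.
by rewrite normrZ gtr0_norm ?divr_gt0 // mulrC ler_pM2r ?divr_gt0.
Qed.

Lemma conj_expansion {F : comNzRingType} n (A' A X D D' : 'M[F]_n) h :
  A' *m A = 1%:M -> h *: (D' - A' *m D *m A) =
  A' *m (X - 1%:M - h *: D) *m A - (A' *m X *m A - 1%:M - h *: D').
Proof.
move=> E; rewrite !mulmxBr !mulmxBl mulmx1 E -scalemxAr -scalemxAl scalerBr.
move: (A' *m D *m A) (A' *m X *m A) => Y Z.
by apply/matrixP => i j; rewrite !mxE; ring.
Qed.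

Lemma trace_expansion {F : comNzRingType} n (X D w : 'M[F]_n) h :
  \tr (X *m w) = 0 -> \tr w = 0 ->
  h *: (\tr (D *m w))%:M = - (\tr ((X - 1%:M - h *: D) *m w))%:M :> 'M[F]_1.
Proof.
move=> E1 E2.
have -> : \tr ((X - 1%:M - h *: D) *m w) = - (h * \tr (D *m w)).
  by rewrite !mulmxBl mul1mx -scalemxAl !raddfB /= mxtraceZ E1 E2 subrr sub0r.
by apply/matrixP => i j; rewrite !mxE mulrnAr mulNrn opprK.
Qed.

Lemma norm_mxtrace {F : realType} n (A : 'M[F]_n) : `|\tr A| <= n%:R * `|A|.
Proof.
rewrite /mxtrace; apply: le_trans (ler_norm_sum _ _ _) _.
apply: (@le_trans _ _ (\sum_(k < n) `|A|)).
  by apply: ler_sum => k _; exact: mx_entry_le.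
by rewrite sumr_const card_ord mulr_natl.
Qed.

Lemma conj_error_le {F : realFieldType} (k a b d h : F) :
  k * (k * a * (d * h)) * b + d * h <= (1 + k * (k * a) * b) * d * h.
Proof. by rewrite le_eqVlt; apply/orP; left; apply/eqP; ring. Qed.

Lemma trace_error_le {F : realFieldType} (k w d h : F) :
  k * (k * (d * h) * w) <= k * (k * w) * d * h.
Proof. by rewrite le_eqVlt; apply/orP; left; apply/eqP; ring. Qed.

Section AdConj.
Context {R : realType} {n : nat} {G : lieGroupType R n}.
Variable c : chart 'rV[R]_n G.
Hypotheses (c_atlas : atlas G c) (c_at1 : chart_dom c 1%g).
Local Notation E := 'rV[R]_n.
Let F0 : Filter (nbhs (0 : R)) := nbhs_filter (0 : R).

Lemma Ad_tang_line y (v : E) e :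
  tang c (nbhs (0 : R)) y (fun h => h *: v) (fun h => `|h|) -> 0 < e ->
  \forall h \near (0 : R), `|Ad c (y h) - 1%:M - h *: ad c v| <= e * `|h|.
Proof.
move=> t e0; have := Ad_tang c_atlas c_at1 F0 t e0.
by apply: filterS => h; rewrite adZ.
Qed.

Lemma Ad_conj g x : Ad c (conj g x) = Ad c g^-1%g *m Ad c x *m Ad c g.
Proof.
apply: etrans (Ad_mul c_atlas c_at1 (g * x)%g g^-1%g) _.
by rewrite -[RHS]mulmxA; congr (_ *m _); exact: (Ad_mul c_atlas c_at1 g x).
Qed.

Lemma Ad_Vmul g : Ad c g^-1%g *m Ad c g = 1%:M.
Proof. by have := Ad_mulV c_atlas c_at1 g^-1%g; rewrite invgK. Qed.

(** The identity [Ad_conj] is differentiated at 0 along a one-parameter subgroup tangent to [v]. *)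
Lemma ad_conj (v : E) g :
  ad c (v *m Ad c g) = Ad c g^-1%g *m ad c v *m Ad c g.
Proof.
have [y [_ t]] := exp_exists c_atlas c_at1 v.
have t' : tang c (nbhs (0 : R)) (fun h => conj g (y h)) (fun h => h *: (v *m Ad c g))
    (fun h => `|h|).
  have := tang_conj c_atlas c_at1 g F0 t.
  by apply: (eq_tang (FF := F0)); apply: nearW => h //; rewrite -scalemxAl.
apply/eqP; rewrite -subr_eq0; apply/eqP/small_lin0 => e e0.
set A := Ad c g; set A' := Ad c g^-1%g.
have [d d0 dle] := tang_err (1 + n%:R * (n%:R * `|A'|) * `|A|) e0.
apply: filterS2 (Ad_tang_line t d0) (Ad_tang_line t' d0) => h H H'.
have E1 : Ad c (conj g (y h)) = A' *m Ad c (y h) *m A by exact: Ad_conj.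
have E2 : A' *m A = 1%:M by exact: Ad_Vmul.
rewrite E1 in H'.
rewrite [X in `|X|](_ : _ = A' *m (Ad c (y h) - 1%:M - h *: ad c v) *m A -
   (A' *m Ad c (y h) *m A - 1%:M - h *: ad c (v *m A))); last first.
  exact: conj_expansion.
apply: le_trans (ler_normB _ _) _.
apply: (@le_trans _ _ (n%:R * (n%:R * `|A'| * (d * `|h|)) * `|A| + d * `|h|)).
  apply: lerD => //; apply: le_trans (norm_mulmx _ _) _.
  rewrite ler_wpM2r // ler_wpM2l //; apply: le_trans (norm_mulmx _ _) _.
  by rewrite ler_wpM2l // mulr_ge0.
apply: le_trans (ler_wpM2r (normr_ge0 h) dle); apply: conj_error_le.
Qed.

(** A linear functional on matrices is [M] to [\tr (M *m w)]; one that vanishes on Ad(G) vanishes on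
    its tangent directions. This carries triangularity from Ad to [ad]. *)
Lemma ad_functional (w : 'M[R]_n) (v : E) :
  (forall g, \tr (Ad c g *m w) = 0) -> \tr (ad c v *m w) = 0.
Proof.
move=> wAd; have [y [_ t]] := exp_exists c_atlas c_at1 v.
have w1 : \tr w = 0 by have := wAd 1%g; rewrite (Ad1 c_atlas c_at1) mul1mx.
suff H : (\tr (ad c v *m w))%:M = 0 :> 'M[R]_1.
  by have /matrixP/(_ 0 0) := H; rewrite !mxE.
apply: small_lin0 => e e0.
have [d d0 dle] := tang_err (n%:R * (n%:R * `|w|)) e0.
apply: filterS (Ad_tang_line t d0) => h H.
have -> : h *: (\tr (ad c v *m w))%:M =
    - (\tr ((Ad c (y h) - 1%:M - h *: ad c v) *m w))%:M :> 'M[R]_1.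
  exact: trace_expansion.
rewrite normrN; apply: mx_norm_le => [|i j]; first by rewrite mulr_ge0 // ltW.
rewrite !ord1 mxE eqxx mulr1n; apply: le_trans (norm_mxtrace _) _.
apply: le_trans (ler_wpM2r (normr_ge0 h) dle).
have M := norm_mulmx (Ad c (y h) - 1%:M - h *: ad c v) w.
have n0 : 0 <= n%:R :> R by [].
apply: (@le_trans _ _ (n%:R * (n%:R * (d * `|h|) * `|w|))).
  apply: ler_wpM2l => //; apply: le_trans M _.
  by rewrite ler_wpM2r // ler_wpM2l.
exact: trace_error_le.
Qed.

End AdConj.

(** * Triangular form of Ad over C and the ideal acting nilpotently *)

Section Complexify.
Import complex.
Context {R : realType}.
Local Notation C := (complex R).
Local Notation toC := (map_mx (real_complex R)).

Definition re_mx m n (A : 'M[C]_(m, n)) : 'M[R]_(m, n) := map_mx (@Re R) A.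
Definition im_mx m n (A : 'M[C]_(m, n)) : 'M[R]_(m, n) := map_mx (@Im R) A.

Lemma Re_sum (I : Type) (r : seq I) (f : I -> C) :
  Re (\sum_(i <- r) f i) = \sum_(i <- r) Re (f i).
Proof.
elim: r => [|i r IHr]; rewrite ?big_nil // !big_cons -IHr.
by case: (f i) (\sum_(j <- r) f j) => ? ? [].
Qed.

Lemma Im_sum (I : Type) (r : seq I) (f : I -> C) :
  Im (\sum_(i <- r) f i) = \sum_(i <- r) Im (f i).
Proof.
elim: r => [|i r IHr]; rewrite ?big_nil // !big_cons -IHr.
by case: (f i) (\sum_(j <- r) f j) => ? ? [].
Qed.

Lemma re_mulmx_toC m n p (A : 'M[R]_(m, n)) (B : 'M[C]_(n, p)) :
  re_mx (toC A *m B) = A *m re_mx B.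
Proof.
apply/matrixP => i j; rewrite !mxE Re_sum; apply: eq_bigr => k _.
by rewrite !mxE; case: (B k j) => a b /=; rewrite mul0r subr0.
Qed.

Lemma im_mulmx_toC m n p (A : 'M[R]_(m, n)) (B : 'M[C]_(n, p)) :
  im_mx (toC A *m B) = A *m im_mx B.
Proof.
apply/matrixP => i j; rewrite !mxE Im_sum; apply: eq_bigr => k _.
by rewrite !mxE; case: (B k j) => a b /=; rewrite mul0r addr0.
Qed.

Lemma re_im_mx0 m n (A : 'M[C]_(m, n)) : re_mx A = 0 -> im_mx A = 0 -> A = 0.
Proof.
move=> /matrixP H1 /matrixP H2; apply/matrixP => i j.
by have := H1 i j; have := H2 i j; rewrite !mxE; case: (A i j) => a b /= -> ->.
Qed.

End Complexify.

Section Nil.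
Import complex.
Context {R : realType} {n : nat} {G : lieGroupType R n}.
Variable c : chart 'rV[R]_n G.
Hypotheses (c_atlas : atlas G c) (c_at1 : chart_dom c 1%g).
Local Notation E := 'rV[R]_n.
Local Notation C := (complex R).
Local Notation toC := (map_mx (real_complex R)).

Lemma Ad_triangular : connected [set: G] -> solvable_group G ->
  exists2 P : 'M[C]_n, P \in unitmx & forall g (i j : 'I_n), (i < j)%N ->
    (P *m toC (Ad c g) *m invmx P) i j = 0.
Proof.
move=> Gc Gs.
(* On row vectors Ad reverses products, so the representation is Ad of the inverse. *)
have [|P uP PT] := kolchin Gc Gs (rho := fun g => toC (Ad c g^-1%g)).
  split.
  - by rewrite invg1 (Ad1 c_atlas c_at1) map_mx1.
  - move=> g h; rewrite -map_mxM; congr (toC _); rewrite invgM.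
    exact: (Ad_mul c_atlas c_at1 h^-1%g g^-1%g).
  - move=> i j; split=> g.
      have -> : (fun g => Re (toC (Ad c g^-1%g) i j)) = (fun g => Ad c g^-1%g i j).
        by apply/funext => x; rewrite mxE.
      apply: (Ad_cvg c_atlas c_at1 (nbhs_filter g)).
      by apply: (cvg_invg (nbhs_filter g)); exact: cvg_id.
    have -> : (fun g => Im (toC (Ad c g^-1%g) i j)) = (fun=> 0).
      by apply/funext => x; rewrite mxE.
    exact: cvg_cst.
exists P; first exact: uP.
move=> g i j ij; have := PT g^-1%g i j ij.
have -> : (g^-1)^-1%g = g := invgK g.
exact.
Qed.

Variable P : 'M[C]_n.
Hypotheses (uP : P \in unitmx) (Ptri : forall g (i j : 'I_n), (i < j)%N ->
    (P *m toC (Ad c g) *m invmx P) i j = 0).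

Definition tri (M : 'M[R]_n) : 'M[C]_n := P *m toC M *m invmx P.

Lemma triM (M N : 'M[R]_n) : tri (M *m N) = tri M *m tri N.
Proof. by rewrite /tri map_mxM !mulmxA mulmxKV. Qed.

Lemma tri1 : tri 1%:M = 1%:M.
Proof. by rewrite /tri map_mx1 mulmx1 mulmxV. Qed.

Lemma triD (M N : 'M[R]_n) : tri (M + N) = tri M + tri N.
Proof. by rewrite /tri map_mxD mulmxDr mulmxDl. Qed.

Lemma triZ a (M : 'M[R]_n) : tri (a *: M) = (a%:C)%C *: tri M.
Proof. by rewrite /tri map_mxZ -scalemxAr -scalemxAl. Qed.

Lemma tri_inj0 (M : 'M[R]_n) : tri M = 0 -> M = 0.
Proof.
move=> M0; have : toC M = invmx P *m tri M *m P.
  by rewrite /tri !mulmxA mulVmx // mul1mx mulmxKV.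
rewrite M0 mulmx0 mul0mx => /matrixP H; apply/matrixP => i j.
by have := H i j; rewrite !mxE => -[].
Qed.

Lemma tri_entry (M : 'M[R]_n) i j :
  tri M i j = \tr (toC M *m (col j (invmx P) *m row i P)).
Proof.
rewrite mulmxA mxtrace_mulC mulmxA.
have -> (A : 'M[C]_1) : \tr A = A 0 0 by rewrite {1}[A]mx11_scalar mxtrace_scalar.
rewrite -row_mul /tri !mulmxEij; apply: eq_bigr => k _.
by rewrite [row _ _ _ _]mxE [col _ _ _ _]mxE.
Qed.

(** An entry in the complex basis is a complex functional; its real and imaginary parts are real
    functionals vanishing on Ad(G). *)
Lemma tri_ad v (i j : 'I_n) : (i < j)%N -> tri (ad c v) i j = 0.
Proof.
move=> ij; rewrite tri_entry; set W := _ *m row i P.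
have tE (M : 'M[R]_n) : (Re (\tr (toC M *m W)) = \tr (M *m re_mx W)) *
    (Im (\tr (toC M *m W)) = \tr (M *m im_mx W)).
  split; first by rewrite /mxtrace Re_sum -re_mulmx_toC; apply: eq_bigr => k _; rewrite [RHS]mxE.
  by rewrite /mxtrace Im_sum -im_mulmx_toC; apply: eq_bigr => k _; rewrite [RHS]mxE.
have AW g : \tr (toC (Ad c g) *m W) = 0.
  by rewrite /W -tri_entry; exact: Ptri.
have [H1 H2] := tE (ad c v).
rewrite (ad_functional c_atlas c_at1) in H1; last by move=> g; rewrite -tE AW.
rewrite (ad_functional c_atlas c_at1) in H2; last by move=> g; rewrite -tE AW.
by move: H1 H2; case: (\tr _) => a b /= -> ->.
Qed.

(* The elements whose adjoint matrix is strictly triangular in the basis P: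
   an ideal containing the derived algebra *)
Definition nilrad (v : E) : Prop :=
  forall i j : 'I_n, (i <= j)%N -> tri (ad c v) i j = 0.

Lemma nilrad0 : nilrad 0.
Proof.
move=> i j _; have -> : (0 : E) = 0 *: 0 by rewrite scale0r.
by rewrite adZ triZ mxE mul0r.
Qed.

Lemma nilrad_lin a u v : nilrad u -> nilrad v -> nilrad (a *: u + v).
Proof.
move=> Nu Nv i j ij; rewrite adD adZ triD triZ mxE [X in X + _]mxE Nu // Nv //.
by rewrite mulr0 addr0.
Qed.

Lemma tri_mul_diag (A B : 'M[C]_n) :
  (forall i j : 'I_n, (i < j)%N -> A i j = 0) ->
  (forall i j : 'I_n, (i < j)%N -> B i j = 0) ->
  (forall i j : 'I_n, (i < j)%N -> (A *m B) i j = 0) /\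
  forall i, (A *m B) i i = A i i * B i i.
Proof.
move=> HA HB; split=> [i j ij|i]; rewrite mulmxEij.
  apply: big1 => k _; case: (ltnP i k) => ik; first by rewrite HA ?mul0r.
  by rewrite HB ?mulr0 //; exact: leq_ltn_trans ij.
rewrite (bigD1 i) //= big1 ?addr0 // => k ki.
case: (ltngtP i k) => [ik|ik|/val_inj ik].
- by rewrite HA ?mul0r.
- by rewrite HB ?mulr0.
- by rewrite ik eqxx in ki.
Qed.

(** By [ad_conj] the matrices of the two terms differ by conjugation with a triangular matrix, which
    does not change the diagonal of a triangular matrix. *)
Lemma nilrad_Ad v g : nilrad (v *m Ad c g - v).
Proof.
have adE : ad c (v *m Ad c g - v) = ad c (v *m Ad c g) - ad c v.
  by rewrite adD -scaleN1r adZ scaleN1r.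
have T1 := Ptri g^-1%g; have T2 := tri_ad v; have T3 := Ptri g.
have [U1 D1] := tri_mul_diag T1 T2; have [U2 D2] := tri_mul_diag U1 T3.
have [U3 D3] := tri_mul_diag T1 T3.
have E1 i : tri (Ad c g^-1%g) i i * tri (Ad c g) i i = 1.
  by rewrite -D3 -triM (Ad_Vmul c_atlas c_at1) tri1 mxE eqxx.
move=> i j; rewrite adE (ad_conj c_atlas c_at1) triD mxE.
have -> : tri (- ad c v) i j = - tri (ad c v) i j.
  by rewrite /tri map_mxN mulmxN mulNmx mxE.
rewrite !triM leq_eqVlt => /orP[/eqP/val_inj <-|ij].
  by rewrite D2 D1 mulrAC E1 mul1r subrr.
by rewrite U2 // T2 // subr0.
Qed.

End Nil.

(* Here [n] may be 0, where ['M[F]_n] has no ring structure to give [^+] *)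
Definition mpow {F : nzRingType} n (M : 'M[F]_n) (k : nat) : 'M[F]_n :=
  iter k (mulmx M) 1%:M.

(** * Nilpotency and stability of the ideal *)

Section NilIdeal.
Import complex.
Context {R : realType} {n : nat} {G : lieGroupType R n}.
Variable c : chart 'rV[R]_n G.
Hypotheses (c_atlas : atlas G c) (c_at1 : chart_dom c 1%g).
Local Notation E := 'rV[R]_n.
Local Notation C := (complex R).
Local Notation toC := (map_mx (real_complex R)).
Variable P : 'M[C]_n.
Hypotheses (uP : P \in unitmx) (Ptri : forall g (i j : 'I_n), (i < j)%N ->
    (P *m toC (Ad c g) *m invmx P) i j = 0).
Local Notation nilrad := (nilrad c P).

Lemma nilrad_mpow e : nilrad e -> mpow (ad c e) n = 0.
Proof.
move=> Ne; set M := ad c e.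
have H k (i j : 'I_n) : (i < j + k)%N -> tri P (mpow M k) i j = 0.
  elim: k i j => [|k IHk] i j ij.
    rewrite /mpow /= (tri1 uP) mxE; case: eqP => // E; move: ij.
    by rewrite E addn0 ltnn.
  rewrite /mpow iterS (triM uP) mulmxEij; apply: big1 => l _.
  case: (ltnP l i) => li; last by rewrite /M Ne ?mul0r.
  rewrite -/(mpow M k) IHk ?mulr0 //; apply: leq_trans li _.
  by rewrite -ltnS -addnS.
apply: (tri_inj0 uP); apply/matrixP => i j; rewrite [RHS]mxE H //.
by rewrite (leq_trans (ltn_ord i)) // leq_addl.
Qed.

Lemma nilrad_mx : exists K : 'M[R]_n, forall v, nilrad v <-> (v <= K)%MS.
Proof. by apply: subspace_mx; [exact: nilrad0 | exact: nilrad_lin]. Qed.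

(** The bracket is the derivative of [v *m Ad (y h) - v], which stays in the ideal; the linear
    equations of the ideal, collected in [cokermx K], pass to the derivative. *)
Lemma nilrad_ad v e : nilrad v -> nilrad (v *m ad c e).
Proof.
move=> Nv; have [K KP] := nilrad_mx; apply/KP.
have [y [_ t]] := exp_exists c_atlas c_at1 e.
rewrite submxE; apply/eqP; rewrite -mulmxA; apply: small_lin0 => b b0.
set Q := cokermx K.
have [d d0 dle] := tang_err (n%:R * (n%:R * `|v| * `|Q|)) b0.
apply: filterS (Ad_tang_line c_atlas c_at1 t d0) => h H.
have H1 : v *m (Ad c (y h) - 1%:M) *m Q = 0.
  have /KP := nilrad_Ad c_atlas c_at1 uP Ptri v (y h).
  by rewrite mulmxBr mulmx1 submxE => /eqP.
have -> : h *: (v *m (ad c e *m Q)) = - (v *m (Ad c (y h) - 1%:M - h *: ad c e) *m Q).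
  rewrite (mulmxBr v) mulmxBl H1 sub0r opprK.
  by rewrite -scalemxAr -scalemxAl mulmxA.
rewrite normrN; apply: le_trans (norm_mulmx _ _) _.
apply: le_trans (ler_wpM2r (normr_ge0 h) dle).
have M := norm_mulmx v (Ad c (y h) - 1%:M - h *: ad c e).
apply: (@le_trans _ _ (n%:R * (n%:R * `|v| * (d * `|h|)) * `|Q|)).
  rewrite ler_wpM2r // ler_wpM2l //; apply: le_trans M _.
  by rewrite ler_wpM2l // mulr_ge0.
move: (`|v|) (`|Q|) (`|h|) => x q z.
by rewrite le_eqVlt; apply/orP; left; apply/eqP; ring.
Qed.

(* V . ad(nilrad) is a proper subspace of V: otherwise the support of the
   coordinates of V in the basis P could be shrunk indefinitely *)
Lemma nilrad_hyperplane (V : 'M[R]_n) : V != 0 ->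
  exists phi : 'cV[R]_n,
    (forall v e : E, (v <= V)%MS -> nilrad e -> v *m ad c e *m phi = 0) /\
    exists2 v : E, (v <= V)%MS & v *m phi = 1%:M.
Proof.
move=> V0; apply: contrapT => nophi.
have kill (phi : 'cV[R]_n) :
    (forall v e : E, (v <= V)%MS -> nilrad e -> v *m ad c e *m phi = 0) ->
    forall v : E, (v <= V)%MS -> v *m phi = 0.
  move=> Hphi v vV; apply: contrapT => vphi; apply: nophi; exists phi; split=> //.
  have a0 : (v *m phi) 0 0 != 0.
    apply/eqP => H0; apply: vphi; rewrite [LHS]mx11_scalar H0.
    by apply/matrixP => i j; rewrite !mxE mul0rn.
  exists (((v *m phi) 0 0)^-1 *: v); first exact: scalemx_sub.
  rewrite -scalemxAl [X in _ *: X]mx11_scalar scale_scalar_mx mulVf //.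
pose x (v : E) : 'rV[C]_n := toC v *m invmx P.
(* The coordinates vanish from the last one down: coordinate [i] of a bracket involves only
   coordinates beyond [i], already zero, so the real and imaginary parts of that coordinate
   functional kill the brackets, hence [V]. *)
have H k : forall v : E, (v <= V)%MS -> forall i : 'I_n, (n <= i + k)%N -> x v 0 i = 0.
  elim: k => [|k IHk] v vV i ik.
    by move: ik; rewrite addn0 leqNgt ltn_ord.
  have xE (w : E) : x w 0 i = (toC w *m col i (invmx P)) 0 0.
    by rewrite /x !mulmxEij; apply: eq_bigr => l _; rewrite [col _ _ _ _]mxE.
  have Q (w : E) e : (w <= V)%MS -> nilrad e ->
      toC (w *m ad c e) *m col i (invmx P) = 0.
    move=> wV Ne; rewrite [LHS]mx11_scalar -xE.
    have -> : x (w *m ad c e) = x w *m tri P (ad c e).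
      by rewrite /x /tri map_mxM !mulmxA mulmxKV.
    rewrite mulmxEij big1 ?raddf0 // => l _.
    case: (ltnP i l) => il; last by rewrite Ne ?mulr0.
    rewrite IHk ?mul0r //; apply: leq_trans ik _.
    by rewrite addnS -addSn leq_add2r.
  have Kre := kill (re_mx (col i (invmx P))); have Kim := kill (im_mx (col i (invmx P))).
  rewrite xE (_ : toC v *m _ = 0) ?mxE //; apply: re_im_mx0.
    rewrite re_mulmx_toC; apply: Kre => // w e wV Ne.
    by rewrite -re_mulmx_toC Q //; apply/matrixP => ? ?; rewrite !mxE.
  rewrite im_mulmx_toC; apply: Kim => // w e wV Ne.
  by rewrite -im_mulmx_toC Q //; apply/matrixP => ? ?; rewrite !mxE.
move/eqP: V0; apply; apply/row_matrixP => i; rewrite row0.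
have xi0 : x (row i V) = 0.
  apply/rowP => j; rewrite [RHS]mxE; apply: (H n); first exact: row_sub.
  exact: leq_addl.
have : toC (row i V) = 0 by rewrite -[LHS](mulmxKV uP) -/(x _) xi0 mul0mx.
by move=> /rowP T; apply/rowP => j; have := T j; rewrite !mxE => -[].
Qed.

End NilIdeal.

(** * Exponentials of nilpotent matrices and Ad of one-parameter subgroups *)

Section ExpPoly.
Context {R : realType} {n : nat}.
Variable M : 'M[R]_n.
Hypothesis M_nilp : mpow M n = 0.

Definition exp_poly (i j : 'I_n) : {poly R} :=
  \poly_(k < n) ((k`!%:R)^-1 * mpow M k i j).

Definition exp_mx (t : R) : 'M[R]_n := \matrix_(i, j) (exp_poly i j).[t].

Lemma exp_poly_deriv i j :
  (exp_poly i j)^`() = \sum_l M i l *: exp_poly l j.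
Proof.
apply/polyP => k; rewrite coef_deriv coef_poly coef_sum.
have E1 : \sum_l (M i l *: exp_poly l j)`_k =
    if (k < n)%N then (k`!%:R)^-1 * mpow M k.+1 i j else 0.
  under eq_bigr do rewrite coefZ coef_poly.
  case: ifP => kn; last by apply: big1 => l _; rewrite mulr0.
  rewrite /mpow iterS mulmxEij mulr_sumr; apply: eq_bigr => l _.
  by rewrite mulrCA.
rewrite E1; case: ltngtP => kn.
- rewrite factS natrM invfM -mulrA -mulrnAl.
  by rewrite -[_^-1 *+ _]mulr_natr mulVf ?mul1r // pnatr_eq0.
- by rewrite mul0rn.
- by rewrite mul0rn kn M_nilp mxE mulr0.
Qed.

Lemma exp_mx_derive i j (t : R) :
  is_derive t 1 (fun t => exp_mx t i j) ((M *m exp_mx t) i j).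
Proof.
have -> : (fun t => exp_mx t i j) = horner (exp_poly i j).
  by apply/funext => s; rewrite mxE.
have := is_derive_poly (exp_poly i j) t.
rewrite exp_poly_deriv horner_sum mulmxEij.
rewrite (eq_bigr (fun l => M i l * exp_mx t l j)) // => l _.
by rewrite hornerZ mxE.
Qed.

Lemma exp_mx0 : exp_mx 0 = 1%:M.
Proof.
apply/matrixP => i j; rewrite mxE horner_coef0 coef_poly.
by rewrite (leq_ltn_trans (leq0n i) (ltn_ord i)) fact0 invr1 mul1r.
Qed.

Lemma exp_mxE t : exp_mx t = \sum_(k < n) (k`!%:R^-1 * t ^+ k) *: mpow M k.
Proof.
apply/matrixP => i j; rewrite mxE horner_poly summxE; apply: eq_bigr => k _.
by rewrite [RHS]mxE mulrAC.
Qed.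

Lemma exp_mx_stable m (K : 'M[R]_(m, n)) t :
  (K *m M <= K)%MS -> (K *m exp_mx t <= K)%MS.
Proof.
move=> KM; rewrite exp_mxE mulmx_sumr; apply: summx_sub => k _.
rewrite -scalemxAr; apply: scalemx_sub.
elim: {k} (val k) => [|k IHk]; first by rewrite mulmx1.
by rewrite /mpow iterS mulmxA; apply: submx_trans IHk; exact: submxMr.
Qed.

End ExpPoly.

Section AdExp.
Context {R : realType} {n : nat} {G : lieGroupType R n}.
Variable c : chart 'rV[R]_n G.
Hypotheses (c_atlas : atlas G c) (c_at1 : chart_dom c 1%g).
Local Notation E := 'rV[R]_n.
Let F0 : Filter (nbhs (0 : R)) := nbhs_filter (0 : R).

Variables (X : R -> G) (e : E).
Hypothesis X_mul : {morph X : s t / s + t >-> (s * t)%g}.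
Hypothesis X_tang : tang c (nbhs (0 : R)) X (fun h => h *: e) (fun h => `|h|).

Lemma exp0 : X 0 = 1%g.
Proof. by apply: (@mulgI _ (X 0)); rewrite -X_mul addr0 mulg1. Qed.

Lemma rlog_exp s : rlog c X s e.
Proof.
apply: (eq_tang (FF := F0)) X_tang; apply: nearW => h //.
by rewrite addrC X_mul mulgK.
Qed.

(** Conjugation by [X s] fixes the one-parameter subgroup pointwise, hence its tangent vector. *)
Lemma Ad_exp_fix s : e *m Ad c (X s) = e.
Proof.
have t' : tang c (nbhs (0 : R)) X (fun h => h *: (e *m Ad c (X s))) (fun h => `|h|).
  have := tang_conj c_atlas c_at1 (X s) F0 X_tang.
  apply: (eq_tang (FF := F0)); apply: nearW => h; last by rewrite -scalemxAl.
  by rewrite /conj -X_mul addrC X_mul mulgK.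
have H := tang_unique (FF := F0) t' X_tang.
apply/eqP; rewrite -subr_eq0; apply/eqP/small_lin0 => b /H.
by apply: filterS => h; rewrite -scalerBr.
Qed.

(** The product of [Ad c (X (- s))] and [exp_mx (ad c e) s] has derivative 0 and equals 1 at s =
    0. *)
Lemma Ad_exp t : mpow (ad c e) n = 0 -> Ad c (X t) = exp_mx (ad c e) t.
Proof.
set M := ad c e => M0.
pose A (s : R) : 'M[R]_n := Ad c (X (- s)).
have dA i j (s : R) : is_derive s 1 (fun s => A s i j) ((- (A s *m M)) i j).
  have dN : is_derive s 1 (fun s : R => - s) (-1 : R) by exact: is_deriveNid.
  have r1 := rlog_comp (rlog_exp (- s)) dN.
  have := rlog_Ad c_atlas c_at1 i j r1.
  by rewrite scaleN1r -scaleN1r adZ scaleN1r mulmxN.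
pose B (s : R) i j := \sum_l A s i l * exp_mx M s l j.
have dB i j (s : R) : is_derive s 1 (fun s => B s i j) 0.
  have dl (l : 'I_n) : is_derive s 1 (fun s => A s i l * exp_mx M s l j)
     (A s i l * (M *m exp_mx M s) l j + exp_mx M s l j * (- (A s *m M)) i l).
    exact: (@is_deriveM _ _ (fun s => A s i l) (fun s => exp_mx M s l j) s 1
      _ _ (dA i l s) (exp_mx_derive M0 l j s)).
  have H := @is_derive_sum _ _ _ n (fun l s => A s i l * exp_mx M s l j) s 1 _ dl.
  have E0 : \sum_l (A s i l * (M *m exp_mx M s) l j +
      exp_mx M s l j * (- (A s *m M)) i l) = 0.
    rewrite big_split /= -mulmxEij.
    have -> : \sum_l exp_mx M s l j * (- (A s *m M)) i l =
        (- (A s *m M) *m exp_mx M s) i j.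
      by rewrite mulmxEij; apply: eq_bigr => l _; rewrite mulrC.
    by rewrite mulmxA mulNmx [X in _ + X]mxE subrr.
  rewrite E0 in H.
  have E1 : (fun s => B s i j) = \sum_l (fun s => A s i l * exp_mx M s l j).
    by apply/funext => u; rewrite /B fct_sumE.
  by rewrite E1.
have BE : A t *m exp_mx M t = 1%:M.
  apply/matrixP => i j; rewrite mulmxEij -/(B t i j).
  rewrite (is_derive_0_is_cst t 0 (dB i j)) /B -mulmxEij exp_mx0 mulmx1.
  by rewrite /A oppr0 exp0 (Ad1 c_atlas c_at1).
have AA : Ad c (X t) *m A t = 1%:M.
  rewrite /A -(Ad_mul c_atlas c_at1 (X (- t)) (X t)) -X_mul addNr exp0.
  exact: Ad1.
by rewrite -[LHS]mulmx1 -BE mulmxA AA mul1mx.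
Qed.

End AdExp.

(** * Primitives, and functions integrable in time and rational in the matrix *)

Section Primitive.
Context {R : realType}.

Lemma primitive_right (f : R -> R) : continuous f ->
  exists F : R -> R, F 0 = 0 /\ forall s : R, -1 < s -> is_derive s 1 F (f s).
Proof.
move=> fc.
(* Integrating from -1 makes 0 an interior point, so the two halves of [primitive] are
   differentiable at the gluing point. *)
pose F (x : R) : R :=
  (\int[lebesgue_measure]_(t in `[-1, x]) f t).
exists (fun x => F x - F 0); split; first by rewrite subrr.
move=> s s1.
have fi : lebesgue_measure.-integrable `[-1, s + 1]
    (EFin \o f).
  apply: continuous_compact_integrable; first exact: segment_compact.
  exact: continuous_subspaceT.
have ss : s < s + 1 by rewrite ltrDl.
have [dF FE] := continuous_FTC1_closed ss fi s1 (fc s).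
have dF' : is_derive s 1 F (f s) by split; [exact: dF | rewrite -derive1E; exact: FE].
have dc : is_derive s 1 (cst (F 0)) (0 : R) by exact: is_derive_cst.
have := is_deriveB dF' dc; rewrite subr0; exact.
Qed.

Lemma primitive (f : R -> R) : continuous f ->
  exists F : R -> R, F 0 = 0 /\ forall s : R, is_derive s 1 F (f s).
Proof.
move=> fc; have [F1 [F10 dF1]] := primitive_right fc.
have gc : continuous (fun x => f (- x)).
  by move=> x; apply: (@cvg_comp _ _ _ -%R f); [exact: oppr_continuous|exact: fc].
have [F2 [F20 dF2]] := primitive_right gc.
pose F (x : R) := if 0 <= x then F1 x else - F2 (- x).
exists F; split; first by rewrite /F lexx.
have H1 (s : R) : 0 <= s -> forall e, 0 < e ->
    \forall h \near (0 : R), `|F1 (s + h) - F1 s - h * f s| <= e * `|h|.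
  by move=> s0; apply: is_derive_eps; apply: dF1; lra.
have H2 (s : R) : s <= 0 -> forall e, 0 < e ->
    \forall h \near (0 : R), `|- F2 (- (s + h)) + F2 (- s) - h * f s| <= e * `|h|.
  move=> s0 e e0.
  have d2 : is_derive (- s) 1 F2 (f s).
    by rewrite -[s in f s]opprK; apply: dF2; lra.
  have /nbhs_ballP[r /= r0 br] := is_derive_eps d2 e0.
  apply/nbhs_ballP; exists r => // h hr.
  have /br : ball (0 : R) r (- h).
    by move: hr; rewrite -!ball_normE /= !sub0r !normrN.
  move=> H; rewrite opprD -normrN -[`|h|]normrN; apply: le_trans H.
  by rewrite le_eqVlt; apply/orP; left; apply/eqP; congr `|_|; ring.
move=> s; apply: eps_is_derive => e e0.
case: (ltgtP s 0) => s0.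
- have : \forall h \near (0 : R), s + h < 0.
    apply/(near_shift0 (fun t => t < 0)); exact: lt_nbhsl.
  apply: filterS2 (H2 s (ltW s0) e e0) => h Hh sh.
  by rewrite /F [0 <= s + h]leNgt sh [0 <= s]leNgt s0 /= opprK.
- have : \forall h \near (0 : R), 0 < s + h.
    apply/(near_shift0 (fun t => 0 < t)); exact: lt_nbhsr.
  apply: filterS2 (H1 s (ltW s0) e e0) => h Hh sh.
  by rewrite /F (ltW sh) (ltW s0).
- rewrite s0; apply: filterS2 (H1 0 (lexx _) e e0) (H2 0 (lexx _) e e0) => h.
  rewrite /F lexx !add0r F10; case: ifP => //.
  by rewrite oppr0 F20 addr0.
Qed.

End Primitive.

Section ParamFun.
Context {R : realType} {n : nat}.

(* A class closed under integration in time, whose time slices are rational *)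
Inductive paramfun : (R -> 'M[R]_n -> R) -> Prop :=
| paramfun_base (u : R -> R) (q : 'M[R]_n -> R) : continuous u -> ratfun q ->
    paramfun (fun s b => u s * q b)
| paramfun_add (f g : R -> 'M[R]_n -> R) : paramfun f -> paramfun g ->
    paramfun (fun s b => f s b + g s b).

Lemma eq_paramfun (f g : R -> 'M[R]_n -> R) : f =2 g -> paramfun f -> paramfun g.
Proof. by move=> fg; rewrite (_ : g = f) //; apply/funext => s; apply/funext => b. Qed.

Lemma ratfun_cst (a : R) : ratfun (fun _ : 'M[R]_n => a).
Proof. exact/polyfun_ratfun/polyfun_cst. Qed.

Lemma paramfun_time (u : R -> R) : continuous u -> paramfun (fun s _ => u s).
Proof.
move=> uc; apply: eq_paramfun (paramfun_base uc (ratfun_cst 1)) => s b.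
by rewrite mulr1.
Qed.

Lemma paramfun_ratfun q : ratfun q -> paramfun (fun _ b => q b).
Proof.
move=> qr; have c1 : continuous (fun _ : R => 1 : R) by move=> s; exact: cvg_cst.
by apply: eq_paramfun (paramfun_base c1 qr) => s b; rewrite mul1r.
Qed.

Lemma paramfun_cst a : paramfun (fun _ _ => a).
Proof. exact/paramfun_ratfun/ratfun_cst. Qed.

Lemma paramfunM f g : paramfun f -> paramfun g ->
  paramfun (fun s b => f s b * g s b).
Proof.
move=> Pf Pg; elim: {f} Pf => [u q uc qr|f1 f2 _ IH1 _ IH2]; last first.
  by apply: eq_paramfun (paramfun_add IH1 IH2) => s b; rewrite mulrDl.
elim: {g} Pg => [v r vc rr|g1 g2 _ IH1 _ IH2]; last first.
  by apply: eq_paramfun (paramfun_add IH1 IH2) => s b; rewrite mulrDr.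
have uv : continuous (fun s => u s * v s).
  by move=> s; apply: cvgM; [exact: uc|exact: vc].
by apply: eq_paramfun (paramfun_base uv (ratfunM qr rr)) => s b; rewrite mulrACA.
Qed.

Lemma paramfunN f : paramfun f -> paramfun (fun s b => - f s b).
Proof.
move=> Pf; apply: eq_paramfun (paramfunM (paramfun_cst (-1)) Pf) => s b.
by rewrite mulN1r.
Qed.

Lemma paramfun_sum (I : Type) (r : seq I) (f : I -> R -> 'M[R]_n -> R) :
  (forall i, paramfun (f i)) -> paramfun (fun s b => \sum_(i <- r) f i s b).
Proof.
move=> Pf; elim: r => [|i r IHr].
  by apply: eq_paramfun (paramfun_cst 0) => s b; rewrite big_nil.
by apply: eq_paramfun (paramfun_add (Pf i) IHr) => s b; rewrite big_cons.
Qed.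

Lemma paramfun_horner (p : {poly R}) f : paramfun f ->
  paramfun (fun s b => p.[f s b]).
Proof.
move=> Pf; elim/poly_ind: p => [|p a IHp].
  by apply: eq_paramfun (paramfun_cst 0) => s b; rewrite horner0.
apply: eq_paramfun (paramfun_add (paramfunM IHp Pf) (paramfun_cst a)) => s b.
by rewrite hornerMXaddC.
Qed.

Lemma paramfun_at f s : paramfun f -> ratfun (f s).
Proof.
elim=> {f} [u q uc qr|f g _ IH1 _ IH2]; last exact: ratfunD.
by apply: ratfunM => //; exact: ratfun_cst.
Qed.

Lemma paramfun_continuous f b : paramfun f -> continuous (fun s => f s b).
Proof.
elim=> {f} [u q uc qr|f g _ IH1 _ IH2] s.
  by apply: cvgM; [exact: uc|exact: cvg_cst].
by apply: cvgD; [exact: IH1|exact: IH2].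
Qed.

(** In each separated term only the time factor is integrated; the factor rational in [b] is a
    constant. *)
Lemma paramfun_primitive f : paramfun f -> exists F, [/\ paramfun F,
  forall b, F 0 b = 0 & forall b (s : R), is_derive s 1 (fun s => F s b) (f s b)].
Proof.
elim=> {f} [u q uc qr|f g _ [F [PF F0 dF]] _ [H [PH H0 dH]]].
  have [U [U0 dU]] := primitive uc; exists (fun s b => U s * q b); split.
  - apply: paramfun_base => // s; apply: differentiable_continuous.
    by apply/derivable1_diffP; exact: ex_derive.
  - by move=> b; rewrite U0 mul0r.
  - move=> b s; have dc : is_derive s 1 (cst (q b)) (0 : R) by exact: is_derive_cst.
    have := is_deriveM (dU s) dc; rewrite scaler0 add0r /= => H.
    by rewrite mulrC; exact: H.
exists (fun s b => F s b + H s b); split; first exact: paramfun_add.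
  by move=> b; rewrite F0 H0 addr0.
by move=> b s; exact: is_deriveD (dF b s) (dH b s).
Qed.

End ParamFun.

(** * Products of one-parameter subgroups near zero times *)

Section ExpProduct.
Context {R : realType} {n : nat} {G : lieGroupType R n}.
Variable c : chart 'rV[R]_n G.
Hypotheses (c_atlas : atlas G c) (c_at1 : chart_dom c 1%g).
Local Notation E := 'rV[R]_n.
Implicit Types (L : seq ((R -> G) * E)) (q : nat -> R).

Definition is_exp (X : R -> G) (e : E) : Prop :=
  {morph X : s t / s + t >-> (s * t)%g} /\
  tang c (nbhs (0 : R)) X (fun h => h *: e) (fun h => `|h|).

Fixpoint all_exp L : Prop :=
  if L is l :: L' then is_exp l.1 l.2 /\ all_exp L' else True.

(** Times form an infinite sequence, so that removing a factor is a shift; those beyond the length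
    of [L] are ignored. *)
Fixpoint eprod L q : G :=
  if L is l :: L' then (l.1 (q 0%N) * eprod L' (fun i => q i.+1))%g else 1%g.

Fixpoint lincomb L q : E :=
  if L is l :: L' then q 0%N *: l.2 + lincomb L' (fun i => q i.+1) else 0.

Fixpoint abs_sum L q : R :=
  if L is l :: L' then `|q 0%N| + abs_sum L' (fun i => q i.+1) else 0.

Lemma abs_sum_ge0 L q : 0 <= abs_sum L q.
Proof. by elim: L q => //= l L IHL q; rewrite addr_ge0. Qed.

Lemma eprod0 L q : all_exp L -> abs_sum L q = 0 -> eprod L q = 1%g.
Proof.
elim: L q => //= l L IHL q [[lM lt] Lexp] /eqP.
rewrite paddr_eq0 ?abs_sum_ge0 // normr_eq0 => /andP[/eqP -> /eqP q0].
by rewrite IHL // mulg1; exact: exp0.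
Qed.

Lemma tang_eprod (T : Type) (F : set_system T) (FF : Filter F) L
    (q : T -> nat -> R) : all_exp L ->
  (forall i, (i < size L)%N -> (fun t => q t i) @ F --> (0 : R)) ->
  tang c F (fun t => eprod L (q t)) (fun t => lincomb L (q t))
    (fun t => abs_sum L (q t)).
Proof.
elim: L q => [|[X e] L IHL] q /=.
  move=> _ _; split; first exact: cvg_cst.
    by exists 0; apply: nearW => t; rewrite normr0 mul0r.
  by move=> a _; apply: nearW => t; rewrite subrr subr0 normr0 mulr0.
move=> [[XM Xt] Lexp] q0.
have t1 := tang_comp (q0 0%N isT) Xt.
have t2 := IHL (fun t i => q t i.+1) Lexp (fun i => q0 i.+1).
have s0 t := abs_sum_ge0 L (fun i => q t i.+1).
apply: (tang_mul (FF := FF) c_atlas c_at1).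
  apply: (tang_le (FF := FF) (K := 1)) t1.
    by apply: nearW => t /=; rewrite mul1r lerDl.
  by apply: nearW => t; rewrite addr_ge0.
apply: (tang_le (FF := FF) (K := 1)) t2.
  by apply: nearW => t; rewrite mul1r lerDr.
by apply: nearW => t; rewrite addr_ge0.
Qed.

Lemma abs_sum_eq0 L q : abs_sum L q = 0 <-> forall i, (i < size L)%N -> q i = 0.
Proof.
elim: L q => //= l L IHL q; split=> [/eqP|q0].
  rewrite paddr_eq0 ?abs_sum_ge0 // normr_eq0 => /andP[/eqP q0 /eqP/IHL H].
  by case=> // i; exact: H.
by rewrite (q0 0%N) // normr0 add0r; apply/IHL => i; exact: (q0 i.+1).
Qed.

Lemma abs_sum_continuous L (T : topologicalType) (q : T -> nat -> R) :
  (forall i, continuous (fun t => q t i)) ->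
  continuous (fun t => abs_sum L (q t)).
Proof.
elim: L q => [|l L IHL] q qc t /=; first exact: cvg_cst.
apply: cvgD; first by apply: cvg_norm; exact: qc.
by apply: (IHL (fun t i => q t i.+1)) => i; exact: qc.
Qed.

(* The coordinates 0 are isolated in the fibre of eprod over 1 *)
Lemma eprod_near L K (T : topologicalType) (q : T -> nat -> R) (t0 : T) :
  all_exp L -> (forall q, abs_sum L q <= K * `|lincomb L q|) ->
  (forall i, continuous (fun t => q t i)) ->
  abs_sum L (q t0) = 0 -> (forall t, eprod L (q t) = 1%g) ->
  \forall t \near t0, abs_sum L (q t) = 0.
Proof.
move=> Lexp LK qc q0 q1.
have qF i : (i < size L)%N -> (fun t => q t i) @ t0 --> (0 : R).
  by move=> iL; rewrite -((abs_sum_eq0 L (q t0)).1 q0 i iL); exact: qc.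
have t1 := tang_eprod (nbhs_filter t0) Lexp qF.
(* When the product is 1, the tangent part is at most [d] times the sum of the times, so for
   nonnegative [K] the sum is at most K d, hence half, of itself. *)
have [d d0 dle] := tang_err K (divr_gt0 (@ltr01 R) (@ltr0n R 2)).
case: t1 => [_ _ /(_ d d0)].
apply: filterS => t; rewrite q1 subrr sub0r normrN => H.
have A0 := abs_sum_ge0 L (q t).
apply/eqP; rewrite eq_le A0 andbT.
have [Kn|Kp] := ltP K 0.
  by apply: le_trans (LK _) _; rewrite mulr_le0_ge0 // ltW.
have := le_trans (LK (q t)) (ler_wpM2l Kp H); rewrite mulrA => H2.
have H3 := le_trans H2 (ler_wpM2r A0 dle).
by lra.
Qed.

(** The zero set of the times is closed by continuity and open by [eprod_near]. *)
Lemma eprod_connected L K (T : topologicalType) (q : T -> nat -> R) (t0 : T) :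
  connected [set: T] ->
  all_exp L -> (forall q, abs_sum L q <= K * `|lincomb L q|) ->
  (forall i, continuous (fun t => q t i)) ->
  (forall t, eprod L (q t) = 1%g) ->
  abs_sum L (q t0) = 0 -> forall t, abs_sum L (q t) = 0.
Proof.
move=> Tc Lexp LK qc q1 q0.
suff H : [set t | abs_sum L (q t) = 0] = setT.
  by move=> t; have : [set: T] t by []; rewrite -H.
apply: Tc; first by exists t0.
- exists [set t | abs_sum L (q t) = 0]; last by rewrite setTI.
  rewrite openE => t tq; exact: (eprod_near Lexp LK qc tq q1).
- exists [set t | abs_sum L (q t) = 0]; last by rewrite setTI.
  apply: (@preimage_closed _ _ (fun t => abs_sum L (q t)) [set 0]).
    by move=> t _; exact: abs_sum_continuous.
  exact: accessible_closed_set1 (hausdorff_accessible (@Rhausdorff R)) _.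
Qed.

End ExpProduct.

(** * Factoring a curve with logarithmic derivative in the ideal *)

Section Factor.
Import complex.
Context {R : realType} {n : nat} {G : lieGroupType R n}.
Variable c : chart 'rV[R]_n G.
Hypotheses (c_atlas : atlas G c) (c_at1 : chart_dom c 1%g).
Local Notation E := 'rV[R]_n.
Local Notation toC := (map_mx (complex.real_complex R)).
Variable P : 'M[complex.complex R]_n.
Hypotheses (uP : P \in unitmx) (Ptri : forall g (i j : 'I_n), (i < j)%N ->
    (P *m toC (Ad c g) *m invmx P) i j = 0).
Local Notation nilrad := (nilrad c P).

Variable B : 'M[R]_n -> Prop.

(* A curve whose right logarithmic derivative stays in V is a product of
   one-parameter subgroups, the last factor being peeled off by a linear
   functional killing [V, nilrad]; its coordinates depend rationally on b *)
Lemma curve_factor k (V : 'M[R]_n) : (\rank V <= k)%N ->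
  (forall v : E, (v <= V)%MS -> nilrad v) ->
  (forall v e : E, (v <= V)%MS -> nilrad e -> (v *m ad c e <= V)%MS) ->
  forall nu : R -> 'M[R]_n -> E,
  (forall j, paramfun (fun s b => nu s b 0 j)) ->
  (forall s b, B b -> (nu s b <= V)%MS) ->
  exists L p K, [/\ all_exp c L,
    (forall i, paramfun (p i)) /\ (forall i b, p i 0 b = 0),
    forall q, (lincomb L q <= V)%MS,
    forall q, abs_sum L q <= K * `|lincomb L q| &
    forall b x, B b -> x 0 = 1%g -> (forall s, rlog c x s (nu s b)) ->
      forall s, x s = eprod L (fun i => p i s b)].
Proof.
elim: k V => [|k IHk] V Vk Vnil Vad nu nuP nuV.
  have V0 : V = 0 by apply/eqP; rewrite -mxrank_eq0 -leqn0.
  exists [::], (fun _ _ _ => 0), 0%R; split => //=.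
  - by split=> // i; exact: paramfun_cst.
  - by move=> q; exact: sub0mx.
  - move=> b x Bb x0 xd s; rewrite -x0; apply: (rlog0_cst c_atlas c_at1) => t.
    have := xd t; have := nuV t b Bb; rewrite V0 submx0 => /eqP ->.
    exact.
have [V0|V0] := eqVneq V 0.
  by apply: IHk => //; rewrite V0 mxrank0.
have [phi [phiK [e eV ephi]]] := nilrad_hyperplane c uP V0.
have ne : nilrad e by exact: Vnil.
have [X Xexp] := exp_exists c_atlas c_at1 e.
have [XM Xt] := Xexp.
(* Still stable under brackets with the ideal, since [phi] kills all such brackets of [V]; its rank
   is smaller because [phi] is 1 on [e]. *)
pose W : 'M[R]_n := (V :&: kermx phi)%MS.
have WV : (W <= V)%MS := capmxSl _ _.
have Wphi (w : E) : (w <= W)%MS -> w *m phi = 0.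
  by move=> wW; apply/sub_kermxP; exact: submx_trans wW (capmxSr _ _).
have inW (w : E) : (w <= V)%MS -> w *m phi = 0 -> (w <= W)%MS.
  by move=> wV w0; rewrite sub_capmx wV; exact/sub_kermxP.
have Wk : (\rank W <= k)%N.
  rewrite -ltnS; apply: leq_trans Vk; apply: rank_ltmx.
  rewrite ltmxE WV /=; apply/negP => VW.
  have := Wphi e (submx_trans eV VW); rewrite ephi => /matrixP/(_ 0 0).
  by rewrite !mxE eqxx => /eqP; rewrite oner_eq0.
have Wnil (v : E) : (v <= W)%MS -> nilrad v.
  by move=> vW; apply: Vnil; exact: submx_trans vW WV.
have Wad (v a : E) : (v <= W)%MS -> nilrad a -> (v *m ad c a <= W)%MS.
  move=> vW na; have vV := submx_trans vW WV.
  by apply: inW; [exact: Vad|exact: phiK].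
pose nuphi s b := (nu s b *m phi) 0 0.
have nuphiP : paramfun nuphi.
  apply: (eq_paramfun (f := fun s b => \sum_j nu s b 0 j * phi j 0)).
    by move=> s b; rewrite /nuphi mulmxEij.
  by apply: paramfun_sum => j; apply: paramfunM => //; exact: paramfun_cst.
have [p0 [p0P p00 dp0]] := paramfun_primitive nuphiP.
pose M := ad c e.
have M0 : mpow M n = 0 by exact: nilrad_mpow uP _ ne.
(* The logarithmic derivative of [X (- p0) * x]: the product rule gives - nuphi e plus [nu] moved by
   [Ad (X (- p0))], which fixes [e]. The choice of [p0] as a primitive of [nuphi] is what puts it in
   [W]. *)
pose nu' s b : E := (nu s b - nuphi s b *: e) *m exp_mx M (- p0 s b).
have nu'P j : paramfun (fun s b => nu' s b 0 j).
  apply: (eq_paramfun (f := fun s b =>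
      \sum_l (nu s b 0 l - nuphi s b * e 0 l) * (exp_poly M l j).[- p0 s b])).
    move=> s b; rewrite /nu' mulmxEij; apply: eq_bigr => l _.
    by rewrite [exp_mx _ _ _ _]mxE !mxE.
  apply: paramfun_sum => l; apply: paramfunM.
    apply: paramfun_add => //; apply: paramfunN; apply: paramfunM => //.
    exact: paramfun_cst.
  by apply: paramfun_horner; exact: paramfunN.
have nu'W s b : B b -> (nu' s b <= W)%MS.
  move=> Bb; have KW : (W *m M <= W)%MS.
    by apply/row_subP => i; rewrite row_mul; apply: Wad => //; exact: row_sub.
  apply: submx_trans (exp_mx_stable (- p0 s b) KW); apply: submxMr.
  apply: inW; first by rewrite addmx_sub ?nuV // eqmx_opp scalemx_sub.
  rewrite mulmxBl -scalemxAl ephi [nu s b *m phi]mx11_scalar -/(nuphi s b).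
  by rewrite scale_scalar_mx mulr1 subrr.
have [L [p [K [Lexp [pP p_0] LW LK LE]]]] := IHk W Wk Wnil Wad nu' nu'P nu'W.
exists ((X, e) :: L), (fun i => if i is i'.+1 then p i' else p0).
(* The first time is recovered as [w *m phi], of size at most n |phi| |w|; the others are bounded
   through w - q0 e, of size at most (1 + n |phi| |e|) |w|. *)
exists (n%:R * `|phi| + `|K| * (1 + n%:R * `|phi| * `|e|)).
split.
- by split.
- by split=> [[|i]|[|i] b] //; exact: p_0.
- by move=> q /=; rewrite addmx_sub // ?scalemx_sub // (submx_trans (LW _)).
- move=> q /=; set w' := lincomb L (fun i => q i.+1); set w := q 0%N *: e + w'.
  have qE : (q 0%N)%:M = w *m phi.
    by rewrite mulmxDl -scalemxAl ephi (Wphi _ (LW _)) addr0 scale_scalar_mx mulr1.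
  have q0 : `|q 0%N| <= n%:R * `|phi| * `|w|.
    apply: le_trans (_ : `|w *m phi| <= _); last first.
      by rewrite mulrAC; exact: norm_mulmx.
    by rewrite -qE; have := mx_entry_le ((q 0%N)%:M : 'M[R]_1) 0 0; rewrite mxE eqxx mulr1n.
  rewrite mulrDl; apply: lerD => //; apply: le_trans (LK _) _.
  rewrite -/w' -mulrA; apply: (@le_trans _ _ (`|K| * `|w'|)).
    by rewrite ler_wpM2r // ler_norm.
  rewrite ler_wpM2l //; have -> : w' = w - q 0%N *: e by rewrite addrAC subrr add0r.
  apply: le_trans (ler_normB _ _) _; rewrite mulrDl mul1r lerD2l normrZ.
  by rewrite mulrAC ler_wpM2r.
- move=> b x Bb x0 xd s /=.
  pose x1 t := (X (- p0 t b) * x t)%g.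
  have X0 : X 0 = 1%g by exact: exp0 XM.
  have x10 : x1 0 = 1%g by rewrite /x1 p00 oppr0 X0 x0 mulg1.
  have x1d t : rlog c x1 t (nu' t b).
    have dN : is_derive t 1 (fun t => - p0 t b) (- nuphi t b).
      exact: is_deriveN (dp0 b t).
    have rX : rlog c (X \o (fun t => - p0 t b)) t (- nuphi t b *: e).
      by apply: rlog_comp dN; exact: rlog_exp.
    have := rlog_mul c_atlas c_at1 rX (xd t); apply: eq_rlog => //=.
    have AdE : Ad c (X (- p0 t b)) = exp_mx M (- p0 t b) by exact: Ad_exp.
    rewrite /nu' -AdE mulmxBl -scalemxAl (Ad_exp_fix c_atlas c_at1 XM Xt).
    by rewrite scaleNr addrC.
  have <- := LE b x1 Bb x10 x1d s.
  by rewrite /x1 mulgA -XM subrr X0 mul1g.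
Qed.

End Factor.

Section ParamMatrix.
Context {R : realType} {n : nat}.

Definition parammx m p (F : R -> 'M[R]_n -> 'M[R]_(m, p)) : Prop :=
  forall i j, paramfun (fun s b => F s b i j).

Lemma parammx_mul m k p (F : R -> 'M[R]_n -> 'M[R]_(m, k))
    (H : R -> 'M[R]_n -> 'M[R]_(k, p)) :
  parammx F -> parammx H -> parammx (fun s b => F s b *m H s b).
Proof.
move=> PF PH i j.
apply: (eq_paramfun (f := fun s b => \sum_l F s b i l * H s b l j)).
  by move=> s b; rewrite mulmxEij.
by apply: paramfun_sum => l; exact: paramfunM.
Qed.

Lemma parammx_sub m p (F H : R -> 'M[R]_n -> 'M[R]_(m, p)) :
  parammx F -> parammx H -> parammx (fun s b => F s b - H s b).
Proof.
move=> PF PH i j.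
apply: (eq_paramfun (f := fun s b => F s b i j - H s b i j)).
  by move=> s b; rewrite !mxE.
by apply: paramfun_add => //; exact: paramfunN.
Qed.

Lemma parammx_id : parammx (fun _ b => b).
Proof. by move=> i j; exact/paramfun_ratfun/polyfun_ratfun/polyfun_coord. Qed.

Lemma parammx_inv : parammx (fun _ b => invmx b).
Proof. by move=> i j; exact/paramfun_ratfun/ratfun_inv. Qed.

End ParamMatrix.

(** * The algebraic hull and displacement curves *)

Section Hull.
Context {R : realType} {n : nat} {G : lieGroupType R n}.
Variable c : chart 'rV[R]_n G.
Hypotheses (c_atlas : atlas G c) (c_at1 : chart_dom c 1%g).
Local Notation E := 'rV[R]_n.
Let F0 : Filter (nbhs (0 : R)) := nbhs_filter (0 : R).

Lemma Ad_range_unit A : range (Ad c) A -> A \in unitmx.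
Proof. by move=> [g _ <-]; exact: Ad_unit. Qed.

Lemma Ad_range_mul A B : range (Ad c) A -> range (Ad c) B -> range (Ad c) (A *m B).
Proof.
by move=> [g _ <-] [h _ <-]; exists (h * g)%g => //; exact: Ad_mul.
Qed.

Lemma Ad_range_inv A : range (Ad c) A -> range (Ad c) (invmx A).
Proof. by move=> [g _ <-]; exists g^-1%g => //; exact: Ad_inv. Qed.

(** The Zariski closure of the group Ad(G) is itself an algebraic subgroup, so it contains the
    hull. *)
Lemma Ad_alg_zclosure a : Ad_alg c a -> zclosure (range (Ad c)) a.
Proof.
apply; split.
  split.
  - apply: (sub_zclosure Ad_range_unit); exists 1%g => //; exact: Ad1.
  - move=> A B; exact: (zclosure_mul Ad_range_mul).
  - move=> A; exact: (zclosure_inv Ad_range_unit Ad_range_inv).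
  - by exists [set p | forall B, range (Ad c) B ->
      mpoly.meval (fun k => mxvec B 0 k) p = 0].
by move=> A; exact: (sub_zclosure Ad_range_unit).
Qed.

Lemma ratfun_Ad_continuous (q : 'M[R]_n -> R) : ratfun q ->
  continuous (fun g => q (Ad c g)).
Proof.
have polyc (f : 'M[R]_n -> R) : polyfun f -> continuous (fun g => f (Ad c g)).
  move=> [p fp].
  have -> : (fun g => f (Ad c g)) =
      (fun g => mpoly.meval (fun k => mxvec (Ad c g) 0 k) p).
    by apply/funext => g; exact: fp.
  apply: (meval_ind (Q := fun h : G -> R => continuous h)
    (x := fun k g => mxvec (Ad c g) 0 k)).
  - by move=> r g; exact: cvg_cst.
  - by move=> f1 f2 H1 H2 g; apply: cvgD; [exact: H1|exact: H2].
  - by move=> f1 f2 H1 H2 g; apply: cvgM; [exact: H1|exact: H2].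
  - move=> k g; case/mxvec_indexP: k => i j.
    have -> : (fun g => mxvec (Ad c g) 0 (mxvec_index i j)) = (fun g => Ad c g i j).
      by apply/funext => h; exact: mxvecE.
    by apply: (Ad_cvg c_atlas c_at1 (nbhs_filter g)); exact: cvg_id.
  - by move=> f1 f2 /funext ->.
move=> [d [p [Pp qp]]] g.
have det0 h : \det (Ad c h) ^+ d != 0.
  by rewrite expf_neq0 // -unitfE -unitmxE; exact: Ad_unit.
have -> : (fun g => q (Ad c g)) = (fun g => p (Ad c g) / \det (Ad c g) ^+ d).
  apply/funext => h; rewrite -qp; last exact: Ad_unit.
  by rewrite mulfK // det0.
apply: cvgM; first exact: polyc.
apply: cvgV; first exact: det0.
exact: (polyc _ (polyfunX d polyfun_det)).
Qed.

(** The product rule brings in Ad at [f (x s)]; the last hypothesis replaces it by a conjugate of Ad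
    at [x s], so that [f] survives only through [b]. *)
Lemma rlog_displacement (f : G -> G) (b : 'M[R]_n) x s (v : E) :
  b \in unitmx -> rlog c x s v -> rlog c (f \o x) s (v *m b) ->
  Ad c (x s) *m b = b *m Ad c (f (x s)) ->
  rlog c (fun t => f (x t) * (x t)^-1)%g s
    (v *m b - v *m Ad c (x s)^-1%g *m (invmx b *m Ad c (x s) *m b)).
Proof.
move=> ub rx rfx Adf.
have rxV := rlog_inv c_atlas c_at1 rx.
have := rlog_mul c_atlas c_at1 rfx rxV; apply: eq_rlog => //.
rewrite mulNmx; congr (_ - _ *m _).
by rewrite -mulmxA Adf mulKmx.
Qed.

Lemma rlog_conj g x s v : rlog c x s v -> rlog c (conj g \o x) s (v *m Ad c g).
Proof.
move=> rx; have := tang_conj c_atlas c_at1 g F0 rx.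
apply: (eq_tang (FF := F0)); apply: nearW => h; last by rewrite -scalemxAl.
by rewrite /conj /= !invgM !invgK !mulgA mulgVK.
Qed.

Lemma Ad_conj_comm g x : Ad c x *m Ad c g = Ad c g *m Ad c (conj g x).
Proof.
apply: etrans (esym (Ad_mul c_atlas c_at1 g x)) _.
apply: etrans _ (Ad_mul c_atlas c_at1 (conj g x) g).
by congr (Ad c _); rewrite /conj mulgVK.
Qed.

End Hull.

(** * Automorphisms from the hull fix the center *)

Section Main.
Context {R : realType} {n : nat} {G : lieGroupType R n}.
Variable c : chart 'rV[R]_n G.
Hypotheses (c_atlas : atlas G c) (c_at1 : chart_dom c 1%g).
Hypotheses (Gc : connected [set: G]) (Gs : solvable_group G).
Local Notation E := 'rV[R]_n.

Lemma aut_center a alpha z : Ad_alg c a -> integrates c a alpha ->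
  group_center G z -> alpha z = z.
Proof.
move=> /(Ad_alg_zclosure c_atlas c_at1) Za [aut_alpha alphaE] zc.
have ua : a \in unitmx := Za.1.
have [P uP Ptri] := Ad_triangular c_atlas c_at1 Gc Gs.
have [K KP] := nilrad_mx c P.
(* Triviality modulo the ideal: multiplicative, and a linear condition on [b], so it extends from
   Ad(G) to [a]. *)
pose T (b : 'M[R]_n) := forall v : E, (v *m b - v <= K)%MS.
have TAd g : T (Ad c g) by move=> v; apply/KP; exact: nilrad_Ad.
have TM b b' : T b -> T b' -> T (b *m b').
  move=> Tb Tb' v.
  have -> : v *m (b *m b') - v = (v *m b *m b' - v *m b) + (v *m b - v).
    by rewrite mulmxA addrA subrK.
  by apply: addmx_sub; [exact: Tb'|exact: Tb].
have TV b : b \in unitmx -> T b -> T (invmx b).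
  move=> ub Tb v; have := Tb (v *m invmx b); rewrite mulmxKV // => H.
  by rewrite -opprB eqmx_opp.
have Ta : T a.
  move=> v; rewrite submxE; apply/eqP/rowP => j; rewrite [RHS]mxE.
  pose f (b : 'M[R]_n) : R := ((v *m b - v) *m cokermx K) 0 j.
  have Pf : polyfun f.
    apply: (eq_polyfun (f := fun b => \sum_l
        ((\sum_k v 0 k * b k l) + (- v 0 l)) * cokermx K l j)).
      move=> b; rewrite /f [RHS]mulmxEij; apply: eq_bigr => l _; congr (_ * _).
      by rewrite [RHS]mxE; congr (_ + _); [rewrite mulmxEij|rewrite mxE].
    apply: polyfun_sum => l; apply: polyfunM; last exact: polyfun_cst.
    apply: polyfunD; last exact: polyfun_cst.
    apply: polyfun_sum => k; apply: polyfunM; first exact: polyfun_cst.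
    exact: polyfun_coord.
  apply: (zclosure_polyfun Pf _ Za) => b [g _ <-].
  by have := TAd g v; rewrite submxE /f => /eqP ->; rewrite mxE.
have [x [xi [x0 x1 xd xic]]] := connected_reachable c_atlas c_at1 Gc z.
pose nu s b := xi s *m b - xi s *m Ad c (x s)^-1%g *m (invmx b *m Ad c (x s) *m b).
have Pxi : @parammx R n _ _ (fun s _ => xi s).
  by move=> i j; rewrite (ord1 i); exact/paramfun_time/xic.
have PAd : @parammx R n _ _ (fun s _ => Ad c (x s)).
  move=> i j; apply: paramfun_time => s.
  by apply: (Ad_cvg c_atlas c_at1 (nbhs_filter s)); exact: rlog_continuous (xd s).
have PAdV : @parammx R n _ _ (fun s _ => Ad c (x s)^-1%g).
  move=> i j; apply: paramfun_time => s.
  apply: (Ad_cvg c_atlas c_at1 (nbhs_filter s)).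
  by apply: (cvg_invg (nbhs_filter s)); exact: rlog_continuous (xd s).
have Pnu : parammx nu.
  apply: parammx_sub; first exact: parammx_mul Pxi parammx_id.
  apply: parammx_mul; first exact: parammx_mul.
  apply: parammx_mul; last exact: parammx_id.
  by apply: parammx_mul => //; exact: parammx_inv.
(* One factorisation, with the same subgroups and the same time functions, must serve [a] and all
   Ad(g). *)
pose B b := b = a \/ range (Ad c) b.
have nuK s b : B b -> (nu s b <= K)%MS.
  move=> Bb; have [ub' Tb] : b \in unitmx /\ T b.
    by case: Bb => [->|[g _ <-]]; [|split=> //; exact: Ad_unit].
  rewrite /nu -mulmxA.
  (* Both [b] and the fourfold product on the right are trivial modulo the ideal, so the copies of
     [xi s] cancel. *)
  have -> : xi s *m b - xi s *m (Ad c (x s)^-1%g *m (invmx b *m Ad c (x s) *m b)) =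
      (xi s *m b - xi s) -
      (xi s *m (Ad c (x s)^-1%g *m (invmx b *m Ad c (x s) *m b)) - xi s).
    by rewrite opprB addrA subrK.
  apply: addmx_sub; first exact: Tb.
  rewrite eqmx_opp; apply: (TM _ _ (TAd _)); apply: (TM _ _ _ Tb).
  by apply: (TM _ _ _ (TAd _)); exact: TV.
have Knil (v : E) : (v <= K)%MS -> nilrad c P v by move/KP.
have Kad (v e : E) : (v <= K)%MS -> nilrad c P e -> (v *m ad c e <= K)%MS.
  by move=> /KP vK eN; apply/KP; exact: nilrad_ad.
have [L [p [C [Lexp [pP p0] _ LC LE]]]] := curve_factor c_atlas c_at1 uP
  (leqnn (\rank K)) Knil Kad (fun j => Pnu 0 j) nuK.
have disp f b s : b \in unitmx -> rlog c (f \o x) s (xi s *m b) ->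
    Ad c (x s) *m b = b *m Ad c (f (x s)) ->
    rlog c (fun t => f (x t) * (x t)^-1)%g s (nu s b).
  by move=> ub; exact: rlog_displacement (xd s).
have conjE g s : (conj g (x s) * (x s)^-1)%g = eprod L (fun i => p i s (Ad c g)).
  apply: (LE (Ad c g) (fun s => conj g (x s) * (x s)^-1)%g).
  - by right; exists g.
  - by rewrite x0 conj1 invg1 mulg1.
  move=> t; apply: (disp (conj g)); first exact: Ad_unit.
    exact: rlog_conj.
  exact: Ad_conj_comm.
have Rc : connected [set: R].
  by apply/connected_intervalP => x' y' _ _ z' _.
pose T1 : R := pi / 2.
(* For g = 1 the displacement is 1 at every time s, and the times vanish at s = 0; connectedness of
   the line carries this to [T1]. *)
have q1 : abs_sum L (fun i => p i T1 (Ad c (1%g : G))) = 0.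
  apply: (eprod_connected (c := c) (t0 := 0 : R) (q := fun s i => p i s (Ad c 1%g))
    c_atlas c_at1 Rc Lexp LC).
  - by move=> i; exact: paramfun_continuous.
  - by move=> t; rewrite -conjE /conj mul1g invg1 mulg1 mulgV.
  - by apply/abs_sum_eq0 => i _; exact: p0.
(* At [T1] the curve is at the central [z], which no conjugation moves; connectedness of G
   propagates the vanishing from g = 1. *)
have qg : forall g, abs_sum L (fun i => p i T1 (Ad c g)) = 0.
  apply: (eprod_connected (c := c) (t0 := 1%g : G) (q := fun g i => p i T1 (Ad c g))
    c_atlas c_at1 Gc Lexp LC _ _ q1).
  - by move=> i; apply: ratfun_Ad_continuous => //; exact: paramfun_at.
  - by move=> g; rewrite -conjE x1 /conj -zc mulgK mulgV.
have qa : abs_sum L (fun i => p i T1 a) = 0.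
  apply/abs_sum_eq0 => i iL.
  apply: (zclosure_ratfun (Ad_range_unit c_atlas c_at1) (paramfun_at T1 (pP i)) _ Za).
  by move=> b [g _ <-]; exact: ((abs_sum_eq0 L _).1 (qg g)).
have alphaz : (alpha z * z^-1)%g = 1%g.
  rewrite -x1 (LE a (fun s => alpha (x s) * (x s)^-1)%g _ _ _ T1).
  - by rewrite (eprod0 Lexp qa).
  - by left.
  - by rewrite x0 (aut1 aut_alpha) invg1 mulg1.
  - move=> t; apply: disp => //.
      by rewrite -alphaE; exact: rlog_aut.
    by rewrite -alphaE; exact: Ad_aut.
by apply: (@mulIg _ z^-1%g); rewrite mulgV.
Qed.

End Main.

Theorem theorem4p3 (R : realType) (n : nat) (G : lieGroupType R n)
  (G_connected : connected [set: G])
  (G_simply_connected : simply_connected R G)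
  (G_solvable : solvable_group G)
  (c : chart 'rV[R]_n G) (c_atlas : atlas G c) (c_at1 : chart_dom c 1%g)
  (a : 'M[R]_n) (a_hull : Ad_alg c a)
  (alpha : G -> G) (alpha_a : integrates c a alpha)
  (z : G) (z_center : group_center G z) :
  alpha z = z.
Proof.
exact: (aut_center c_atlas c_at1 G_connected G_solvable a_hull alpha_a z_center).
Qed.
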